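(* Let $q\in\mathcal{GC}^\infty([t_1,t_2],\widetilde{\mathbb R}^d)$ and $Q\in\mathcal{GC}^\infty([t_1,t_2]\times\widetilde{\mathbb R}^{d(m+1)},\widetilde{\mathbb R}^d)$, and assume that the functional $J$ satisfies at $q$ the D'Alembert principle with generalized forces $Q$, i.e. $$\delta J(q;h)=\int_{t_1}^{t_2}h(t)\cdot Q[q]^m(t)\,dt\qquad\forall h\in\mathcal{GC}^\infty_0(t_1,t_2).$$ Then $$\sum_{i=0}^{m}(-1)^i\frac{d^i}{dt^i}\,\partial_{i+2}L[q]^m(t)=Q[q]^m(t)\qquad\forall t\in[t_1,t_2].$$
   Context: Ring of scalars. Fix a net $\rho=(\rho_\varepsilon)_{\varepsilon\in(0,1]}$ in $(0,1]$ with $\rho_\varepsilon\to0$ as $\varepsilon\to0^+$. ''For $\varepsilon$ small'' means: for all $\varepsilon\in(0,\varepsilon_0]$, for some $\varepsilon_0\in(0,1]$. A net $(x_\varepsilon)\in\mathbb R^{(0,1]}$ is moderate if there is $N\in\mathbb N$ with $|x_\varepsilon|\le\rho_\varepsilon^{-N}$ for $\varepsilon$ small; $(x_\varepsilon)\sim(y_\varepsilon)$ if for all $n\in\mathbb N$, $|x_\varepsilon-y_\varepsilon|\le\rho_\varepsilon^n$ for $\varepsilon$ small. $\widetilde{\mathbb R}$ is the ring of moderate nets modulo $\sim$ with pointwise operations; classes are written $[x_\varepsilon]$, similarly for $\widetilde{\mathbb R}^n$. Order: $x\le y$ iff there are representatives $x=[x_\varepsilon]$, $y=[y_\varepsilon]$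 with $x_\varepsilon\le y_\varepsilon$ for all $\varepsilon$; $x<y$ means $x\le y$ and $y-x$ is invertible; $\widetilde{\mathbb R}_{>0}=\{x: x>0\}$. $[a,b]=\{x\in\widetilde{\mathbb R}: a\le x\le b\}$, $(a,b)=\{x: a<x<b\}$, $|[x_\varepsilon]|=[|x_\varepsilon|]$, $B_r(c)=\{x\in\widetilde{\mathbb R}^n:|x-c|<r\}$ for $r\in\widetilde{\mathbb R}_{>0}$. The sharp topology on $\widetilde{\mathbb R}^n$ has these balls as a base; all topological notions refer to it. Generalized smooth functions (GSF). For $\Omega_\varepsilon\subseteq\mathbb R^n$, $\langle\Omega_\varepsilon\rangle$ is the set of $[x_\varepsilon]\in\widetilde{\mathbb R}^n$ such that for every representative $(x'_\varepsilon)$ one has $x'_\varepsilon\in\Omega_\varepsilon$ for $\varepsilon$ small. For $X\subseteq\widetilde{\mathbb R}^n$, $Y\subseteq\widetilde{\mathbb R}^k$, a map $f:X\to Y$ is a GSF, $f\in\mathcal{GC}^\infty(X,Y)$, if there is a net $f_\varepsilon\in C^\infty(\Omega_\varepsilon,\mathbb R^k)$, $\Omega_\varepsilon\subseteq\mathbb R^n$ open, with $X\subseteq\langle\Omega_\varepsilon\rangle$, $f([x_\varepsilon])=[f_\varepsilon(x_\varepsilon)]\in Y$ and $(\partial^\alpha f_\varepsilon(x_\varepsilon))$ moderate for all $[x_\varepsilon]\in X$ and all multi-indices $\alpha$ (one may always choose $\Omega_\varepsilon=\mathbb R^n$). Derivatives at sharply interior points are $\partial^\alpha f([x_\varepsilon])=[\partial^\alpha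 f_\varepsilon(x_\varepsilon)]$ (independent of choices), and at endpoints of intervals they are the sharp limits from interior points. For $f\in\mathcal{GC}^\infty([a,b],\widetilde{\mathbb R})$ and $c=[c_\varepsilon],e=[e_\varepsilon]\in[a,b]$, $\int_c^e f(t)\,dt=[\int_{c_\varepsilon}^{e_\varepsilon}f_\varepsilon(t)\,dt]$ for any $f_\varepsilon\in C^\infty(\mathbb R,\mathbb R)$ defining $f$. Variational setting. Let $t_1<t_2$ in $\widetilde{\mathbb R}$, $d,m\in\mathbb N_{>0}$, $L\in\mathcal{GC}^\infty([t_1,t_2]\times\widetilde{\mathbb R}^{d(m+1)},\widetilde{\mathbb R})$. For $q\in\mathcal{GC}^\infty([t_1,t_2],\widetilde{\mathbb R}^d)$ set $[q]^m(t)=(t,q(t),\dot q(t),\ldots,q^{(m)}(t))$, $L[q]^m(t)=L(t,q(t),\ldots,q^{(m)}(t))$, $Q[q]^m(t)=Q(t,q(t),\ldots,q^{(m)}(t))$, $J[q]=J(q)=\int_{t_1}^{t_2}L[q]^m(t)\,dt$. $\partial_{i+2}L$ ($0\le i\le m$) is the gradient of $L$ with respect to the $\widetilde{\mathbb R}^d$-argument into which $q^{(i)}$ is inserted; $\partial_jL[q]^m(t)$ is $\partial_jL$ evaluated at $[q]^m(t)$. $\mathcal{GC}^\infty_0(t_1,t_2)$ is the set of $h\in\mathcal{GC}^\infty([t_1,t_2],\widetilde{\mathbb R}^d)$ with $h^{(i)}(t_1)=h^{(i)}(t_2)=0$ for all $i\in\mathbb N$. First variation: $\delta J(q;h)=\frac{d}{ds}J(q+sh)|_{s=0}$.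 *)

(* Defs.v *)
From HB Require Import structures.
From mathcomp Require Import all_boot all_order all_algebra ring_quotient.
From mathcomp Require Import all_classical all_reals all_analysis.
Set Implicit Arguments.
Unset Strict Implicit.
Unset Printing Implicit Defensive.
Import Order.TTheory GRing.Theory Num.Theory.
Import numFieldNormedType.Exports.
Local Open Scope classical_set_scope.
Local Open Scope ring_scope.

(* Nets indexed by (0,1] are functions on R; their values outside (0,1] are
   never used.  "For eps small" is [\forall e \near 0^'+, _].               *)

Record gauge (R : realType) := Gauge {
  gauge_fun :> R -> R ;
  gauge_itv : forall e, 0 < e <= 1 -> 0 < gauge_fun e <= 1 ;
  gauge_cvg : gauge_fun e @[e --> 0^'+] --> 0 }.

Section Ring.
Variables (R : realType) (rho : gauge R).
Implicit Types u v : R -> R.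

Definition moderate u :=
  exists N : nat, \forall e \near 0^'+, `|u e| <= (rho e)^-1 ^+ N.

Definition negligible u :=
  forall n : nat, \forall e \near 0^'+, `|u e| <= rho e ^+ n.

Lemma near_itv01 : \forall e \near (0 : R)^'+, 0 < e <= 1.
Proof.
near=> e; apply/andP; split; near: e; first exact: nbhs_right_gt.
exact: nbhs_right_le.
Unshelve. all: by end_near. Qed.

Lemma near_gauge : \forall e \near 0^'+, 0 < rho e <= 1.
Proof.
apply: filterS near_itv01 => e; exact: gauge_itv.
Qed.

Lemma near_gauge_lt c : 0 < c -> \forall e \near 0^'+, rho e < c.
Proof. by move=> c0; apply: (cvgr_lt _ (gauge_cvg rho)). Qed.

Lemma moderate_subring : subring_closed [pred u | `[< moderate u >]].
Proof.
have mono (N M : nat) (e : R) : 0 < rho e <= 1 -> (N <= M)%N ->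
    (rho e)^-1 ^+ N <= (rho e)^-1 ^+ M.
  by move=> /andP[r0 r1] NM; rewrite ler_weXn2l// invf_ge1.
split=> [|u v|u v].
- apply/asboolP; exists 0%N; near=> e.
  by rewrite expr0 normr1.
- move=> /asboolP[N uN] /asboolP[M vM]; apply/asboolP; exists (maxn N M).+1.
  near=> e.
  have re : 0 < rho e <= 1 by near: e; exact: near_gauge.
  have /andP[r0 r1] := re.
  have r2 : 2 <= (rho e)^-1.
    rewrite -[leLHS]invrK lef_pV2 ?posrE ?invr_gt0//.
    by apply/ltW; near: e; apply: near_gauge_lt.
  apply: (le_trans (ler_normB _ _)).
  rewrite exprS; apply: (@le_trans _ _ (2 * (rho e)^-1 ^+ maxn N M)).
    rewrite mulr_natl mulr2n lerD//.
      apply: (le_trans _ (mono _ _ _ re (leq_maxl N M))); near: e; exact: uN.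
    apply: (le_trans _ (mono _ _ _ re (leq_maxr N M))); near: e; exact: vM.
  by rewrite ler_wpM2r// exprn_ge0// invr_ge0 ltW.
- move=> /asboolP[N uN] /asboolP[M vM]; apply/asboolP; exists (N + M)%N.
  near=> e.
  rewrite [X in `|X|](_ : _ = u e * v e)// normrM exprD.
  rewrite ler_pM//; near: e; [exact: uN | exact: vM].
Unshelve. all: by end_near. Qed.

Definition moderate_pred : {pred R -> R} := [pred u | `[< moderate u >]].

HB.instance Definition _ :=
  GRing.isSubringClosed.Build (R -> R) moderate_pred moderate_subring.

Record modnet := Modnet {
  modnet_val : R -> R ;
  _ : modnet_val \in moderate_pred }.
HB.instance Definition _ := [isSub for modnet_val].
HB.instance Definition _ := [Choice of modnet by <:].
HB.instance Definition _ := [SubChoice_isSubComNzRing of modnet by <:].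

Definition negligible_pred : {pred modnet} :=
  [pred u : modnet | `[< negligible (val u) >]].

Lemma negligible_idealr : idealr_closed negligible_pred.
Proof.
split.
- apply/asboolP => n; near=> e.
  rewrite [X in `|X|](_ : _ = 0)// normr0 exprn_ge0//.
  by have /andP[/ltW] : 0 < rho e <= 1 by near: e; exact: near_gauge.
- apply/negP => /asboolP /(_ 1%N) n1.
  have n2 : \forall e \near (0 : R)^'+, False.
    near=> e.
    have : rho e < 1 by near: e; exact: near_gauge_lt.
    rewrite ltNge => /negP; apply.
    have : `|(val (1 : modnet)) e| <= rho e ^+ 1 by near: e.
    by rewrite [X in `|X|](_ : _ = 1)// normr1 expr1.
  by have /filter_ex[] := n2.
- move=> a u v /asboolP ui /asboolP vi; apply/asboolP => n.
  have /asboolP[N aN] := valP a.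
  near=> e.
  have /andP[r0 r1] : 0 < rho e <= 1 by near: e; exact: near_gauge.
  rewrite [X in `|X|](_ : _ = val a e * val u e + val v e)//.
  apply: (le_trans (ler_normD _ _)); rewrite normrM.
  have ae : `|val a e| <= (rho e)^-1 ^+ N by near: e; exact: aN.
  have ue : `|val u e| <= rho e ^+ (N + n.+1) by near: e; exact: ui.
  have ve : `|val v e| <= rho e ^+ n.+1 by near: e; exact: vi.
  have r2 : 2 * rho e <= 1.
    rewrite mulrC -ler_pdivlMr// mul1r.
    by apply/ltW; near: e; apply: near_gauge_lt.
  apply: (@le_trans _ _ (rho e ^+ n.+1 + rho e ^+ n.+1)).
    apply: lerD => //; apply: (le_trans (ler_pM _ _ ae ue)) => //.
    by rewrite exprD mulrA -exprMn mulVf ?gt_eqF// expr1n mul1r.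
  rewrite -mulr2n -mulr_natl exprS mulrA -[leRHS]mul1r.
  by rewrite ler_wpM2r// exprn_ge0// ltW.
Unshelve. all: by end_near. Qed.

HB.instance Definition _ :=
  isIdealr.Build modnet negligible_pred negligible_idealr.

Definition Rtilde := {ideal_quot negligible_pred}.
HB.instance Definition _ := GRing.ComNzRing.on Rtilde.

End Ring.

(* Points of Rtilde^n are row vectors of generalized numbers: the class of a
   moderate net in R^n is identified with the vector of the classes of its
   coordinates.                                                             *)
Section Points.
Variables (R : realType) (rho : gauge R).
Local Notation Rt := (Rtilde rho).

(* [gnum u x] : the net u is moderate and x = [u_eps] *)
Definition gnum (u : R -> R) (x : Rt) :=
  exists v : modnet rho,
    val v = u /\ \pi_({ideal_quot @negligible_pred R rho})%qT v = x.

(* [gvec u x] : x = [u_eps] in Rtilde^n *)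
Definition gvec n (u : R -> 'rV[R]_n) (x : 'rV[Rt]_n) :=
  forall j, gnum (fun e => u e 0 j) (x 0 j).

Definition gle (x y : Rt) := exists u v : R -> R,
  [/\ gnum u x, gnum v y & forall e, 0 < e <= 1 -> u e <= v e].

Definition glt (x y : Rt) := gle x y /\ exists z, z * (y - x) = 1.

Definition gitv (a b : Rt) : set Rt := [set x | gle a x /\ gle x b].

(* Euclidean norm; the library's norm on row vectors is the maximum norm *)
Definition enorm n (x : 'rV[R]_n) : R := Num.sqrt (\sum_j x 0 j ^+ 2).

Definition gnorm n (x : 'rV[Rt]_n) : Rt :=
  xget 0 [set y | exists2 u, gvec u x & gnum (fun e => enorm (u e)) y].

Definition gball n (c : 'rV[Rt]_n) (r : Rt) : set 'rV[Rt]_n :=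
  [set x | glt (gnorm (x - c)) r].

(* neighbourhood filter of x in the sharp topology *)
Definition sharp_nbhs n (x : 'rV[Rt]_n) : set_system 'rV[Rt]_n :=
  filter_from [set r | glt 0 r] (gball x).

Definition sharp_interior n (X : set 'rV[Rt]_n) : set 'rV[Rt]_n :=
  [set x | sharp_nbhs x X].

Definition internal n (Omega : R -> set 'rV[R]_n) : set 'rV[Rt]_n :=
  [set x | forall u, gvec u x -> \forall e \near 0^'+, Omega e (u e)].

End Points.

Section ClassicalDerivatives.
Variables (R : realType) (n k : nat).
Implicit Types f : 'rV[R]_n -> 'rV[R]_k.

Definition partials (s : seq 'I_n) f : 'rV[R]_n -> 'rV[R]_k :=
  foldr (fun i g => 'D_(delta_mx 0 i) g) f s.

(* For smooth f the order of differentiation is immaterial. *)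
Definition mpartial (alpha : 'I_n -> nat) f : 'rV[R]_n -> 'rV[R]_k :=
  partials (flatten [seq nseq (alpha i) i | i <- enum 'I_n]) f.

Definition smooth_on (Omega : set 'rV[R]_n) f :=
  forall x, Omega x -> forall s : seq 'I_n,
    {for x, continuous (partials s f)} /\
    forall i, derivable (partials s f) x (delta_mx 0 i).

End ClassicalDerivatives.

(* Maps defined on X are total functions whose values outside X are never
   used.                                                                    *)
Section GSF.
Variables (R : realType) (rho : gauge R).
Local Notation Rt := (Rtilde rho).

Definition gsf_defined_by n k (X : set 'rV[Rt]_n) (f : 'rV[Rt]_n -> 'rV[Rt]_k)
    (Omega : R -> set 'rV[R]_n) (F : R -> 'rV[R]_n -> 'rV[R]_k) :=
  [/\ forall e, 0 < e <= 1 -> open (Omega e) /\ smooth_on (Omega e) (F e),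
      X `<=` @internal R rho n Omega &
      forall x u, X x -> gvec u x ->
        gvec (fun e => F e (u e)) (f x) /\
        forall alpha, moderate rho (fun e => enorm (mpartial alpha (F e) (u e)))].

Definition gsf n k (X : set 'rV[Rt]_n) (Y : set 'rV[Rt]_k)
    (f : 'rV[Rt]_n -> 'rV[Rt]_k) :=
  (exists Omega F, gsf_defined_by X f Omega F) /\ forall x, X x -> Y (f x).

(* Meaningful at sharply interior points x of X, where y exists and does not
   depend on the chosen nets.                                               *)
Definition gderive_int n k (X : set 'rV[Rt]_n) (f : 'rV[Rt]_n -> 'rV[Rt]_k)
    (alpha : 'I_n -> nat) (x : 'rV[Rt]_n) : 'rV[Rt]_k :=
  xget 0 [set y | exists Omega F u,
    [/\ gsf_defined_by X f Omega F, gvec u x &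
        gvec (fun e => mpartial alpha (F e) (u e)) y]].

(* At the points of X that are not sharply interior, the derivative is the
   sharp limit of its values at sharply interior points.                    *)
Definition gderive n k (X : set 'rV[Rt]_n) (f : 'rV[Rt]_n -> 'rV[Rt]_k)
    (alpha : 'I_n -> nat) (x : 'rV[Rt]_n) : 'rV[Rt]_k :=
  if `[< sharp_interior X x >] then gderive_int X f alpha x
  else xget 0 [set y |
    gderive_int X f alpha @ within (sharp_interior X) (sharp_nbhs x)
      `=>` sharp_nbhs y].

(* Rtilde identified with Rtilde^1, on the source and on the target *)
Definition of_num k (c : Rt -> 'rV[Rt]_k) : 'rV[Rt]_1 -> 'rV[Rt]_k :=
  fun x => c (x 0 0).
Definition to_num (T : Type) (g : T -> Rt) : T -> 'rV[Rt]_1 :=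
  fun x => const_mx (g x).
Definition num_set (A : set Rt) : set 'rV[Rt]_1 := [set x | A (x 0 0)].

Definition gsf1 k (A : set Rt) (c : Rt -> 'rV[Rt]_k) :=
  gsf (num_set A) setT (of_num c).

Definition gderive1n k (A : set Rt) (i : nat) (c : Rt -> 'rV[Rt]_k) (t : Rt) :
    'rV[Rt]_k :=
  if i is 0%N then c t
  else gderive (num_set A) (of_num c) (fun=> i) (const_mx t).

Definition oriented_integral (a b : R) (f : R -> R) : R :=
  if a <= b then \int[lebesgue_measure]_(x in `[a, b]) f x
  else - \int[lebesgue_measure]_(x in `[b, a]) f x.

(* [gintegral a b f c e] is the integral from c to e of f : [a,b] -> Rtilde *)
Definition gintegral (a b : Rt) (f : Rt -> Rt) (c e : Rt) : Rt :=
  xget 0 [set y | exists F u v,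
    [/\ gsf_defined_by (num_set (gitv a b)) (of_num (to_num f)) (fun=> setT) F,
        gnum u c, gnum v e &
        gnum (fun eps => oriented_integral (u eps) (v eps)
                           (fun t => F eps (const_mx t) 0 0)) y]].

End GSF.

Section Variational.
Variables (R : realType) (rho : gauge R).
Local Notation Rt := (Rtilde rho).
Variables (t1 t2 : Rt) (d m : nat).

(* Rtilde^(1 + d(m+1)); the coordinates after the first one are the entries
   of an (m+1) x d matrix whose i-th row is the argument of q^(i).          *)
Definition jet_space := 'rV[Rt]_(1 + m.+1 * d).

Definition jet_box : set jet_space := [set x | gitv t1 t2 (lsubmx x 0 0)].

Definition jet (q : Rt -> 'rV[Rt]_d) (t : Rt) : jet_space :=
  row_mx (const_mx t)
    (mxvec (\matrix_(i < m.+1) gderive1n (gitv t1 t2) i q t)).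

Definition jet_grad (i : 'I_m.+1) (L : jet_space -> Rt) (x : jet_space) :
    'rV[Rt]_d :=
  \row_j gderive jet_box (to_num L)
           (fun l => (l == rshift 1 (mxvec_index i j)) : nat) x 0 0.

Definition action (L : jet_space -> Rt) (q : Rt -> 'rV[Rt]_d) : Rt :=
  gintegral t1 t2 (fun t => L (jet q t)) t1 t2.

Definition first_variation (J : (Rt -> 'rV[Rt]_d) -> Rt)
    (q h : Rt -> 'rV[Rt]_d) : Rt :=
  gderive1n setT 1 (to_num (fun s => J (fun t => q t + s *: h t))) 0 0 0.

Definition gsf_flat (h : Rt -> 'rV[Rt]_d) :=
  gsf1 (gitv t1 t2) h /\
  forall i, gderive1n (gitv t1 t2) i h t1 = 0 /\
            gderive1n (gitv t1 t2) i h t2 = 0.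

Definition dot (x y : 'rV[Rt]_d) : Rt := \sum_j x 0 j * y 0 j.

End Variational.

(* Main.v *)
Require Import Defs.
From HB Require Import structures.
From mathcomp Require Import all_boot all_order all_algebra ring_quotient.
From mathcomp Require Import all_classical all_reals all_analysis.
From mathcomp Require Import ring lra.
Require Import Defs.
(** Everything is computed on representatives.  Write A, B for nets
    representing t1, t2, and let rho^N stand for the net of the N-th powers of
    the gauge.

    A curve on [t1,t2] is represented by a net of smooth functions on the
    whole real line all of whose derivatives are moderate at the nets
    representing points of [t1,t2] (predicate [tame]; existence in
    [global_rep]).  Two facts make such nets manageable.  By [saturation], an
    estimate that holds along every net representing a point of [t1,t2] holds
    uniformly on [A - rho^N, B + rho^N] for some N.  By [gderive_net] and
    [gintegral_net], derivatives (also at the end points, where they are sharp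
    limits) and integrals are the classes of the classical derivatives and
    integrals of any representing net.  The first rests on
    [smooth_net_negl], negligible values force negligible derivatives, and on
    the symmetry of higher partial derivatives, since moderateness is
    required only for the sorted ones.

    With representatives fq of q and fh of h, the curve s |-> J(q + s h) is
    represented by the integrals of L along the jet of fq + s fh.  This net is
    smooth in s by differentiation under the integral sign, so that
    ([first_variation_net], [variation_expand])

      delta J (q; h) = sum over i, j of the class of
        the integral from A to B of dL/dq_j^(i) (jet of fq) * fh_j^(i).

    If all fh_j vanish outside ]A,B[ then h is flat at t1 and t2, and i
    integrations by parts ([itvint_parts_iter]) move the derivatives onto
    dL/dq_j^(i).  D'Alembert's principle then says that the integral of
    sum_j E_j fh_j is negligible, where the E_j represent the components of
    the difference of both sides of the Euler-Lagrange equation.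

    It remains to conclude that the E_j are negligible ([fundamental_lemma]).
    The principle is applied to fh_j = E_j w, where w >= 0 is a smooth bump
    that vanishes outside ]A,B[ and is bounded below on
    [A + rho^k, B - rho^k].  If |E_j(t0)| > rho^n, then, since E_j' is at most
    rho^-M, |E_j| exceeds rho^n / 2 on an interval of length rho^k next to t0
    on which w is bounded below, as soon as k is large compared with n and M.
    Hence the integral is at least a constant times rho^(2n+k), which a
    negligible net cannot be. *)

Set Implicit Arguments.
Unset Strict Implicit.
Unset Printing Implicit Defensive.
Import Order.TTheory GRing.Theory Num.Theory.
Import numFieldNormedType.Exports.
Local Open Scope classical_set_scope.
Local Open Scope ring_scope.

(** * Nets, generalized numbers and their order *)

Section Nets.
Variables (R : realType) (rho : gauge R).
Local Notation Rt := (Rtilde rho).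
Implicit Types u v w : R -> R.

Lemma rho_expW e m n : 0 < rho e <= 1 -> (m <= n)%N -> rho e ^+ n <= rho e ^+ m.
Proof. by move=> /andP[r0 r1] mn; rewrite ler_wiXn2l// ltW. Qed.

Lemma rho_invW e m n : 0 < rho e <= 1 -> (m <= n)%N ->
  (rho e)^-1 ^+ m <= (rho e)^-1 ^+ n.
Proof. by move=> /andP[r0 r1] mn; rewrite ler_weXn2l// invf_ge1. Qed.

Lemma moderate_predP u : reflect (moderate rho u) (u \in moderate_pred rho).
Proof. exact: asboolP. Qed.

Lemma negligible_predP (u : modnet rho) :
  reflect (negligible rho (val u)) (u \in @negligible_pred R rho).
Proof. exact: asboolP. Qed.

Lemma moderate_cls u : moderate rho u -> u \in moderate_pred rho.
Proof. by move/moderate_predP. Qed.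

Lemma moderateB u v : moderate rho u -> moderate rho v ->
  moderate rho (fun e => u e - v e).
Proof.
move=> /moderate_cls hu /moderate_cls hv.
exact/moderate_predP/(rpredB hu hv).
Qed.

Lemma moderateD u v : moderate rho u -> moderate rho v ->
  moderate rho (fun e => u e + v e).
Proof.
move=> /moderate_cls hu /moderate_cls hv.
exact/moderate_predP/(rpredD hu hv).
Qed.

Lemma moderateM u v : moderate rho u -> moderate rho v ->
  moderate rho (fun e => u e * v e).
Proof.
move=> /moderate_cls hu /moderate_cls hv.
by have [_ _ H] := moderate_subring rho; apply/moderate_predP/(H u v hu hv).
Qed.

Lemma moderateN u : moderate rho u -> moderate rho (fun e => - u e).
Proof.
move=> /moderate_cls hu; apply/moderate_predP.
by rewrite -[X in X \in _]/(- u) rpredN.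
Qed.

Lemma moderate_le u v : (\forall e \near 0^'+, `|u e| <= `|v e|) ->
  moderate rho v -> moderate rho u.
Proof.
move=> uv [N vN]; exists N.
by apply: filterS2 uv vN => e; exact: le_trans.
Qed.

Lemma moderate_cst (c : R) : moderate rho (fun=> c).
Proof.
exists 1%N; near=> e; rewrite expr1.
have /andP[r0 r1] : 0 < rho e <= 1 by near: e; exact: near_gauge.
have : rho e < (`|c| + 1)^-1.
  by near: e; apply: near_gauge_lt; rewrite invr_gt0 ltr_pwDr.
have c0 : 0 < `|c| + 1 by rewrite ltr_pwDr.
rewrite -{1}[rho e]invrK ltf_pV2 ?posrE ?invr_gt0// => h.
by apply: le_trans (ltW h); rewrite lerDl.
Unshelve. all: by end_near. Qed.

Lemma moderate_rhoV N : moderate rho (fun e => (rho e)^-1 ^+ N).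
Proof.
exists N; near=> e; rewrite ger0_norm// exprn_ge0// invr_ge0.
by have /andP[/ltW] : 0 < rho e <= 1 by near: e; exact: near_gauge.
Unshelve. all: by end_near. Qed.

Lemma moderate_rho N : moderate rho (fun e => rho e ^+ N).
Proof.
exists 0%N; near=> e; rewrite expr0.
have /andP[r0 r1] : 0 < rho e <= 1 by near: e; exact: near_gauge.
by rewrite ger0_norm ?exprn_ile1 ?exprn_ge0// ltW.
Unshelve. all: by end_near. Qed.

Lemma moderate_sum (I : Type) (s : seq I) (F : I -> R -> R) :
  (forall i, moderate rho (F i)) -> moderate rho (fun e => \sum_(i <- s) F i e).
Proof.
move=> hF; elim: s => [|i s IH].
  rewrite [X in moderate _ X](_ : _ = fun=> 0); first exact: moderate_cst.
  by apply/funext => e; rewrite big_nil.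
rewrite [X in moderate _ X](_ : _ = fun e => F i e + \sum_(i <- s) F i e).
  exact: moderateD.
by apply/funext => e; rewrite big_cons.
Qed.

Lemma negligible_moderate u : negligible rho u -> moderate rho u.
Proof.
move=> /(_ 0%N); rewrite /moderate => h; exists 0%N.
by apply: filterS h => e; rewrite !expr0.
Qed.

Lemma negligible_le u v : (\forall e \near 0^'+, `|u e| <= `|v e|) ->
  negligible rho v -> negligible rho u.
Proof. by move=> uv vN n; apply: filterS2 uv (vN n) => e; exact: le_trans. Qed.

Lemma negligible_near0 u : (\forall e \near 0^'+, u e = 0) -> negligible rho u.
Proof.
move=> h n; near=> e; have -> : u e = 0 by near: e.
have /andP[r0 r1] : 0 < rho e <= 1 by near: e; exact: near_gauge.
by rewrite normr0 exprn_ge0// ltW.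
Unshelve. all: by end_near. Qed.

Lemma negligibleDM w u v : moderate rho w -> negligible rho u ->
  negligible rho v -> negligible rho (fun e => w e * u e + v e).
Proof.
move=> hw hu hv.
have hu' := moderate_cls (negligible_moderate hu).
have hv' := moderate_cls (negligible_moderate hv).
have [_ _ H] := negligible_idealr rho.
have hU : Modnet hu' \in negligible_pred (rho:=rho) by apply/negligible_predP.
have hV : Modnet hv' \in negligible_pred (rho:=rho) by apply/negligible_predP.
by move: (H (Modnet (moderate_cls hw)) _ _ hU hV) => /negligible_predP.
Qed.

Lemma negligibleD u v : negligible rho u -> negligible rho v ->
  negligible rho (fun e => u e + v e).
Proof.
move=> hu hv; apply: (negligible_le _ (negligibleDM (moderate_cst 1) hu hv)).
by apply: nearW => e; rewrite mul1r.
Qed.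

Lemma gnum_moderate u (x : Rt) : gnum u x -> moderate rho u.
Proof. by move=> [v [<- _]]; apply/moderate_predP/valP. Qed.

Lemma gnum_ex (x : Rt) : exists u, gnum u x.
Proof. by exists (val (repr x)); exists (repr x); rewrite reprK. Qed.

Lemma moderate_gnum u : moderate rho u -> exists x : Rt, gnum u x.
Proof.
move=> /moderate_cls hu.
by exists (\pi_({ideal_quot @negligible_pred R rho})%qT (Modnet hu)); exists (Modnet hu).
Qed.

(** Representatives are handled through this lemma only: the quotient
    construction is not looked into afterwards, except for the ring operations. *)
Lemma gnumP u v (x : Rt) (y : Rt) : gnum u x -> gnum v y ->
  x = y <-> negligible rho (fun e => u e - v e).
Proof.
move=> [a [<- <-]] [b [<- <-]]; split.
  move/eqP; rewrite -Quotient.idealrBE => /negligible_predP H; exact: H.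
by move=> h; apply/eqP; rewrite -Quotient.idealrBE; apply/negligible_predP/h.
Qed.

Lemma gnum_eq u v (x : Rt) : gnum u x -> gnum v x ->
  negligible rho (fun e => u e - v e).
Proof. by move=> ux vx; apply/(gnumP ux vx). Qed.

Lemma gnum_inj u (x y : Rt) : gnum u x -> gnum u y -> x = y.
Proof.
move=> ux uy; apply/(gnumP ux uy); apply: negligible_near0.
by apply: nearW => e; rewrite subrr.
Qed.

Lemma gnum_negl u v (x : Rt) : gnum u x ->
  negligible rho (fun e => v e - u e) -> gnum v x.
Proof.
move=> ux vu.
have mv : moderate rho v.
  apply: (moderate_le _ (moderateD (negligible_moderate vu) (gnum_moderate ux))).
  by apply: nearW => e; rewrite subrK.
have [y vy] := moderate_gnum mv.
by rewrite -((gnumP vy ux).2 vu).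
Qed.

Lemma gnum_near u v (x : Rt) : gnum u x ->
  (\forall e \near 0^'+, v e = u e) -> gnum v x.
Proof.
move=> ux vu; apply: (gnum_negl ux); apply: negligible_near0.
by apply: filterS vu => e ->; rewrite subrr.
Qed.

Lemma gnumD u v (x y : Rt) : gnum u x -> gnum v y ->
  gnum (fun e => u e + v e) (x + y).
Proof.
by move=> [a [<- <-]] [b [<- <-]]; exists (a + b); split; [by []|rewrite !piE].
Qed.

Lemma gnumN u (x : Rt) : gnum u x -> gnum (fun e => - u e) (- x).
Proof. by move=> [a [<- <-]]; exists (- a); split; [by []|rewrite !piE]. Qed.

Lemma gnumB u v (x y : Rt) : gnum u x -> gnum v y ->
  gnum (fun e => u e - v e) (x - y).
Proof. by move=> ux vy; apply: gnumD => //; apply: gnumN. Qed.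

Lemma gnumM u v (x y : Rt) : gnum u x -> gnum v y ->
  gnum (fun e => u e * v e) (x * y).
Proof.
by move=> [a [<- <-]] [b [<- <-]]; exists (a * b); split; [by []|rewrite !piE].
Qed.

Lemma gnum1 : gnum (fun=> 1) (1 : Rt).
Proof. by exists 1; split; [by []|rewrite !piE]. Qed.

Lemma gnum0 : gnum (fun=> 0) (0 : Rt).
Proof. by exists 0; split; [by []|rewrite !piE]. Qed.

Lemma gnum_sum (I : Type) (s : seq I) (F : I -> R -> R) (G : I -> Rt) :
  (forall i, gnum (F i) (G i)) ->
  gnum (fun e => \sum_(i <- s) F i e) (\sum_(i <- s) G i).
Proof.
move=> hF; elim: s => [|i s IH].
  by rewrite big_nil; apply: (gnum_near gnum0); apply: nearW => e; rewrite big_nil.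
rewrite big_cons; apply: (gnum_near (gnumD (hF i) IH)).
by apply: nearW => e; rewrite big_cons.
Qed.

Lemma gle_net u v (x y : Rt) : gnum u x -> gnum v y -> gle x y ->
  forall n, \forall e \near 0^'+, u e <= v e + rho e ^+ n.
Proof.
move=> ux vy [u' [v' [ux' vy' uv']]] n.
have := negligibleD (gnum_eq ux ux') (gnum_eq vy' vy).
move=> /(_ n) H; near=> e.
have : u' e <= v' e by apply: uv'; near: e; exact: near_itv01.
have : `|u e - u' e + (v' e - v e)| <= rho e ^+ n by near: e.
by rewrite ler_norml => /andP[_]; lra.
Unshelve. all: by end_near. Qed.

(** The representative required by the order is the minimum of u and v, which
    differs from u by less than every power of rho. *)
Lemma net_gle u v (x y : Rt) : gnum u x -> gnum v y ->
  (forall n, \forall e \near 0^'+, u e <= v e + rho e ^+ n) -> gle x y.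
Proof.
move=> ux vy h; exists (fun e => Num.min (u e) (v e)), v; split=> //; last first.
  by move=> e _; rewrite ge_min lexx orbT.
apply: (gnum_negl ux) => n; near=> e.
have : u e <= v e + rho e ^+ n by near: e.
have /andP[r0 r1] : 0 < rho e <= 1 by near: e; exact: near_gauge.
have : 0 <= rho e ^+ n by rewrite exprn_ge0// ltW.
rewrite /Num.min; case: ltP => vu rn uv; first by rewrite subrr normr0.
by rewrite ler_norml; lra.
Unshelve. all: by end_near. Qed.

Lemma net_gle0 u v (x y : Rt) : gnum u x -> gnum v y ->
  (\forall e \near 0^'+, u e <= v e) -> gle x y.
Proof.
move=> ux vy h; apply: (net_gle ux vy) => n; near=> e.
have : u e <= v e by near: e.
have /andP[r0 r1] : 0 < rho e <= 1 by near: e; exact: near_gauge.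
have : 0 <= rho e ^+ n by rewrite exprn_ge0// ltW.
lra.
Unshelve. all: by end_near. Qed.

(** The inverse of y - x is bounded by some rho^-N, so |v - u| > rho^(N+1);
    the sign comes from x <= y.  Together with [net_glt] this turns the strict
    order into a lower bound of the gap by a power of rho. *)
Lemma glt_net u v (x y : Rt) : gnum u x -> gnum v y -> glt x y ->
  exists N, \forall e \near 0^'+, u e + rho e ^+ N <= v e.
Proof.
move=> ux vy [xy [z zxy]].
have [w wz] := gnum_ex z.
have := gnum_eq (gnumM wz (gnumB vy ux)); rewrite zxy => /(_ _ gnum1) /(_ 1%N) H.
have [N wN] := gnum_moderate wz.
exists N.+1; have uv := gle_net ux vy xy N.+1.
near=> e.
have /andP[r0 r1] : 0 < rho e <= 1 by near: e; exact: near_gauge.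
have r2 : rho e < 1/2 by near: e; apply: near_gauge_lt; lra.
have h1 : `|w e * (v e - u e) - 1| <= rho e ^+ 1 by near: e.
have h2 : `|w e| <= (rho e)^-1 ^+ N by near: e.
have h3 : u e <= v e + rho e ^+ N.+1 by near: e.
have rN : 0 < rho e ^+ N by rewrite exprn_gt0.
suff h4 : rho e ^+ N.+1 < `|v e - u e|.
  move: h4; rewrite lter_normr; case/orP; lra.
have h5 : 1/2 < `|w e * (v e - u e)|.
  move: h1; rewrite expr1 ler_norml => /andP[h1 _].
  by apply: lt_le_trans (ler_norm _); lra.
rewrite normrM in h5.
have h6 : 1/2 < (rho e)^-1 ^+ N * `|v e - u e|.
  by apply: (lt_le_trans h5); rewrite ler_wpM2r.
rewrite exprVn ltr_pdivlMl// in h6.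
by apply: le_lt_trans h6; rewrite exprSr ler_wpM2l// ltW.
Unshelve. all: by end_near. Qed.

Lemma net_glt u v (x y : Rt) N : gnum u x -> gnum v y ->
  (\forall e \near 0^'+, u e + rho e ^+ N <= v e) -> glt x y.
Proof.
move=> ux vy h; split.
  apply: (net_gle0 ux vy); near=> e.
  have : u e + rho e ^+ N <= v e by near: e.
  have /andP[r0 r1] : 0 < rho e <= 1 by near: e; exact: near_gauge.
  have : 0 <= rho e ^+ N by rewrite exprn_ge0// ltW.
  lra.
have mw : moderate rho (fun e => (v e - u e)^-1).
  exists N; near=> e.
  have h' : u e + rho e ^+ N <= v e by near: e.
  have /andP[r0 r1] : 0 < rho e <= 1 by near: e; exact: near_gauge.
  have rN : 0 < rho e ^+ N by rewrite exprn_gt0.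
  have uv : 0 < v e - u e by lra.
  rewrite normfV gtr0_norm// exprVn lef_pV2 ?posrE//; lra.
have [z wz] := moderate_gnum mw.
exists z; apply: (gnum_inj (gnumM wz (gnumB vy ux))).
apply: (gnum_near gnum1); near=> e.
have h' : u e + rho e ^+ N <= v e by near: e.
have /andP[r0 r1] : 0 < rho e <= 1 by near: e; exact: near_gauge.
have rN : 0 < rho e ^+ N by rewrite exprn_gt0.
have uv : 0 < v e - u e by lra.
by rewrite mulVf// gt_eqF.
Unshelve. all: by end_near. Qed.

(** Any representative is truncated to [A,B]; as t lies in [a,b], this changes
    it by a negligible net. *)
Lemma gitv_net (a b t : Rt) (A B : R -> R) : gnum A a -> gnum B b ->
  (forall e, 0 < e <= 1 -> A e <= B e) -> gitv a b t ->
  exists2 u, gnum u t & forall e, 0 < e <= 1 -> A e <= u e <= B e.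
Proof.
move=> Aa Bb AB [at_ tb]; have [u ut] := gnum_ex t.
exists (fun e => Num.max (A e) (Num.min (u e) (B e))); last first.
  move=> e /AB ABe; rewrite le_max lexx/= ge_max ABe/=.
  by rewrite ge_min lexx orbT.
apply: (gnum_negl ut) => n.
have H1 := gle_net Aa ut at_ n; have H2 := gle_net ut Bb tb n; near=> e.
have h1 : A e <= u e + rho e ^+ n by near: e.
have h2 : u e <= B e + rho e ^+ n by near: e.
have h3 : A e <= B e by apply: AB; near: e; exact: near_itv01.
have /andP[r0 r1] : 0 < rho e <= 1 by near: e; exact: near_gauge.
have : 0 <= rho e ^+ n by rewrite exprn_ge0// ltW.
move=> r3; rewrite ler_norml /Num.max /Num.min.
by case: (ltP (u e)) => h4; case: (ltP (A e)) => h5; lra.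
Unshelve. all: by end_near. Qed.

Lemma net_gitv (a b t : Rt) (A B u : R -> R) : gnum A a -> gnum B b ->
  gnum u t -> (forall n, \forall e \near 0^'+, A e - rho e ^+ n <= u e <= B e + rho e ^+ n) ->
  gitv a b t.
Proof.
move=> Aa Bb ut h; split.
  apply: (net_gle Aa ut) => n; apply: filterS (h n) => e /andP[]; lra.
by apply: (net_gle ut Bb) => n; apply: filterS (h n) => e /andP[].
Qed.

End Nets.

(** * From estimates along nets to uniform estimates *)

Section Saturation.
Variables (R : realType).

(** With [near0I]: the neighbourhood filter of 0 on the right in terms of
    explicit intervals. *)
Lemma near0P (P : R -> Prop) : (\forall e \near 0^'+, P e) ->
  exists2 r, 0 < r & forall e, 0 < e < r -> P e.
Proof.
move=> [r /= r0 Hr]; exists r => // e /andP[e0 er].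
by apply: Hr => //=; rewrite /ball_ /= sub0r normrN gtr0_norm.
Qed.

Lemma near0I (P : R -> Prop) r : 0 < r -> (forall e, 0 < e < r -> P e) ->
  \forall e \near 0^'+, P e.
Proof.
move=> r0 H; near=> e; apply: H; apply/andP; split; near: e.
  exact: nbhs_right_gt.
exact: nbhs_right_lt.
Unshelve. all: by end_near. Qed.

(** If uniformity fails for every N, pick e_N < 1/(N+1) and x_N with
    [B N e_N x_N] and not [ok N e_N x_N].  The net equal to x_N at e_N and to u0
    elsewhere is eventually in each [B N], because e is
    smaller than all the e_M with M < N as soon as e is small; pointwise validity along that net is contradicted
    at a sufficiently small e_N. *)
Lemma saturation (T : Type) (B ok : nat -> R -> T -> Prop) (u0 : R -> T) :
  (forall N, \forall e \near 0^'+, B N e (u0 e)) ->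
  (forall N e x, 0 < e <= 1 -> B N.+1 e x -> B N e x) ->
  (forall N e x, 0 < e <= 1 -> ok N e x -> ok N.+1 e x) ->
  (forall x : R -> T, (forall N, \forall e \near 0^'+, B N e (x e)) ->
     exists N, \forall e \near 0^'+, ok N e (x e)) ->
  exists N, \forall e \near 0^'+, forall x, B N e x -> ok N e x.
Proof.
move=> Bu0 Bdec okinc Hpt; apply: contrapT => Hbad.
have Bdecn N M e x : 0 < e <= 1 -> (N <= M)%N -> B M e x -> B N e x.
  move=> e01; elim: M => [|M IH]; first by rewrite leqn0 => /eqP ->.
  rewrite leq_eqVlt => /predU1P[-> //|]; rewrite ltnS => /IH{}IH /Bdec BM.
  by apply: IH; exact: BM.
have okincn N M e x : 0 < e <= 1 -> (N <= M)%N -> ok N e x -> ok M e x.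
  move=> e01; elim: M => [|M IH]; first by rewrite leqn0 => /eqP ->.
  rewrite leq_eqVlt => /predU1P[-> //|]; rewrite ltnS => NM /(IH NM).
  exact: okinc.
have bad N : exists p : R * T, [/\ 0 < p.1 <= 1, p.1 < N.+1%:R^-1,
    B N p.1 p.2 & ~ ok N p.1 p.2].
  apply: contrapT => nb; apply: Hbad; exists N.
  have r0 : 0 < Num.min 1 (N.+1%:R^-1 : R) by rewrite lt_min ltr01 invr_gt0/=.
  apply: (near0I r0) => e; rewrite lt_min => /and3P[e0 e1 eN] x Bx.
  apply: contrapT => nok; apply: nb; exists (e, x); split=> //=.
  by rewrite e0 ltW.
have [p hp] := choice bad.
(* Several indices may share one value of e; any choice among them will do,
   as both families are monotone in N. *)
pose x e := match pselect (exists M, (p M).1 = e) with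
  | left h => (p (projT1 (cid h))).2 | right _ => u0 e end.
have plt N : \forall e \near (0 : R)^'+, forall M, (M < N)%N -> e < (p M).1.
  elim: N => [|N IH]; first exact: nearW.
  near=> e => M; rewrite ltnS leq_eqVlt => /predU1P[->|]; last first.
    by move: M; near: e; exact: IH.
  near: e; apply: nbhs_right_lt.
  by have [/andP[]] := hp N.
have xB N : \forall e \near 0^'+, B N e (x e).
  near=> e; rewrite /x; case: pselect => [h|_]; last first.
    by near: e; exact: Bu0.
  case: (cid h) => M /= eM; have [M01 _ BM _] := hp M.
  rewrite eM in M01 BM; apply: (Bdecn _ M) => //.
  rewrite leqNgt; apply/negP => MN.
  suff : e < (p M).1 by rewrite eM ltxx.
  by move: M MN {eM M01 BM}; near: e; exact: plt.
have [N0 hN0] := Hpt x xB.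
have [r r0 Hr] := near0P (filterI hN0 (plt N0)).
have [K hK] : exists K : nat, K.+1%:R^-1 < r.
  exists (Num.truncn r^-1).
  by rewrite invf_plt ?posrE//; exact: truncnS_gt.
pose M := maxn K N0.
have [pM01 pMlt BM nokM] := hp M.
have pMr : 0 < (p M).1 < r.
  have /andP[-> _] /= := pM01.
  apply: lt_trans hK; apply: (lt_le_trans pMlt).
  by rewrite lef_pV2 ?posrE ?ltr0n// ler_nat ltnS leq_maxl.
have [] := Hr _ pMr; rewrite /x; case: pselect => [h|[]]; last by exists M.
case: (cid h) => M' /= eM' okx pltM; have [M01 _ _ nok] := hp M'.
apply: nok; apply: (okincn N0); rewrite ?eM' //.
rewrite leqNgt; apply/negP => /pltM; by rewrite -eM' ltxx.
Unshelve. all: by end_near. Qed.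

End Saturation.

(** * Vectors of generalized numbers and the sharp topology *)

Section Vectors.
Variables (R : realType) (rho : gauge R).
Local Notation Rt := (Rtilde rho).

Lemma enorm_ge n (x : 'rV[R]_n) j : `|x 0 j| <= enorm x.
Proof.
rewrite -sqrtr_sqr; apply: ler_wsqrtr.
by rewrite (bigD1 j)//= lerDl sumr_ge0// => i _; exact: sqr_ge0.
Qed.

Lemma enorm_le n (x : 'rV[R]_n) r : 0 <= r -> (forall j, `|x 0 j| <= r) ->
  enorm x <= n.+1%:R * r.
Proof.
move=> r0 xr; have s0 : 0 <= n.+1%:R * r by rewrite mulr_ge0.
rewrite -(ger0_norm s0) -sqrtr_sqr; apply: ler_wsqrtr.
apply: (@le_trans _ _ (\sum_(j < n) r ^+ 2)).
  apply: ler_sum => j _; rewrite -(real_normK (num_real (x 0 j))).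
  by rewrite lerXn2r ?nnegrE.
rewrite sumr_const card_ord exprMn -[leLHS]mulr_natl.
apply: ler_wpM2r; first exact: sqr_ge0.
rewrite expr2 -natrM ler_nat; apply: (leq_trans (leqnSn n)).
by rewrite leq_pmulr.
Qed.

Lemma moderate_enorm n (u : R -> 'rV[R]_n) :
  moderate rho (fun e => enorm (u e)) <->
  forall j, moderate rho (fun e => u e 0 j).
Proof.
split=> [h j|h].
  apply: (moderate_le _ h); apply: nearW => e.
  by apply: le_trans (enorm_ge _ j) (ler_norm _).
have hS : moderate rho (fun e => n.+1%:R * \sum_j `|u e 0 j|).
  apply: moderateM; first exact: moderate_cst.
  apply: moderate_sum => j; apply: (moderate_le _ (h j)).
  by apply: nearW => e; rewrite normr_id.
apply: (moderate_le _ hS); apply: nearW => e.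
rewrite ger0_norm ?sqrtr_ge0//; apply: le_trans (ler_norm _).
apply: enorm_le => [|j]; first exact: sumr_ge0.
by rewrite (bigD1 j)//= lerDl sumr_ge0.
Qed.

Lemma gvec_ex n (x : 'rV[Rt]_n) : exists u, gvec u x.
Proof.
have [u hu] := choice (fun j => gnum_ex (x 0 j)).
exists (fun e => \row_j u j e) => j.
by apply: (gnum_near (hu j)); apply: nearW => e; rewrite mxE.
Qed.

Lemma moderate_gvec n (u : R -> 'rV[R]_n) :
  (forall j, moderate rho (fun e => u e 0 j)) -> exists x : 'rV[Rt]_n, gvec u x.
Proof.
move=> h; have [x hx] := choice (fun j => moderate_gnum (h j)).
by exists (\row_j x j) => j; rewrite mxE.
Qed.

Lemma gvec_negl n (u v : R -> 'rV[R]_n) (x : 'rV[Rt]_n) : gvec u x ->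
  (forall j, negligible rho (fun e => v e 0 j - u e 0 j)) -> gvec v x.
Proof. by move=> ux uv j; exact: gnum_negl (ux j) (uv j). Qed.

Lemma gvec_near n (u v : R -> 'rV[R]_n) (x : 'rV[Rt]_n) : gvec u x ->
  (\forall e \near 0^'+, v e = u e) -> gvec v x.
Proof.
by move=> ux uv j; apply: (gnum_near (ux j)); apply: filterS uv => e ->.
Qed.

Lemma gvecB n (u v : R -> 'rV[R]_n) (x y : 'rV[Rt]_n) : gvec u x -> gvec v y ->
  gvec (fun e => u e - v e) (x - y).
Proof.
move=> ux vy j; rewrite !mxE; apply: (gnum_near (gnumB (ux j) (vy j))).
by apply: nearW => e; rewrite !mxE.
Qed.

Lemma gnorm_net n (x : 'rV[Rt]_n) :
  exists2 u, gvec u x & gnum (fun e => enorm (u e)) (gnorm x).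
Proof.
have [u ux] := gvec_ex x.
have mu : moderate rho (fun e => enorm (u e)).
  by apply/moderate_enorm => j; exact: gnum_moderate (ux j).
have [y uy] := moderate_gnum mu.
have : [set y : Rt | exists2 u, gvec u x & gnum (fun e => enorm (u e)) y] y.
  by exists u.
by move=> /(xgetI 0) [v vx vy]; exists v.
Qed.

Lemma near_ord n (P : 'I_n -> R -> Prop) :
  (forall j, \forall e \near 0^'+, P j e) ->
  \forall e \near (0 : R)^'+, forall j, P j e.
Proof. by move=> h; apply: filter_forall. Qed.

(** This lemma and [gball_out] describe the sharp topology on representatives:
    neighbourhoods amount to bounds of the coordinates by powers of rho. *)
Lemma gball_in n (r : Rt) : glt 0 r -> exists N,
  forall (x c : 'rV[Rt]_n) u v, gvec u x -> gvec v c ->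
    (\forall e \near 0^'+, forall j, `|u e 0 j - v e 0 j| <= rho e ^+ N) ->
    gball c r x.
Proof.
move=> r0; have [w wr] := gnum_ex r.
have [M HM] := glt_net (gnum0 rho) wr r0.
(* One spare power of rho absorbs the constant comparing the Euclidean norm
   with the coordinates, the other the gap needed for a strict inequality. *)
exists M.+2 => x c u v ux vc uv; rewrite /gball /=.
have [u' u'x u'n] := gnorm_net (x - c).
apply: (@net_glt _ _ _ _ _ _ M.+1 u'n wr).
have uu : forall j, \forall e \near 0^'+,
    `|u' e 0 j - (u e 0 j - v e 0 j)| <= rho e ^+ M.+2.
  move=> j; have := gnum_eq (u'x j) (gvecB ux vc j) M.+2.
  by apply: filterS => e; rewrite !mxE.
have {}uu := near_ord uu.
near=> e.
have /andP[e0 e1] : 0 < rho e <= 1 by near: e; exact: near_gauge.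
have rM : 0 < rho e ^+ M by rewrite exprn_gt0.
have h1 : 0 + rho e ^+ M <= w e by near: e.
have h2 : enorm (u' e) <= n.+1%:R * (2 * rho e ^+ M.+2).
  apply: enorm_le => [|j]; first by rewrite mulr_ge0// exprn_ge0// ltW.
  have : `|u' e 0 j - (u e 0 j - v e 0 j)| <= rho e ^+ M.+2.
    by move: j; near: e.
  have : `|u e 0 j - v e 0 j| <= rho e ^+ M.+2 by move: j; near: e.
  by rewrite !ler_norml => /andP[? ?] /andP[? ?]; lra.
have h3 : rho e < (n.+1%:R * 2 + 1)^-1.
  by near: e; apply: near_gauge_lt; rewrite invr_gt0 ltr_wpDl// mulr_ge0.
have h3' : rho e * (n.+1%:R * 2 + 1) <= 1.
  by rewrite -ler_pdivlMr ?div1r ?(ltW h3)// ltr_wpDl// mulr_ge0.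
have h4 : rho e < 1/2 by near: e; apply: near_gauge_lt; lra.
have h5 : n.+1%:R * (2 * rho e ^+ M.+2) <= rho e ^+ M.+1.
  have -> : n.+1%:R * (2 * rho e ^+ M.+2) =
      (rho e * (n.+1%:R * 2)) * rho e ^+ M.+1 by rewrite exprS; ring.
  rewrite ler_piMl ?exprn_ge0 ?(ltW e0)//; lra.
have h6 : rho e ^+ M.+1 <= 1/2 * rho e ^+ M.
  by rewrite exprS ler_wpM2r// ltW.
lra.
Unshelve. all: by end_near. Qed.

Lemma gball_out n (r : Rt) N (x c : 'rV[Rt]_n) u v :
  gnum (fun e => rho e ^+ N) r -> gball c r x -> gvec u x -> gvec v c ->
  \forall e \near 0^'+, forall j, `|u e 0 j - v e 0 j| <= rho e ^+ N.
Proof.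
move=> rN; rewrite /gball /= => xcr ux vc.
have [u' u'x u'n] := gnorm_net (x - c).
have [M HM] := glt_net u'n rN xcr.
apply: near_ord => j.
have := gnum_eq (gvecB ux vc j) (u'x j) M; rewrite /= => uu.
near=> e.
have h1 : enorm (u' e) + rho e ^+ M <= rho e ^+ N by near: e.
have h2 : `|(u e - v e) 0 j - u' e 0 j| <= rho e ^+ M by near: e.
have h3 := enorm_ge (u' e) j.
rewrite !mxE in h2; move: h2 h3; rewrite !ler_norml => /andP[? ?] /andP[? ?].
lra.
Unshelve. all: by end_near. Qed.

Lemma rho_class N : exists2 r : Rt, gnum (fun e => rho e ^+ N) r & glt 0 r.
Proof.
have [r hr] := moderate_gnum (moderate_rho rho N); exists r => //.
apply: (@net_glt _ _ _ _ _ _ N (gnum0 rho) hr).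
by apply: nearW => e; rewrite add0r.
Qed.

End Vectors.

(** * Classical calculus in several variables *)

Section Multivariate.
Variables (R : realType) (n : nat).
Implicit Types (f g : 'rV[R]_n -> R) (x y v : 'rV[R]_n).

Definition ipartial (s : seq 'I_n) f : 'rV[R]_n -> R :=
  foldr (fun i g => 'D_(delta_mx 0 i) g) f s.

(** The scalar counterpart of [smooth_on], on which the calculus is done;
    vector-valued functions are treated one coordinate at a time. *)
Definition smooth_in (Omega : set 'rV[R]_n) f :=
  forall x, Omega x -> forall s : seq 'I_n,
    {for x, continuous (ipartial s f)} /\
    forall i, derivable (ipartial s f) x (delta_mx 0 i).

Lemma rVnorm_leP x r : 0 <= r -> `|x| <= r <-> forall j, `|x 0 j| <= r.
Proof.
move=> r0; rewrite [`|x|]/Num.Def.normr /= mx_normrE; split=> [h j|h].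
  by apply: le_trans h; exact: (le_bigmax _ (fun ij => `|x ij.1 ij.2|) (0, j)).
by apply: bigmax_le => // -[i j] _ /=; rewrite ord1.
Qed.

Lemma rVnorm_coord x j : `|x 0 j| <= `|x|.
Proof. by move: j; apply/rVnorm_leP. Qed.

Lemma line_derive f x v (t : R) : derivable f (t *: v + x) v ->
  is_derive t 1 (fun s => f (s *: v + x)) ('D_v f (t *: v + x)).
Proof.
have E : (fun h : R => h^-1 *: (f ((h *: 1 + t) *: v + x) - f (t *: v + x))) =
         (fun h : R => h^-1 *: (f (h *: v + (t *: v + x)) - f (t *: v + x))).
  by apply/funext => h; rewrite scalerDl addrA /GRing.scale/= mulr1.
move=> h; apply: DeriveDef; first by rewrite /derivable E.
by rewrite /derive E.
Qed.

(** Increments of either sign occur below, so 0 and c are not ordered. *)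
Lemma MVT0 (g g' : R -> R) (c : R) :
  (forall t : R, `|t| <= `|c| -> is_derive t 1 g (g' t)) ->
  exists2 t, `|t| <= `|c| & g c - g 0 = g' t * c.
Proof.
move=> hg.
have cont (a b : R) : (forall t, a <= t <= b -> `|t| <= `|c|) ->
    {within `[a, b], continuous g}.
  move=> h; apply: derivable_within_continuous => t; rewrite in_itv/= => /h/hg.
  by case.
have [c0|c0|<-] := ltgtP 0 c; last first.
- by exists 0; rewrite ?normr0// subrr mulr0.
- have le (t : R) : c <= t <= 0 -> `|t| <= `|c|.
    by move=> /andP[ct t0]; rewrite !ler0_norm ?lerN2// ltW.
  have [t|t tc E] := @MVT _ g g' c 0 c0 _ (cont _ _ le).
    by rewrite in_itv/= => /andP[? ?]; apply: hg; apply: le; rewrite !ltW.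
  exists t; first by apply: le; move: tc; rewrite in_itv/= => /andP[? ?]; rewrite !ltW.
  by rewrite -opprB E; ring.
- have le (t : R) : 0 <= t <= c -> `|t| <= `|c|.
    by move=> /andP[ct t0]; rewrite !ger0_norm// ltW.
  have [t|t tc E] := @MVT _ g g' 0 c c0 _ (cont _ _ le).
    by rewrite in_itv/= => /andP[? ?]; apply: hg; apply: le; rewrite !ltW.
  exists t; first by apply: le; move: tc; rewrite in_itv/= => /andP[? ?]; rewrite !ltW.
  by rewrite E; ring.
Qed.

Section C1.
Variables (f : 'rV[R]_n -> R) (x : 'rV[R]_n).
Let a i := 'D_(delta_mx 0 i) f x.
Let trunc (k : nat) v : 'rV[R]_n := \row_j (if (j < k)%N then v 0 j else 0).

Let truncS (k : 'I_n) v : trunc k.+1 v = v 0 k *: delta_mx 0 k + trunc k v.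
Proof.
apply/rowP => j; rewrite !mxE eqxx/= ltnS leq_eqVlt.
have [->|jk] := eqVneq j k; first by rewrite eqxx/= ltnn addr0 mulr1.
by rewrite (negbTE (_ : nat_of_ord j != k))// mulr0 add0r.
Qed.

(** A displacement v is decomposed into its coordinates; the mean value theorem
    is applied to each step, at points that stay in the ball of radius |v|, where
    the partial derivatives are eps-close to their values at x. *)
Lemma C1_estimate (eps : R) : 0 < eps ->
  (\forall y \near x, forall i, derivable f y (delta_mx 0 i)) ->
  (forall i, {for x, continuous ('D_(delta_mx 0 i) f)}) ->
  exists2 r, 0 < r & forall v, `|v| < r ->
    `|f (v + x) - f x - \sum_i a i * v 0 i| <= n%:R * eps * `|v|.
Proof.
move=> e0 hd hc.
have hc' : \forall y \near x, forall i, `|a i - 'D_(delta_mx 0 i) f y| <= eps.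
  have := @filter_forall _ _ (fun i y => `|a i - 'D_(delta_mx 0 i) f y| <= eps)
    (nbhs x) (nbhs_filter x).
  apply => i.
  by have /cvgrPdist_le /(_ eps e0) := hc i.
have [r /= r0 Hr] := (nbhs_ballP _ _).1 (filterI hd hc').
exists r => // v vr.
have Hy y : `|y| <= `|v| -> (forall i, derivable f (y + x) (delta_mx 0 i)) /\
    forall i, `|a i - 'D_(delta_mx 0 i) f (y + x)| <= eps.
  move=> yv; apply: Hr; rewrite -ball_normE /ball_/= opprD addrCA subrr addr0 normrN.
  exact: le_lt_trans vr.
suff H (k : nat) : (k <= n)%N ->
    `|f (trunc k v + x) - f x - \sum_(i < n | (i < k)%N) a i * v 0 i| <=
      k%:R * eps * `|v|.
  have := H n (leqnn n).
  have -> : trunc n v = v by apply/rowP => j; rewrite /trunc mxE (ltn_ord j).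
  have -> : \sum_(i < n | (i < n)%N) a i * v 0 i = \sum_i a i * v 0 i.
    by apply: eq_bigl => i; rewrite ltn_ord.
  exact.
elim: k => [_|k IH kn].
  have -> : trunc 0 v = 0 by apply/rowP => j; rewrite /trunc !mxE.
  by rewrite add0r subrr big1// subrr normr0 !mul0r.
have {}IH := IH (ltnW kn).
rewrite -natr1 mulrDl mulrDl.
pose k' := Ordinal kn.
have -> : \sum_(i < n | (i < k.+1)%N) a i * v 0 i =
    a k' * v 0 k' + \sum_(i < n | (i < k)%N) a i * v 0 i.
  rewrite (bigD1 k')//=; congr (_ + _); apply: eq_bigl => i.
  rewrite ltnS leq_eqVlt -(inj_eq val_inj)/=.
  by case: ltngtP.
have -> : trunc k.+1 v = v 0 k' *: delta_mx 0 k' + trunc k v.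
  exact: (truncS k').
have nrm (t : R) : `|t| <= `|v 0 k'| ->
    `|t *: delta_mx 0 k' + trunc k v| <= `|v|.
  move=> tv; apply/rVnorm_leP => // j; rewrite !mxE eqxx/=.
  have [->|jk] := eqVneq j k'.
    rewrite ltnn addr0 mulr1; apply: (le_trans tv); exact: rVnorm_coord.
  rewrite mulr0 add0r; case: ifP => _; last by rewrite normr0.
  exact: rVnorm_coord.
have [t|t tv] := @MVT0 (fun t => f (t *: delta_mx 0 k' + (trunc k v + x)))
   (fun t => 'D_(delta_mx 0 k') f (t *: delta_mx 0 k' + (trunc k v + x))) (v 0 k').
  move=> /nrm /Hy[+ _] => /(_ k'); rewrite -addrA => h.
  exact: line_derive.
rewrite scale0r add0r => E.
have [_ /(_ k')] := Hy _ (nrm _ tv); rewrite -addrA => h.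
rewrite -(addrA (v 0 k' *: _)).
set A := f (_ + (_ + x)) in E *; set B := f (trunc k v + x) in E IH *.
set S := \sum_(i < n | _) _ in IH *.
have -> : A - f x - (a k' * v 0 k' + S) = (B - f x - S) + (A - B - a k' * v 0 k').
  by ring.
apply: (le_trans (ler_normD _ _)); apply: lerD => //.
rewrite E -mulrBl normrM mul1r distrC; apply: ler_pM => //.
exact: rVnorm_coord.
Qed.

Let df v : R := \sum_i a i * v 0 i.
Let df_linear : linear df.
Proof.
move=> c u v; rewrite /df scaler_sumr -big_split/=; apply: eq_bigr => i _.
by rewrite !mxE /GRing.scale/=; ring.
Qed.

Lemma C1_differentiable :
  (\forall y \near x, forall i, derivable f y (delta_mx 0 i)) ->
  (forall i, {for x, continuous ('D_(delta_mx 0 i) f)}) ->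
  differentiable f x.
Proof.
move=> hd hc.
pose L := HB.pack_for {linear 'rV[R]_n -> R} df (GRing.isLinear.Build _ _ _ _ df df_linear).
have Lc : continuous L.
  move=> y; have H : {for y, continuous (fun v : 'rV[R]_n => \sum_(i < n) a i * v 0 i)}.
    rewrite /continuous_at; have H1 := (@cvg_big R _ +%R 0 xpredT (@add_continuous R) _ (nbhs y)
    (index_enum _) (fun i (v : 'rV[R]_n) => a i * v 0 i) (fun i => a i * y 0 i) (nbhs_filter y)).
    apply: H1 => i _.
    by apply: cvgMr; exact: coord_continuous.
  exact: H.
have H : f \o shift x = cst (f x) + L +o_ (0 : 'rV[R]_n) id.
  apply/eqaddoP => eps e0.
  have e1 : 0 < eps / n.+1%:R by rewrite divr_gt0.
  have [r r0 Hr] := C1_estimate e1 hd hc.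
  have nr : \forall v \near (0 : 'rV[R]_n), `|v| < r.
    apply/nbhs_ballP; exists r => // v.
    by rewrite -ball_normE /ball_/= sub0r normrN.
  apply: filterS nr => v vr.
  have := Hr _ vr; rewrite /= => h.
  rewrite [X in `|X|](_ : _ = f (v + x) - f x - \sum_i a i * v 0 i); last first.
    by rewrite -[LHS]/(f (v + x) - (f x + df v)) opprD addrA.
  apply: (le_trans h); apply: ler_wpM2r => //.
  rewrite mulrCA; apply: ler_piMr; first exact: ltW.
  by rewrite ler_pdivrMr// mul1r ler_nat.
have := (@diff_locallyP _ _ _ x f).2.
have := @diff_unique _ _ _ f L x Lc H => Ed.
apply; rewrite Ed; split => //; exact: H.
Qed.

End C1.

End Multivariate.

Section Smooth.
Variables (R : realType) (n : nat).
Implicit Types (f g : 'rV[R]_n -> R) (x y v : 'rV[R]_n) (Omega : set 'rV[R]_n).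

Lemma near_open (T : topologicalType) (O : set T) (x0 : T) : open O -> O x0 ->
  \forall y \near x0, O y.
Proof. by move=> oO Ox; apply: open_nbhs_nbhs. Qed.

Lemma smooth_in_ipartial Omega f s : smooth_in Omega f -> smooth_in Omega (ipartial s f).
Proof.
move=> sf x Ox s'; have := sf x Ox (s' ++ s).
by rewrite /ipartial foldr_cat.
Qed.

Lemma smooth_inW (O O' : set 'rV[R]_n) f : O `<=` O' -> smooth_in O' f -> smooth_in O f.
Proof. by move=> OO' h x /OO' /h. Qed.

Lemma smooth_in_differentiable Omega f x : open Omega -> smooth_in Omega f -> Omega x ->
  differentiable f x.
Proof.
move=> oO sf Ox; apply: C1_differentiable.
  by apply: filterS (near_open oO Ox) => y Oy i; exact: (sf y Oy [::]).2.
by move=> i; exact: (sf x Ox [:: i]).1.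
Qed.

Lemma diff_partials f x v : differentiable f x ->
  'd f x v = \sum_i 'D_(delta_mx 0 i) f x * v 0 i.
Proof.
move=> df; rewrite [v in LHS]row_sum_delta linear_sum; apply: eq_bigr => i _.
by rewrite linearZ/= deriveE// mulrC.
Qed.

Lemma chain_rule f (c c' : R -> 'rV[R]_n) (t : R) :
  (forall i, is_derive t 1 (fun s => c s 0 i) (c' t 0 i)) ->
  differentiable f (c t) ->
  is_derive t 1 (fun s => f (c s))
    (\sum_i 'D_(delta_mx 0 i) f (c t) * c' t 0 i).
Proof.
move=> hc df.
have dc : derivable c t 1.
  by apply/derivable_mxP => i j; rewrite ord1; case: (hc j).
have dc1 : differentiable c t by apply/derivable1_diffP.
have dfc : differentiable (f \o c) t by exact: differentiable_comp.
apply: DeriveDef; first by apply/derivable1_diffP.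
rewrite -[LHS]/('D_1 (f \o c) t) deriveE// diff_comp//= diff_partials//.
apply: eq_bigr => i _; congr (_ * _).
by rewrite -deriveE// derive_mx// mxE; case: (hc i).
Qed.

Lemma eq_on_derive Omega f g x v : open Omega -> Omega x ->
  {in Omega, f =1 g} -> 'D_v f x = 'D_v g x.
Proof.
move=> oO Ox fg.
apply: near_eq_derive => //.
by apply: filterS (near_open oO Ox) => y Oy; apply: fg; rewrite inE.
Qed.

Lemma eq_on_derivable Omega f g x v : open Omega -> Omega x ->
  {in Omega, f =1 g} -> derivable f x v -> derivable g x v.
Proof.
move=> oO Ox fg.
apply: near_eq_derivable => //.
by apply: filterS (near_open oO Ox) => y Oy; apply: fg; rewrite inE.
Qed.

Lemma eq_on_continuous Omega f g x : open Omega -> Omega x ->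
  {in Omega, f =1 g} -> {for x, continuous f} -> {for x, continuous g}.
Proof.
move=> oO Ox fg; have E : f x = g x by apply: fg; rewrite inE.
rewrite /prop_for/= /continuous_at /= => h; rewrite -E; apply: cvg_trans h.
have H := near_open oO Ox; have {}H : \forall y \near nbhs x, f y = g y.
  by apply: filterS H => y Oy; rewrite fg// inE.
have FF := nbhs_filter x; exact: (near_eq_cvg H).
Qed.

Lemma dist_le_split (a b c e : R) :
  `|a - c| <= e / 2 -> `|b - c| <= e / 2 -> `|a - b| <= e.
Proof.
rewrite !ler_norml => /andP[? ?] /andP[? ?]; apply/andP; split; lra.
Qed.

(** The second difference is symmetric in i and j, while the mean value theorem,
    applied in direction i and then in direction j, makes it a value of the
    mixed partial derivative in that order. *)
Lemma second_difference Omega f (i j : 'I_n) x (h : R) : smooth_in Omega f -> 0 <= h ->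
  (forall a b, `|a| <= h -> `|b| <= h ->
     Omega (a *: delta_mx 0 i + (b *: delta_mx 0 j + x))) ->
  exists a b, [/\ `|a| <= h, `|b| <= h &
    f (h *: delta_mx 0 i + (h *: delta_mx 0 j + x)) - f (h *: delta_mx 0 i + x)
    - f (h *: delta_mx 0 j + x) + f x =
    h ^+ 2 * ipartial [:: j; i] f (a *: delta_mx 0 i + (b *: delta_mx 0 j + x))].
Proof.
move=> sf h0 hO; set ei := delta_mx 0 i; set ej := delta_mx 0 j.
have hh : `|h| <= h by rewrite ger0_norm.
have O0 a : `|a| <= h -> Omega (a *: ei + x).
  by move=> ah; have := hO a 0 ah; rewrite normr0 scale0r add0r; apply.
pose g (t : R) := f (t *: ei + (h *: ej + x)) - f (t *: ei + x).
pose g' (t : R) := ipartial [:: i] f (t *: ei + (h *: ej + x)) - ipartial [:: i] f (t *: ei + x).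
have [t|a] := @MVT0 R g g' h.
  rewrite (ger0_norm h0) => th; apply: is_deriveB; apply: line_derive.
    exact: (sf _ (hO _ _ th hh) [::]).2.
  exact: (sf _ (O0 _ th) [::]).2.
rewrite (ger0_norm h0) => ah E1.
pose k (t : R) := ipartial [:: i] f (t *: ej + (a *: ei + x)).
pose k' (t : R) := ipartial [:: j; i] f (t *: ej + (a *: ei + x)).
have [t|b] := @MVT0 R k k' h.
  rewrite (ger0_norm h0) => th; apply: line_derive.
  have := hO _ _ ah th; rewrite addrCA => O1.
  exact: (sf _ O1 [:: i]).2.
rewrite (ger0_norm h0) => bh E2.
exists a, b; split=> //.
have -> : f (h *: ei + (h *: ej + x)) - f (h *: ei + x) - f (h *: ej + x) + f x =
   g h - g 0 by rewrite /g !scale0r !add0r; ring.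
rewrite E1 /g' (addrCA (a *: ei)).
have -> : ipartial [:: i] f (h *: ej + (a *: ei + x)) - ipartial [:: i] f (a *: ei + x)
   = k h - k 0 by rewrite /k scale0r add0r.
rewrite E2 /k' (addrCA (a *: ei)); ring.
Qed.

(** By [second_difference] the two mixed derivatives take the same value at two
    points as close to x as desired; continuity at x does the rest. *)
Lemma schwarz Omega f (i j : 'I_n) x : open Omega -> smooth_in Omega f -> Omega x ->
  ipartial [:: j; i] f x = ipartial [:: i; j] f x.
Proof.
move=> oO sf Ox; apply/eqP; rewrite -subr_eq0 -normr_le0; apply/ler_addgt0Pr => e e0.
rewrite add0r; set A := ipartial [:: j; i] f x; set B := ipartial [:: i; j] f x.
have e2 : 0 < e / 2 by rewrite divr_gt0.
have /cvgrPdist_le /(_ _ e2) cA := (sf x Ox [:: j; i]).1.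
have /cvgrPdist_le /(_ _ e2) cB := (sf x Ox [:: i; j]).1.
have [r /= r0 Hr] := (nbhs_ballP _ _).1 (filterI (near_open oO Ox) (filterI cA cB)).
pose h := r / 4; have h0 : 0 < h by rewrite divr_gt0.
have nd (k : 'I_n) : `|delta_mx 0 k : 'rV[R]_n| <= 1.
  by apply/rVnorm_leP => // l; rewrite mxE eqxx/=; case: eqP => _; rewrite ?normr1// normr0.
have Hab k l a b : `|a| <= h -> `|b| <= h ->
   ball x r (a *: delta_mx 0 k + (b *: delta_mx 0 l + x)).
  move=> ah bh; rewrite -ball_normE /ball_/= addrA opprD addrCA subrr addr0 normrN.
  apply: (le_lt_trans (ler_normD _ _)); rewrite !normrZ.
  apply: (@le_lt_trans _ _ (h * 1 + h * 1)); first by apply: lerD; apply: ler_pM.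
  by rewrite /h; lra.
have [|a [b [ah bh E1]]] := @second_difference Omega f i j x h sf (ltW h0).
  by move=> a b ah bh; have [] := Hr _ (Hab i j a b ah bh).
have [|a' [b' [ah' bh' E2]]] := @second_difference Omega f j i x h sf (ltW h0).
  by move=> a' b' ah' bh'; have [] := Hr _ (Hab j i a' b' ah' bh').
have E : ipartial [:: j; i] f (a *: delta_mx 0 i + (b *: delta_mx 0 j + x)) =
    ipartial [:: i; j] f (a' *: delta_mx 0 j + (b' *: delta_mx 0 i + x)).
  have h2 : h ^+ 2 != 0 by rewrite expf_neq0// gt_eqF.
  apply: (mulfI h2); apply: (eq_trans (esym E1)); apply: (eq_trans _ E2).
  by rewrite (addrCA (h *: delta_mx 0 j)); congr (_ + _); exact: addrAC.
have h1 : `|A - ipartial [:: j; i] f (a *: delta_mx 0 i + (b *: delta_mx 0 j + x))|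
    <= e / 2 := (Hr _ (Hab i j a b ah bh)).2.1.
have h2 : `|B - ipartial [:: i; j] f (a' *: delta_mx 0 j + (b' *: delta_mx 0 i + x))|
    <= e / 2 := (Hr _ (Hab j i a' b' ah' bh')).2.2.
rewrite E in h1; set X := ipartial _ _ _ in h1 h2.
exact: dist_le_split h1 h2.
Qed.

(** Adjacent transpositions are Schwarz's theorem, and they generate all
    permutations. *)
Lemma ipartial_perm Omega f s s' x : open Omega -> smooth_in Omega f -> Omega x ->
  perm_eq s s' -> ipartial s f x = ipartial s' f x.
Proof.
move=> oO sf Ox pss.
apply: (@catCA_perm_subst _ _ (fun s => ipartial s f x) _ _ _ pss) => {s s' pss}.
have swap i j s y : Omega y -> ipartial (i :: j :: s) f y = ipartial (j :: i :: s) f y.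
  by move=> Oy; rewrite -[LHS]/(ipartial [:: i; j] (ipartial s f) y) (@schwarz Omega)//; exact: smooth_in_ipartial.
have mv i s t y : Omega y -> ipartial (i :: s ++ t) f y = ipartial (s ++ i :: t) f y.
  elim: s y => [//|j s IH] y Oy; rewrite swap//.
  by apply: (eq_on_derive _ oO Oy) => z; rewrite inE; exact: IH.
move=> s1 s2 s3; elim: s1 x Ox => [//|i s1 IH] y Oy; rewrite [RHS]/= -mv//.
by apply: (eq_on_derive _ oO Oy) => z; rewrite inE; exact: IH.
Qed.

(** The order of differentiation used by [mpartial], for which moderateness is
    provided, is the sorted one. *)
Lemma sort_multiindex (s : seq 'I_n) :
  perm_eq s (flatten [seq nseq (count_mem i s) i | i <- enum 'I_n]).
Proof.
apply/allP => i _ /=; apply/eqP; rewrite count_flatten -map_comp.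
under eq_map do rewrite /= count_nseq.
rewrite sumnE big_map (bigD1_seq i)/= ?mem_enum ?enum_uniq// eqxx mul1n.
by rewrite big1 ?addn0// => j /negbTE /= ->.
Qed.

End Smooth.

Section VectorPartials.
Variables (R : realType) (n k : nat).
Implicit Types (F : 'rV[R]_n -> 'rV[R]_k) (Omega : set 'rV[R]_n).

Lemma partials_coord Omega F s x j : open Omega -> smooth_on Omega F -> Omega x ->
  partials s F x 0 j = ipartial s (fun y => F y 0 j) x.
Proof.
move=> oO sF Ox; elim: s x Ox => [//|i s IH] x Ox /=.
have dF := (sF x Ox s).2 i.
rewrite derive_mx// mxE; apply: (eq_on_derive _ oO Ox) => y.
by rewrite inE; exact: IH.
Qed.

Lemma smooth_on_coord Omega F j : open Omega -> smooth_on Omega F ->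
  smooth_in Omega (fun y => F y 0 j).
Proof.
move=> oO sF x Ox s.
have E : {in Omega, (fun y => partials s F y 0 j) =1 ipartial s (fun y => F y 0 j)}.
  by move=> y; rewrite inE => Oy; exact: (partials_coord s j oO sF Oy).
split=> [|i].
  apply: (eq_on_continuous oO Ox E).
  apply: (@continuous_comp _ _ _ (partials s F) (fun M : 'rV[R]_k => M 0 j)).
    exact: (sF x Ox s).1.
  exact: coord_continuous.
apply: (eq_on_derivable oO Ox E).
by have /derivable_mxP /(_ 0 j) := (sF x Ox s).2 i.
Qed.

Lemma smooth_on_of_coords Omega F : open Omega ->
  (forall j, smooth_in Omega (fun y => F y 0 j)) -> smooth_on Omega F.
Proof.
move=> oO sF.
have E s x j : Omega x -> partials s F x 0 j = ipartial s (fun y => F y 0 j) x.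
  elim: s x j => [//|i s IH] x j Ox /=.
  have dF : derivable (partials s F) x (delta_mx 0 i).
    apply/derivable_mxP => k' l; rewrite ord1.
    have := (sF l x Ox s).2 i; apply: (eq_on_derivable oO Ox) => y.
    by rewrite inE => Oy; rewrite IH.
  rewrite derive_mx// mxE; apply: (eq_on_derive _ oO Ox) => y.
  by rewrite inE; exact: IH.
move=> x Ox s; split=> [|i].
  apply/(@cvgrPdist_le _ _ _ (nbhs x) (nbhs_filter x)) => e e0.
  have hj j : \forall y \near x, `|partials s F x 0 j - partials s F y 0 j| <= e.
    have c := (sF j x Ox s).1.
    have E' : {in Omega, ipartial s (fun y => F y 0 j) =1 fun y => partials s F y 0 j}.
      by move=> y; rewrite inE => Oy; rewrite E.
    by have /cvgrPdist_le /(_ e e0) := eq_on_continuous oO Ox E' c.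
  have := @filter_forall _ _ (fun j y => `|partials s F x 0 j - partials s F y 0 j| <= e)
    (nbhs x) (nbhs_filter x) hj.
  apply: filterS => y hy; apply/rVnorm_leP; first exact: ltW.
  by move=> j; rewrite !mxE.
apply/derivable_mxP => k' l; rewrite ord1.
have := (sF l x Ox s).2 i; apply: (eq_on_derivable oO Ox) => y.
by rewrite inE => Oy; rewrite E.
Qed.

End VectorPartials.

Section SmoothMore.
Variables (R : realType) (n : nat).
Implicit Types (f g : 'rV[R]_n -> R) (Omega : set 'rV[R]_n).

Lemma ipartialB Omega f g s x : open Omega -> smooth_in Omega f -> smooth_in Omega g -> Omega x ->
  ipartial s (f - g) x = ipartial s f x - ipartial s g x.
Proof.
move=> oO sf sg; elim: s x => [//|i s IH] x Ox /=.
rewrite (eq_on_derive _ oO Ox (g := ipartial s f - ipartial s g)); last first.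
  by move=> y; rewrite inE => /IH.
rewrite deriveB//; first exact: (sf x Ox s).2.
exact: (sg x Ox s).2.
Qed.

Lemma smooth_in_sub Omega f g : open Omega -> smooth_in Omega f -> smooth_in Omega g ->
  smooth_in Omega (f - g).
Proof.
move=> oO sf sg x Ox s.
have E : {in Omega, ipartial s f - ipartial s g =1 ipartial s (f - g)}.
  by move=> y; rewrite inE => Oy; rewrite (ipartialB _ oO sf sg Oy).
split=> [|i].
  apply: (eq_on_continuous oO Ox E).
  by apply: continuousB; [exact: (sf x Ox s).1|exact: (sg x Ox s).1].
apply: (eq_on_derivable oO Ox E).
by apply: derivableB; [exact: (sf x Ox s).2|exact: (sg x Ox s).2].
Qed.

Lemma mean_value Omega f (u v : 'rV[R]_n) K : open Omega -> smooth_in Omega f ->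
  (forall y, `|y - u| <= `|v - u| ->
     Omega y /\ forall i, `|ipartial [:: i] f y| <= K) ->
  `|f v - f u| <= n%:R * K * `|v - u|.
Proof.
move=> oO sf H.
have nrm (t : R) : `|t| <= `|1| -> `|t *: (v - u) + u - u| <= `|v - u|.
  by rewrite normr1 addrK normrZ => t1; rewrite ler_piMl.
have [t|t t1] := @MVT0 R (fun t => f (t *: (v - u) + u))
    (fun t => \sum_i 'D_(delta_mx 0 i) f (t *: (v - u) + u) * (v - u) 0 i) 1.
  move=> /nrm /H[Oy _].
  apply: (@chain_rule _ _ f (fun t => t *: (v - u) + u) (fun=> v - u)).
    move=> i; rewrite [X in is_derive _ _ X](_ : _ = fun s => s * (v - u) 0 i + u 0 i).
      apply: is_derive_eq; rewrite addr0 scaler1 /GRing.scale/=.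
      by rewrite ?mulr0 ?add0r ?mulr1.
    by apply/funext => s; rewrite !mxE.
  exact: smooth_in_differentiable oO sf Oy.
rewrite scale1r subrK scale0r add0r mulr1 => ->.
have [_ Ht] := H _ (nrm _ t1).
apply: (le_trans (ler_norm_sum _ _ _)).
apply: (@le_trans _ _ (\sum_(i < n) K * `|v - u|)).
  apply: ler_sum => i _; rewrite normrM; apply: ler_pM => //; first exact: Ht.
  exact: rVnorm_coord.
by rewrite sumr_const card_ord -mulrA mulr_natl.
Qed.

End SmoothMore.

(** * Nets of smooth functions *)

Section ScalarNets.
Variables (R : realType) (rho : gauge R) (n : nat).
Local Notation Rt := (Rtilde rho).
Implicit Types (X : set 'rV[Rt]_n) (F : R -> 'rV[R]_n -> R)
  (Omega : R -> set 'rV[R]_n) (u : R -> 'rV[R]_n).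

(** The conditions on the nets defining a generalized smooth function, for one
    coordinate, without reference to a generalized function, and with all orders
    of differentiation allowed.  The latter makes the notion stable under
    differentiation. *)
Definition smooth_net X Omega F :=
  [/\ forall e, 0 < e <= 1 -> open (Omega e) /\ smooth_in (Omega e) (F e),
      X `<=` @internal R rho n Omega &
      forall x u s, X x -> gvec u x -> moderate rho (fun e => ipartial s (F e) (u e))].

Lemma gsf_smooth_net k X (f : 'rV[Rt]_n -> 'rV[Rt]_k) Omega
    (F : R -> 'rV[R]_n -> 'rV[R]_k) j :
  gsf_defined_by X f Omega F -> smooth_net X Omega (fun e y => F e y 0 j).
Proof.
move=> [sF XO fF]; split=> //.
  by move=> e /sF[oO sO]; split=> //; exact: smooth_on_coord.
move=> x u s Xx ux; have [_ /(_ (fun i => count_mem i s)) mF] := fF x u Xx ux.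
move/moderate_enorm : mF => /(_ j); apply: moderate_le.
have := XO x Xx u ux; apply: filterS2 (near_itv01 R) => e /sF[oO sO] Ou.
rewrite (ipartial_perm oO (smooth_on_coord j oO sO) Ou (sort_multiindex s)).
by rewrite -(partials_coord _ _ oO sO Ou).
Qed.

Lemma smooth_net_ipartial X Omega F s : smooth_net X Omega F ->
  smooth_net X Omega (fun e => ipartial s (F e)).
Proof.
move=> [h1 h2 h3]; split; [move=> e /h1[oO sO]|exact: h2|move=> x u s' Xx ux].
  by split; [|exact: smooth_in_ipartial].
have := h3 x u (s' ++ s) Xx ux.
by rewrite /ipartial; under eq_fun do rewrite foldr_cat.
Qed.

Lemma smooth_netB X Omega Omega' F G : smooth_net X Omega F -> smooth_net X Omega' G ->
  smooth_net X (fun e => Omega e `&` Omega' e) (fun e => F e - G e).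
Proof.
move=> [F1 F2 F3] [G1 G2 G3].
have O e : 0 < e <= 1 -> [/\ open (Omega e `&` Omega' e),
    smooth_in (Omega e `&` Omega' e) (F e) & smooth_in (Omega e `&` Omega' e) (G e)].
  move=> e01; have [oF sF] := F1 e e01; have [oG sG] := G1 e e01; split.
  - exact: openI.
  - by apply: smooth_inW sF; exact: subIsetl.
  - by apply: smooth_inW sG; exact: subIsetr.
split=> [e /O[? ? ?]|x Xx u ux|x u s Xx ux].
- by split; [|exact: smooth_in_sub].
- exact: filterI (F2 x Xx u ux) (G2 x Xx u ux).
- apply: (moderate_le _ (moderateB (F3 x u s Xx ux) (G3 x u s Xx ux))).
  have HF := F2 x Xx u ux; have HG := G2 x Xx u ux; near=> e.
  have /O[oO sF sG] : 0 < e <= 1 by near: e; exact: near_itv01.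
  have Fu : Omega e (u e) by near: e.
  have Gu : Omega' e (u e) by near: e.
  have OO : (Omega e `&` Omega' e) (u e) by [].
  by rewrite (ipartialB s oO sF sG OO).
Unshelve. all: by end_near.
Qed.

Lemma moderate_list (I : Type) (ss : seq I) (g : I -> R -> R) :
  (forall s, moderate rho (g s)) ->
  exists N, \forall e \near 0^'+, all (fun s => `|g s e| <= (rho e)^-1 ^+ N) ss.
Proof.
move=> h; elim: ss => [|s ss [N HN]]; first by exists 0%N; exact: nearW.
have [M HM] := h s; exists (maxn N M); near=> e => /=.
have re : 0 < rho e <= 1 by near: e; exact: near_gauge.
apply/andP; split.
  have H : `|g s e| <= (rho e)^-1 ^+ M by near: e.
  by apply: (le_trans H); rewrite rho_invW// leq_maxr.
have : all (fun s => `|g s e| <= (rho e)^-1 ^+ N) ss by near: e.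
apply: sub_all => t H; apply: (le_trans H).
by rewrite rho_invW// leq_maxl.
Unshelve. all: by end_near. Qed.

Lemma smooth_net_uniform X Omega F (ss : seq (seq 'I_n))
    (B : nat -> R -> 'rV[R]_n -> Prop) u0 : smooth_net X Omega F ->
  (forall N, \forall e \near 0^'+, B N e (u0 e)) ->
  (forall N e x, 0 < e <= 1 -> B N.+1 e x -> B N e x) ->
  (forall u, (forall N, \forall e \near 0^'+, B N e (u e)) ->
     exists2 x, X x & gvec u x) ->
  exists N, \forall e \near 0^'+, forall v, B N e v ->
    Omega e v /\ all (fun s => `|ipartial s (F e) v| <= (rho e)^-1 ^+ N) ss.
Proof.
move=> [h1 h2 h3] B0 Bdec BX.
apply: (saturation B0 Bdec) => [N e x /(gauge_itv rho) re [Ox /allP H]|v Bv].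
  split=> //; apply/allP => s /H {}H; apply: (le_trans H).
  by rewrite rho_invW.
have [x Xx vx] := BX v Bv.
have [N HN] := moderate_list ss (fun s => h3 x v s Xx vx).
by exists N; apply: filterS2 (h2 x Xx v vx) HN.
Qed.

Lemma near_norm_gvec u (v : R -> 'rV[R]_n) (x : 'rV[Rt]_n) : gvec u x ->
  (forall N, \forall e \near 0^'+, `|v e - u e| <= rho e ^+ N) -> gvec v x.
Proof.
move=> ux vu; apply: (gvec_negl ux) => j N.
apply: filterS (vu N) => e; apply: le_trans.
by have := rVnorm_coord (v e - u e) j; rewrite !mxE.
Qed.

Lemma gvec_norm u (v : R -> 'rV[R]_n) (x : 'rV[Rt]_n) : gvec u x -> gvec v x ->
  forall N, \forall e \near 0^'+, `|v e - u e| <= rho e ^+ N.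
Proof.
move=> ux vx N.
have H := near_ord (fun j => gnum_eq (vx j) (ux j) N).
apply: filterS2 (near_gauge rho) H => e /andP[/ltW r0 _] h.
by apply/rVnorm_leP => [|j]; [exact: exprn_ge0|rewrite !mxE].
Qed.

(** Moderateness at all nets representing x becomes a bound by one power of
    rho^-1, on a ball of radius a power of rho around any representative. *)
Lemma smooth_net_local X Omega F (ss : seq (seq 'I_n)) u x : smooth_net X Omega F ->
  X x -> gvec u x ->
  exists N, \forall e \near 0^'+, forall v, `|v - u e| <= rho e ^+ N ->
    Omega e v /\ all (fun s => `|ipartial s (F e) v| <= (rho e)^-1 ^+ N) ss.
Proof.
move=> sF Xx ux.
apply: (@smooth_net_uniform X Omega F ss (fun N e v => `|v - u e| <= rho e ^+ N) u sF).
- move=> N; apply: filterS (near_gauge rho) => e /andP[r0 _].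
  by rewrite subrr normr0 exprn_ge0// ltW.
- move=> N e v /(gauge_itv rho) re H; apply: (le_trans H).
  by rewrite rho_expW.
- by move=> v vu; exists x => //; exact: near_norm_gvec ux vu.
Qed.

(** The mean value theorem with the bounds of [smooth_net_local] for the first
    derivatives; the factor n is absorbed by one more power of rho. *)
Lemma smooth_net_lip X Omega F u x : smooth_net X Omega F -> X x -> gvec u x ->
  exists N, \forall e \near 0^'+, forall v, `|v - u e| <= rho e ^+ N ->
    Omega e v /\ `|F e v - F e (u e)| <= (rho e)^-1 ^+ N * `|v - u e|.
Proof.
move=> sF Xx ux.
have [N HN] := smooth_net_local [seq [:: i] | i <- enum 'I_n] sF Xx ux.
have [h1 _ _] := sF.
exists N.+1; near=> e => v vu.
have e01 : 0 < e <= 1 by near: e; exact: near_itv01.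
have re := gauge_itv rho e01; have /andP[r0 r1] := re.
have [oO sO] := h1 e e01.
have H : forall v, `|v - u e| <= rho e ^+ N -> Omega e v /\
    all (fun s => `|ipartial s (F e) v| <= (rho e)^-1 ^+ N) [seq [:: i] | i <- enum 'I_n].
  by near: e.
have vN : `|v - u e| <= rho e ^+ N by apply: (le_trans vu); rewrite rho_expW.
split; first by have [] := H _ vN.
have := @mean_value _ _ (Omega e) (F e) (u e) v ((rho e)^-1 ^+ N) oO sO.
move=> /(_ _) h; apply: le_trans (h _) _ => [y yv|].
  have [Oy /allP Hy] := H y (le_trans yv vN); split=> // i.
  by apply: Hy; apply/mapP; exists i => //; rewrite mem_enum.
rewrite ler_wpM2r// exprS ler_wpM2r ?exprn_ge0 ?invr_ge0 ?(ltW r0)//.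
have : rho e < (n.+1%:R)^-1 by near: e; apply: near_gauge_lt; rewrite invr_gt0.
rewrite -{1}[rho e]invrK ltf_pV2 ?posrE ?invr_gt0// => h'.
by apply: le_trans (ltW h'); rewrite ler_nat.
Unshelve. all: by end_near. Qed.

Lemma interiorW X x : sharp_interior X x -> X x.
Proof.
move=> [r r0 H]; apply: H.
have [N HN] := gball_in n r0; have [u ux] := gvec_ex x.
apply: (HN x x u u ux ux).
apply: filterS (near_gauge rho) => e /andP[e0 _] j.
by rewrite subrr normr0 exprn_ge0// ltW.
Qed.

(** With [net_interior]: sharp interiors in terms of representatives. *)
Lemma interior_net X x u : sharp_interior X x -> gvec u x ->
  exists N, forall (v : R -> 'rV[R]_n) z, gvec v z ->
    (\forall e \near 0^'+, `|v e - u e| <= rho e ^+ N) -> X z.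
Proof.
move=> [r r0 H] ux; have [N HN] := gball_in n r0; exists N => v z vz vu.
apply: H; apply: (HN z x v u vz ux); apply: filterS vu => e h j.
by apply: le_trans h; have := rVnorm_coord (v e - u e) j; rewrite !mxE.
Qed.

Lemma net_interior X x u N : gvec u x ->
  (forall (v : R -> 'rV[R]_n) z, gvec v z ->
    (\forall e \near 0^'+, `|v e - u e| <= rho e ^+ N) -> X z) ->
  sharp_interior X x.
Proof.
move=> ux H; have [r rN r0] := rho_class rho N; exists r => // z zr.
have [v vz] := gvec_ex z; apply: (H v z vz).
apply: filterS2 (near_gauge rho) (gball_out rN zr vz ux) => e /andP[e0 _] h.
by apply/rVnorm_leP => [|j]; [rewrite exprn_ge0// ltW|rewrite !mxE].
Qed.

Lemma interior_nbhs X x u : sharp_interior X x -> gvec u x ->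
  exists N, forall (v : R -> 'rV[R]_n) z, gvec v z ->
    (\forall e \near 0^'+, `|v e - u e| <= rho e ^+ N) -> sharp_interior X z.
Proof.
move=> Xx ux; have [N HN] := interior_net Xx ux; exists N.+1 => v z vz vu.
apply: (@net_interior _ _ v N.+1 vz) => w y wy wv; apply: (HN w y wy).
near=> e.
have /andP[r0 r1] : 0 < rho e <= 1 by near: e; exact: near_gauge.
have h1 : `|w e - v e| <= rho e ^+ N.+1 by near: e.
have h2 : `|v e - u e| <= rho e ^+ N.+1 by near: e.
have h3 : rho e < 1/2 by near: e; apply: near_gauge_lt; lra.
rewrite -(subrKA (v e)); apply: (le_trans (ler_normD _ _)).
apply: (le_trans (lerD h1 h2)); rewrite exprS.
have : 0 <= rho e ^+ N by rewrite exprn_ge0// ltW.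
nra.
Unshelve. all: by end_near. Qed.

Lemma norm_le_split (a b c d r : R) :
  `|a - b| <= c -> `|a| <= d -> c + d <= r -> `|b| <= r.
Proof.
by rewrite !ler_norml => /andP[? ?] /andP[? ?] ?; apply/andP; split; lra.
Qed.

(** By induction on the order of differentiation.  The difference quotient in
    direction i with step rho^M is the derivative at a point within rho^M of u,
    and that derivative differs from the one at u by rho^(M - N), N being a local
    Lipschitz exponent.  The quotient is small because its numerator is
    negligible, at u as well as at the shifted net, which still represents a
    sharply interior point. *)
Lemma smooth_net_negl X Omega F : smooth_net X Omega F ->
  (forall x u, X x -> gvec u x -> negligible rho (fun e => F e (u e))) ->
  forall s x u, sharp_interior X x -> gvec u x ->
    negligible rho (fun e => ipartial s (F e) (u e)).
Proof.
move=> sF F0; elim=> [x u /interiorW Xx ux|i s IH x u Xx ux k]; first exact: F0 Xx ux.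
have sK := smooth_net_ipartial s sF.
have [N HN] := smooth_net_lip (smooth_net_ipartial (i :: s) sF) (interiorW Xx) ux.
have [N' HN'] := interior_nbhs Xx ux.
(* The step must keep the shifted net interior (N') and beat the Lipschitz
   constant (N) by k + 1 powers of rho; the numerator is then taken of order
   M + k + 2. *)
pose M := (k + N + N' + 1)%N.
have MN' : (N' <= M)%N by rewrite /M addn1 leqW// leq_addl.
have MN0 : (N <= M)%N by rewrite /M addn1 leqW// -addnA addnCA leq_addr.
have ME : M = (N + (k.+1 + N'))%N by rewrite /M addn1 (addnC k) -addnA -addnS addSn.
have kN' : (k.+1 <= k.+1 + N')%N by exact: leq_addr.
have ME2 : (k.+2 + M = M + k + 2)%N by rewrite addnC -[k.+2]addn2 addnA.
pose v e := rho e ^+ M *: delta_mx 0 i + u e.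
have nv (t : R) : `|t *: (delta_mx 0 i : 'rV[R]_n)| <= `|t|.
  apply/rVnorm_leP => // j; rewrite mxE normrM ler_piMr// mxE eqxx/=.
  by case: eqP => _; rewrite ?normr1// normr0.
have mv j : moderate rho (fun e => v e 0 j).
  rewrite [X in moderate _ X](_ : _ = fun e => rho e ^+ M * (delta_mx 0 i : 'rV[R]_n) 0 j + u e 0 j).
    exact: (moderateD (moderateM (moderate_rho rho M) (moderate_cst rho _))
      (gnum_moderate (ux j))).
  by apply/funext => e; rewrite !mxE.
have [z vz] := moderate_gvec mv.
have Xz : sharp_interior X z.
  apply: (HN' v z vz); apply: filterS (near_gauge rho) => e re.
  rewrite /v addrK; apply: (le_trans (nv _)).
  have /andP[r0 _] := re.
  rewrite ger0_norm; last by rewrite exprn_ge0// ltW.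
  by rewrite rho_expW.
have nu := IH x u Xx ux (M + k + 2)%N.
have nvv := IH z v Xz vz (M + k + 2)%N.
have [h1 _ _] := sK.
near=> e.
have e01 : 0 < e <= 1 by near: e; exact: near_itv01.
have re := gauge_itv rho e01; have /andP[r0 r1] := re.
have [oO sO] := h1 e e01.
have a1 : `|ipartial s (F e) (u e)| <= rho e ^+ (M + k + 2) by near: e.
have a2 : `|ipartial s (F e) (v e)| <= rho e ^+ (M + k + 2) by near: e.
have a3 : forall w, `|w - u e| <= rho e ^+ N -> Omega e w /\
  `|ipartial (i :: s) (F e) w - ipartial (i :: s) (F e) (u e)| <= (rho e)^-1 ^+ N * `|w - u e|.
  by near: e.
have rM : 0 < rho e ^+ M by rewrite exprn_gt0.
have le1 (t : R) : `|t| <= `|rho e ^+ M| -> `|t *: delta_mx 0 i + u e - u e| <= rho e ^+ M.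
  by move=> tM; rewrite addrK; apply: (le_trans (nv _)); rewrite -(gtr0_norm rM).
have MN : rho e ^+ M <= rho e ^+ N by rewrite rho_expW.
have [t|t tM] := @MVT0 R (fun t => ipartial s (F e) (t *: delta_mx 0 i + u e))
   (fun t => ipartial (i :: s) (F e) (t *: delta_mx 0 i + u e)) (rho e ^+ M).
  move=> /le1 tM; have [Ow _] := a3 _ (le_trans tM MN).
  by apply: line_derive; exact: (sO _ Ow [::]).2.
rewrite scale0r add0r -/(v e) => E.
have [_ b1] := a3 _ (le_trans (le1 _ tM) MN).
set D := ipartial (i :: s) (F e) _ in E b1 *; set D0 := ipartial (i :: s) (F e) (u e) in b1 *.
have b2 : `|D - D0| <= rho e ^+ k.+1.
  apply: (le_trans b1); apply: (@le_trans _ _ ((rho e)^-1 ^+ N * rho e ^+ M)).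
    by rewrite ler_wpM2l ?exprn_ge0 ?invr_ge0 ?(ltW r0)// le1.
  rewrite ME exprD mulrA exprVn mulVf ?mul1r ?expf_neq0 ?gt_eqF//.
  by rewrite rho_expW.
have b3 : `|D| <= 2 * rho e ^+ k.+2.
  have -> : D = (ipartial s (F e) (v e) - ipartial s (F e) (u e)) / rho e ^+ M.
    by rewrite E mulfK ?gt_eqF.
  rewrite normrM normfV (gtr0_norm rM) ler_pdivrMr//.
  apply: (le_trans (ler_normB _ _)); rewrite -mulrA -exprD.
  by rewrite ME2 mulr_natl mulr2n; exact: lerD.
have r4 : rho e < 1/4 by near: e; apply: near_gauge_lt; lra.
have rk : 0 < rho e ^+ k by rewrite exprn_gt0.
have q1 : rho e ^+ k.+1 <= 1/4 * rho e ^+ k by rewrite exprS ler_wpM2r// ltW.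
have q2 : rho e ^+ k.+2 <= 1/4 * rho e ^+ k.
  by apply: le_trans q1; rewrite rho_expW.
by apply: (norm_le_split b2 b3); clear -q1 q2 rk; lra.
Unshelve. all: by end_near. Qed.

End ScalarNets.

(** * Derivatives of generalized smooth functions *)

Section GDerive.
Variables (R : realType) (rho : gauge R) (n k : nat).
Local Notation Rt := (Rtilde rho).
Implicit Types (X : set 'rV[Rt]_n) (f : 'rV[Rt]_n -> 'rV[Rt]_k)
  (F : R -> 'rV[R]_n -> 'rV[R]_k) (Omega : R -> set 'rV[R]_n).

(** Local Lipschitz bounds are moderate, so negligible changes of the argument
    produce negligible changes of the value. *)
Lemma smooth_net_rep X Omega (F : R -> 'rV[R]_n -> R) x (u v : R -> 'rV[R]_n) :
  smooth_net X Omega F -> X x -> gvec u x -> gvec v x ->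
  negligible rho (fun e => F e (v e) - F e (u e)).
Proof.
move=> sF Xx ux vx m; have [N HN] := smooth_net_lip sF Xx ux.
have H := gvec_norm ux vx (N + m)%N.
near=> e.
have re : 0 < rho e <= 1 by near: e; exact: near_gauge.
have /andP[r0 r1] := re.
have vu : `|v e - u e| <= rho e ^+ (N + m) by near: e.
have [_ h] : Omega e (v e) /\ `|F e (v e) - F e (u e)| <= (rho e)^-1 ^+ N * `|v e - u e|.
  suff : `|v e - u e| <= rho e ^+ N by move: (v e); near: e.
  by apply: (le_trans vu); rewrite rho_expW// leq_addr.
apply: (le_trans h).
apply: (@le_trans _ _ ((rho e)^-1 ^+ N * rho e ^+ (N + m))).
  by rewrite ler_wpM2l// exprn_ge0// invr_ge0 ltW.
by rewrite exprD mulrA exprVn mulVf ?mul1r// expf_neq0// gt_eqF.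
Unshelve. all: by end_near. Qed.

Let multi (alpha : 'I_n -> nat) := flatten [seq nseq (alpha i) i | i <- enum 'I_n].

Lemma mpartial_ipartial X f Omega F alpha x (u : R -> 'rV[R]_n) j :
  gsf_defined_by X f Omega F -> X x -> gvec u x ->
  \forall e \near 0^'+, mpartial alpha (F e) (u e) 0 j =
    ipartial (multi alpha) (fun y => F e y 0 j) (u e).
Proof.
move=> [sF XO _] Xx ux; have Ou := XO x Xx u ux.
near=> e.
have [oO sO] : open (Omega e) /\ smooth_on (Omega e) (F e).
  by apply: sF; near: e; exact: near_itv01.
have Oe : Omega e (u e) by near: e.
exact: (partials_coord _ _ oO sO Oe).
Unshelve. all: by end_near. Qed.

Lemma mpartial_moderate X f Omega F alpha x (u : R -> 'rV[R]_n) j :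
  gsf_defined_by X f Omega F -> X x -> gvec u x ->
  moderate rho (fun e => mpartial alpha (F e) (u e) 0 j).
Proof.
by move=> [_ _ fF] Xx ux; have [_ /(_ alpha) /moderate_enorm] := fF x u Xx ux.
Qed.

Lemma gsf_value X f Omega F x (u : R -> 'rV[R]_n) :
  gsf_defined_by X f Omega F -> X x -> gvec u x -> gvec (fun e => F e (u e)) (f x).
Proof. by move=> [_ _ fF] Xx ux; have [] := fF x u Xx ux. Qed.

Lemma mpartial_rep X f Omega F alpha x (u v : R -> 'rV[R]_n) j :
  gsf_defined_by X f Omega F -> X x -> gvec u x -> gvec v x ->
  negligible rho (fun e => mpartial alpha (F e) (v e) 0 j - mpartial alpha (F e) (u e) 0 j).
Proof.
move=> fF Xx ux vx.
have h1 := smooth_net_rep (smooth_net_ipartial (multi alpha) (gsf_smooth_net j fF)) Xx ux vx.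
apply: (negligible_le _ h1).
have Eu := mpartial_ipartial alpha j fF Xx ux; have Ev := mpartial_ipartial alpha j fF Xx vx.
near=> e.
have -> : mpartial alpha (F e) (u e) 0 j = ipartial (multi alpha) (fun y => F e y 0 j) (u e).
  by near: e.
have -> : mpartial alpha (F e) (v e) 0 j = ipartial (multi alpha) (fun y => F e y 0 j) (v e).
  by near: e.
by [].
Unshelve. all: by end_near. Qed.

(** The derivative at a sharply interior point may be computed from any net
    defining f: by [smooth_net_negl] applied to the difference of two such nets. *)
Lemma gderive_int_net X f Omega F alpha x (u : R -> 'rV[R]_n) :
  gsf_defined_by X f Omega F -> sharp_interior X x -> gvec u x ->
  gvec (fun e => mpartial alpha (F e) (u e)) (gderive_int X f alpha x).
Proof.
move=> fF Xi ux; have Xx := interiorW Xi.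
have [y uy] : exists y : 'rV[Rt]_k, gvec (fun e => mpartial alpha (F e) (u e)) y.
  by apply: moderate_gvec => j; exact: mpartial_moderate fF Xx ux.
have : [set y : 'rV[Rt]_k | exists Omega F u,
    [/\ gsf_defined_by X f Omega F, gvec u x &
        gvec (fun e => mpartial alpha (F e) (u e)) y]] y by exists Omega, F, u.
move/(xgetI 0) => [D' [F' [u' [fF' ux' mF']]]].
apply: (gvec_negl mF') => j.
have sF := gsf_smooth_net j fF; have sF' := gsf_smooth_net j fF'.
have n1 : negligible rho (fun e => ipartial (multi alpha)
    ((fun y => F e y 0 j) - (fun y => F' e y 0 j)) (u e)).
  apply: (smooth_net_negl (smooth_netB sF sF') _ _ Xi ux) => z w Xz wz.
  exact: (gnum_eq (gsf_value fF Xz wz j) (gsf_value fF' Xz wz j)).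
have n2 := mpartial_rep alpha j fF' Xx ux' ux.
apply: (negligible_le _ (negligibleD n1 n2)).
have Eu := mpartial_ipartial alpha j fF Xx ux; have Eu' := mpartial_ipartial alpha j fF' Xx ux.
have [h1 h2 _] := sF; have [h1' h2' _] := sF'.
have Ou := h2 x Xx u ux; have Ou' := h2' x Xx u ux.
near=> e.
have e01 : 0 < e <= 1 by near: e; exact: near_itv01.
have [oO sO] := h1 e e01; have [oO' sO'] := h1' e e01.
have Oe : Omega e (u e) by near: e.
have Oe' : D' e (u e) by near: e.
rewrite (@ipartialB _ _ (Omega e `&` D' e)); last by split.
- have <- : mpartial alpha (F e) (u e) 0 j = ipartial (multi alpha) (fun y => F e y 0 j) (u e).
    by near: e.
  have <- : mpartial alpha (F' e) (u e) 0 j = ipartial (multi alpha) (fun y => F' e y 0 j) (u e).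
    by near: e.
  by rewrite addrA subrK.
- exact: openI.
- by apply: smooth_inW sO; exact: subIsetl.
- by apply: smooth_inW sO'; exact: subIsetr.
Unshelve. all: by end_near. Qed.

(** The closure of the sharp interior of X, on representatives. *)
Definition adherent X (x : 'rV[Rt]_n) := forall u N, gvec u x ->
  exists2 z, sharp_interior X z & exists2 v, gvec v z &
    \forall e \near 0^'+, `|v e - u e| <= rho e ^+ N.

(** At adherent points the derivative is a sharp limit of interior derivatives.
    Any defining net gives such a limit, because its derivatives are locally
    Lipschitz with a moderate constant; and the limit is unique, because there
    are interior points as close as desired. *)
Lemma gderive_net X f Omega F alpha x (u : R -> 'rV[R]_n) :
  gsf_defined_by X f Omega F -> X x -> adherent X x -> gvec u x ->
  gvec (fun e => mpartial alpha (F e) (u e)) (gderive X f alpha x).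
Proof.
move=> fF Xx ax ux; rewrite /gderive; case: asboolP => [Xi|_].
  exact: (gderive_int_net alpha fF Xi ux).
set mp := fun e => mpartial alpha (F e) (u e).
have [y uy] : exists y : 'rV[Rt]_k, gvec mp y.
  by apply: moderate_gvec => j; exact: mpartial_moderate fF Xx ux.
have cont M : exists N, forall z (v : R -> 'rV[R]_n), X z -> gvec v z ->
    (\forall e \near 0^'+, `|v e - u e| <= rho e ^+ N) ->
    \forall e \near 0^'+, forall j, `|mpartial alpha (F e) (v e) 0 j - mp e 0 j| <= rho e ^+ M.
  have lip j := smooth_net_lip (smooth_net_ipartial (multi alpha) (gsf_smooth_net j fF)) Xx ux.
  have [N HN] := choice lip; pose N0 := (\max_j N j)%N.
  exists (N0 + M)%N => z v Xz vz vu; apply: near_ord => j.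
  have Eu := mpartial_ipartial alpha j fF Xx ux; have Ev := mpartial_ipartial alpha j fF Xz vz.
  have HNj := HN j.
  near=> e.
  have re : 0 < rho e <= 1 by near: e; exact: near_gauge.
  have /andP[r0 r1] := re.
  rewrite /mp.
  have -> : mpartial alpha (F e) (u e) 0 j = ipartial (multi alpha) (fun y => F e y 0 j) (u e).
    by near: e.
  have -> : mpartial alpha (F e) (v e) 0 j = ipartial (multi alpha) (fun y => F e y 0 j) (v e).
    by near: e.
  have vu' : `|v e - u e| <= rho e ^+ (N0 + M) by near: e.
  have NN : (N j <= N0)%N by exact: leq_bigmax.
  have [_ h] : Omega e (v e) /\ `|ipartial (multi alpha) (fun y => F e y 0 j) (v e) -
      ipartial (multi alpha) (fun y => F e y 0 j) (u e)| <= (rho e)^-1 ^+ N j * `|v e - u e|.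
    suff : `|v e - u e| <= rho e ^+ N j by move: (v e); near: e.
    by apply: (le_trans vu'); rewrite rho_expW// (leq_trans NN)// leq_addr.
  apply: (le_trans h).
  apply: (@le_trans _ _ ((rho e)^-1 ^+ N0 * rho e ^+ (N0 + M))).
    apply: ler_pM => //; first by rewrite exprn_ge0// invr_ge0 ltW.
    exact: rho_invW.
  by rewrite exprD mulrA exprVn mulVf ?mul1r// expf_neq0// gt_eqF.
have : [set y : 'rV[Rt]_k | gderive_int X f alpha @ within (sharp_interior X)
    (sharp_nbhs x) `=>` sharp_nbhs y] y.
  move=> A [r r0 rA]; have [M HM] := gball_in k r0; have [N HN] := cont M.
  have [s sN s0] := rho_class rho N.
  exists s => // z zs Xz; apply: rA.
  have [v vz] := gvec_ex z.
  apply: (HM _ _ _ _ (gderive_int_net alpha fF Xz vz) uy).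
  apply: (HN z v (interiorW Xz) vz).
  apply: filterS2 (near_gauge rho) (gball_out sN zs vz ux) => e /andP[e0 _] h.
  by apply/rVnorm_leP => [|j]; [rewrite exprn_ge0// ltW|rewrite !mxE].
move/(xgetI 0); set y' := xget _ _ => y'lim.
have [w wy'] := gvec_ex y'.
apply: (gvec_negl wy') => j m.
have [r rm r0] := rho_class rho m.+1.
have [|s s0 Hs] := y'lim (gball y' r); first by exists r.
have [N1 HN1] := gball_in n s0; have [N2 HN2] := cont m.+1.
have [z Xz [v vz vu]] := ax u (N1 + N2)%N ux.
have zy' : gball y' r (gderive_int X f alpha z).
  apply: Hs Xz; apply: (HN1 z x v u vz ux).
  apply: filterS2 (near_gauge rho) vu => e re h i.
  have := rVnorm_coord (v e - u e) i; rewrite !mxE => h'; apply: (le_trans h').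
  by apply: (le_trans h); rewrite rho_expW// leq_addr.
have B1 := gball_out rm zy' (gderive_int_net alpha fF Xz vz) wy'.
have B2 := HN2 z v (interiorW Xz) vz.
have {}B2 : \forall e \near 0^'+, forall j, `|mpartial alpha (F e) (v e) 0 j - mp e 0 j| <= rho e ^+ m.+1.
  apply: B2; apply: filterS2 (near_gauge rho) vu => e re h.
  by apply: (le_trans h); rewrite rho_expW// leq_addl.
near=> e.
have /andP[r0' r1] : 0 < rho e <= 1 by near: e; exact: near_gauge.
have b1 : `|mpartial alpha (F e) (v e) 0 j - w e 0 j| <= rho e ^+ m.+1.
  by move: j; near: e.
have b2 : `|mpartial alpha (F e) (v e) 0 j - mp e 0 j| <= rho e ^+ m.+1.
  by move: j {b1}; near: e.
have h3 : rho e < 1/2 by near: e; apply: near_gauge_lt; lra.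
apply: (@dist_le_split _ _ _ (mpartial alpha (F e) (v e) 0 j)); rewrite distrC.
  apply: (le_trans b2); rewrite exprS mulrC ler_wpM2l ?exprn_ge0 ?(ltW r0')//; lra.
apply: (le_trans b1); rewrite exprS mulrC ler_wpM2l ?exprn_ge0 ?(ltW r0')//; lra.
Unshelve. all: by end_near. Qed.

End GDerive.

(** * Tame nets of functions of one variable *)

Section TameNets.
Variables (R : realType) (rho : gauge R).
Implicit Types (f g : R -> R -> R).

(** The nets of [P] play the part of the points at which moderateness is
    required.  The derivative is quantified existentially, so that
    closure properties follow by induction on k without computing any derivative
    of higher order. *)
Fixpoint tame_upto (U : R -> set R) (P : set (R -> R)) (k : nat) f : Prop :=
  (forall u, P u -> moderate rho (fun e => f e (u e))) /\
  (if k is k'.+1 then exists f' : R -> R -> R,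
     (forall e t, 0 < e <= 1 -> U e t -> is_derive t 1 (f e) (f' e t)) /\
     tame_upto U P k' f'
   else True).

Definition tame U P f := forall k, tame_upto U P k f.

Section Fixed.
Variables (U : R -> set R) (P : set (R -> R)).
Hypothesis oU : forall e, 0 < e <= 1 -> open (U e).
Hypothesis PU : forall u, P u -> \forall e \near 0^'+, U e (u e).

Lemma tame_upto_moderate k f u : tame_upto U P k f -> P u -> moderate rho (fun e => f e (u e)).
Proof. by case: k => [|k] [h _]; exact: h. Qed.

Lemma tame_uptoW k f : tame_upto U P k.+1 f -> tame_upto U P k f.
Proof.
elim: k f => [|k IH] f [h [f' [df hf']]]; first by split.
by split=> //; exists f'; split=> //; exact: IH.
Qed.

Lemma eq_near_is_derive (O : set R) (f g : R -> R) t df : open O -> O t ->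
  (forall s, O s -> f s = g s) -> is_derive t 1 f df -> is_derive t 1 g df.
Proof.
move=> oO Ot fg; apply: near_eq_is_derive.
have H : \forall s \near t, O s by apply: open_nbhs_nbhs.
by apply: filterS H => s /fg.
Qed.

Lemma tame_upto_eq k f g : tame_upto U P k f ->
  (forall e t, 0 < e <= 1 -> U e t -> f e t = g e t) -> tame_upto U P k g.
Proof.
move=> hf fg.
have mg u : P u -> moderate rho (fun e => g e (u e)).
  move=> Pu; apply: (moderate_le _ (tame_upto_moderate hf Pu)).
  by apply: filterS2 (near_itv01 R) (PU Pu) => e e01 Ue; rewrite fg.
case: k hf => [|k] [_ hf]; first by split.
split; first exact: mg.
have [f' [df hf']] := hf; exists f'; split; last exact: hf'.
move=> e t e01 Ut.
exact: (eq_near_is_derive (oU e01) Ut (fun s => fg e s e01) (df e t e01 Ut)).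
Qed.

Lemma tame_uptoD k f g : tame_upto U P k f -> tame_upto U P k g -> tame_upto U P k (fun e t => f e t + g e t).
Proof.
elim: k f g => [|k IH] f g [mf hf] [mg hg].
  by split=> // u Pu; exact: moderateD (mf u Pu) (mg u Pu).
split=> [u Pu|]; first exact: moderateD (mf u Pu) (mg u Pu).
have [f' [df hf']] := hf; have [g' [dg hg']] := hg.
exists (fun e t => f' e t + g' e t); split; last exact: IH.
by move=> e t e01 Ut; apply: is_deriveD; [exact: df|exact: dg].
Qed.

Lemma tame_uptoM k f g : tame_upto U P k f -> tame_upto U P k g -> tame_upto U P k (fun e t => f e t * g e t).
Proof.
elim: k f g => [|k IH] f g hf hg.
  by split=> // u Pu; exact: moderateM (tame_upto_moderate hf Pu) (tame_upto_moderate hg Pu).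
split=> [u Pu|]; first exact: moderateM (tame_upto_moderate hf Pu) (tame_upto_moderate hg Pu).
have hf0 := tame_uptoW hf; have hg0 := tame_uptoW hg.
have [_ [f' [df hf']]] := hf; have [_ [g' [dg hg']]] := hg.
exists (fun e t => f e t * g' e t + g e t * f' e t); split.
  move=> e t e01 Ut; apply: is_deriveM; [exact: df|exact: dg].
by apply: tame_uptoD; apply: IH.
Qed.

Lemma tame_upto_cst k (c : R -> R) : moderate rho c -> tame_upto U P k (fun e _ => c e).
Proof.
elim: k c => [|k IH] c mc; first by split.
split; first by [].
exists (fun _ _ => 0); split.
  by move=> e t _ _; exact: is_derive_cst.
exact: (IH (fun=> 0) (moderate_cst rho 0)).
Qed.

Lemma tame_upto_id k : (forall u, P u -> moderate rho u) -> tame_upto U P k (fun _ t => t).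
Proof.
case: k => [|k] mu; first by split.
split; first exact: mu.
exists (fun _ _ => 1); split.
  by move=> e t _ _; exact: is_derive_id.
exact: (tame_upto_cst k (moderate_cst rho 1)).
Qed.

Lemma tame_uptoN k f : tame_upto U P k f -> tame_upto U P k (fun e t => - f e t).
Proof.
move=> hf; have h1 := tame_uptoM (tame_upto_cst k (moderate_cst rho (-1))) hf.
by apply: (tame_upto_eq h1) => e t _ _; rewrite mulN1r.
Qed.

Lemma tame_upto_sum k (I : Type) (s : seq I) (F : I -> R -> R -> R) :
  (forall i, tame_upto U P k (F i)) -> tame_upto U P k (fun e t => \sum_(i <- s) F i e t).
Proof.
move=> h; elim: s => [|i s IH].
  apply: (tame_upto_eq (tame_upto_cst k (moderate_cst rho 0))) => e t _ _.
  by rewrite big_nil.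
by apply: (tame_upto_eq (tame_uptoD (h i) IH)) => e t _ _; rewrite big_cons.
Qed.

Lemma tame_uptoV k f : tame_upto U P k f ->
  (forall e t, 0 < e <= 1 -> U e t -> f e t != 0) ->
  (forall u, P u -> moderate rho (fun e => (f e (u e))^-1)) ->
  tame_upto U P k (fun e t => (f e t)^-1).
Proof.
move=> hf f0 mV; elim: k hf => [|k IH] hf; first by split.
split; first exact: mV.
have {}IH := IH (tame_uptoW hf); have [_ [f' [df hf']]] := hf.
exists (fun e t => - ((f e t)^-1 * (f e t)^-1 * f' e t)); split.
  move=> e t e01 Ut; have [d1 <-] := df e t e01 Ut.
  apply: DeriveDef; first by apply: derivableV => //; exact: f0.
  by rewrite deriveV ?f0// /GRing.scale/= expr2 invfM mulNr.
by apply: tame_uptoN; apply: tame_uptoM => //; exact: tame_uptoM.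
Qed.

Lemma tame_derive f : tame U P f ->
  (forall e t, 0 < e <= 1 -> U e t -> derivable (f e) t 1) /\
  tame U P (fun e => derive1 (f e)).
Proof.
move=> hf; split=> [e t e01 Ut|k].
  have [_ [f' [df _]]] := hf 1%N; by case: (df e t e01 Ut).
have [_ [f' [df hf']]] := hf k.+1.
apply: (tame_upto_eq hf') => e t e01 Ut; rewrite derive1E.
by have [_ ->] := df e t e01 Ut.
Qed.

Lemma tame_deriven f i : tame U P f -> tame U P (fun e => derive1n i (f e)).
Proof.
move=> hf; elim: i => [//|i IH].
have [_] := tame_derive IH.
by under eq_fun do rewrite -derive1nS.
Qed.

End Fixed.

Lemma tame_upto_comp U P U2 P2 k f g : tame_upto U2 P2 k f -> tame_upto U P k g ->
  (forall e t, 0 < e <= 1 -> U e t -> U2 e (g e t)) ->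
  (forall u, P u -> P2 (fun e => g e (u e))) ->
  tame_upto U P k (fun e t => f e (g e t)).
Proof.
move=> hf hg gU gP; elim: k f hf hg => [|k IH] f hf hg.
  by split=> // u Pu; exact: tame_upto_moderate hf (gP u Pu).
split=> [u Pu|]; first exact: tame_upto_moderate hf (gP u Pu).
have hg0 := tame_uptoW hg.
have [_ [f' [df hf']]] := hf; have [_ [g' [dg hg']]] := hg.
exists (fun e t => f' e (g e t) * g' e t); split.
  move=> e t e01 Ut; have dg1 := dg e t e01 Ut; have df1 := df e _ e01 (gU e t e01 Ut).
  exact: is_derive1_comp.
by apply: tame_uptoM => //; exact: IH.
Qed.

Lemma tame_upto_sub U P U2 (P2 : set (R -> R)) k f : tame_upto U2 P2 k f ->
  (forall e t, 0 < e <= 1 -> U e t -> U2 e t) -> P `<=` P2 -> tame_upto U P k f.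
Proof.
move=> hf UU PP; elim: k f hf => [|k IH] f [mf hf].
  by split=> // u /PP; exact: mf.
split=> [u /PP|]; first exact: mf.
by have [f' [df hf']] := hf; exists f'; split; [move=> e t e01 Ut; apply: df => //; exact: UU|exact: IH].
Qed.

(** Composition with the function of several variables G e is meaningful only
    for those e for which the curve c e stays in the domain; these e are cut out
    by [good], and the composite is replaced by 0 for the others. *)
Lemma tame_upto_comp_net (P : set (R -> R)) n (X : set 'rV[Rtilde rho]_n)
    (Omega : R -> set 'rV[R]_n) (G : R -> 'rV[R]_n -> R)
    (good : R -> Prop) (c : R -> R -> 'rV[R]_n) k :
  smooth_net X Omega G -> (\forall e \near 0^'+, good e) ->
  (forall e t, good e -> Omega e (c e t)) ->
  (forall i, tame (fun=> setT) P (fun e t => c e t 0 i)) ->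
  (forall u, P u -> exists2 x, X x & gvec (fun e => c e (u e)) x) ->
  tame_upto (fun=> setT) P k (fun e t => if `[< good e >] then G e (c e t) else 0).
Proof.
move=> sG gd gO hc cX.
have oT (e : R) : 0 < e <= 1 -> open [set: R] by move=> _; exact: openT.
have pT u : P u -> \forall e \near 0^'+, [set: R] (u e) by move=> _; exact: nearW.
elim: k G sG => [|k IH] G sG.
  split=> // u Pu; have [x Xx ux] := cX u Pu; have [_ _ mG] := sG.
  apply: (moderate_le _ (mG x _ [::] Xx ux)); apply: nearW => e.
  by case: asboolP => // _; rewrite normr0.
split=> [u Pu|].
  have [x Xx ux] := cX u Pu; have [_ _ mG] := sG.
  apply: (moderate_le _ (mG x _ [::] Xx ux)); apply: nearW => e.
  by case: asboolP => // _; rewrite normr0.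
pose D (i : 'I_n) e t := (if `[< good e >] then ipartial [:: i] (G e) (c e t) else 0)
                 * derive1 (fun t => c e t 0 i) t.
exists (fun e t => \sum_i D i e t); split; last first.
  apply: (@tame_upto_sum (fun=> setT) P oT pT k _ (index_enum 'I_n) D) => i.
  exact: (tame_uptoM (IH _ (smooth_net_ipartial [:: i] sG)) ((tame_derive oT pT (hc i)).2 k)).
move=> e t e01 _; rewrite /D; case: asboolP => [ge|_]; last first.
  by rewrite big1 => [|i _]; [exact: is_derive_cst|rewrite mul0r].
have [/(_ e e01)[oO sO] _ _] := sG.
pose c' t := \row_i derive1 (fun t => c e t 0 i) t.
have := @chain_rule _ _ (G e) (c e) c' t _ (smooth_in_differentiable oO sO (gO e t ge)).
under eq_bigr do rewrite mxE.
apply=> i; rewrite mxE; apply: DeriveDef; last by rewrite derive1E.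
exact: (tame_derive oT pT (hc i)).1.
Qed.

End TameNets.

(** * A flat function, a smooth step *)

Section Bump.
Variable R : realType.
Implicit Types x : R.

(** The derivatives of exp(-1/x), extended by 0 for x <= 0, are linear
    combinations of these functions; see [is_derive_bump]. *)
Definition bump (n : nat) x : R :=
  if 0 < x then x^-1 ^+ n * expR (- x^-1) else 0.

Lemma bump_ge0 n x : 0 <= bump n x.
Proof.
rewrite /bump; case: ifP => // x0.
by rewrite mulr_ge0 ?expR_ge0// exprn_ge0// invr_ge0 ltW.
Qed.

(** With y = 1/x this is y^n / n! <= exp(y). *)
Lemma bump_le n x : bump n x <= n`!%:R.
Proof.
rewrite /bump; case: ifP => // x0; rewrite expRN ler_pdivrMr ?expR_gt0//.
have y0 : 0 <= x^-1 by rewrite invr_ge0 ltW.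
case: n => [|n].
  by rewrite expr0 fact0 mul1r (le_trans _ (expR_ge1Dx _))// lerDl.
rewrite mulrC -ler_pdivrMr ?ltr0n ?fact_gt0//.
by apply: le_trans (expR_ge1Dxn n y0); rewrite lerDr.
Qed.

Lemma bump_lt0 n x : x <= 0 -> bump n x = 0.
Proof. by move=> x0; rewrite /bump ltNge x0. Qed.

Lemma is_derive_inv x : x != 0 -> is_derive x 1 (fun y : R => y^-1) (- (x^-1 * x^-1)).
Proof.
move=> x0; apply: DeriveDef; first by apply: (@derivableV _ _ id).
by rewrite (@deriveV _ _ id)// derive_id /GRing.scale/= mulr1 expr2 invfM.
Qed.

(** At 0 the difference quotient with increment h > 0 is h times the bounded
    value bump (n+2) h. *)
Lemma is_derive_bump n x :
  is_derive x 1 (bump n) (- n%:R * bump n.+1 x + bump n.+2 x).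
Proof.
have [x0|x0|->] := ltgtP x 0.
- rewrite !bump_lt0 ?ltW// mulr0 addr0.
  have oO : open [set y : R | y < 0] by exact: open_lt.
  apply: (@eq_near_is_derive _ _ (cst 0) _ _ _ oO x0).
  by move=> s /= s0; rewrite bump_lt0// ltW.
- have oO : open [set y : R | 0 < y] by exact: open_gt.
  apply: (@eq_near_is_derive _ _ (fun y => y^-1 ^+ n * expR (- y^-1)) _ _ _ oO x0).
    by move=> s /= s0; rewrite /bump s0.
  have dV := is_derive_inv (lt0r_neq0 x0).
  have dX : is_derive x 1 (fun y : R => y^-1 ^+ n) (- n%:R * x^-1 ^+ n.+1).
    elim: n => [|n IH].
      by rewrite oppr0 mul0r; under eq_fun do rewrite expr0; exact: is_derive_cst.
    under eq_fun do rewrite exprS; apply: (is_derive_eq (is_deriveM dV IH)).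
    by rewrite /GRing.scale/= -natr1 !exprS; ring.
  have dN : is_derive x 1 (fun y : R => - y^-1) (x^-1 * x^-1).
    by have := is_deriveN dV; rewrite opprK.
  have dE : is_derive x 1 (fun y : R => expR (- y^-1)) (expR (- x^-1) * (x^-1 * x^-1)).
    exact: is_derive1_comp.
  apply: (is_derive_eq (is_deriveM dX dE)).
  by rewrite /bump x0 /GRing.scale/= !exprS; ring.
- rewrite !bump_lt0// mulr0 addr0.
  have H : (fun h : R => h^-1 *: (bump n (h *: 1 + 0) - bump n 0)) h @[h --> 0^'] --> (0 : R).
    apply/cvgrPdist_le => eps e0; near=> h.
    rewrite sub0r normrN addr0 (bump_lt0 n (lexx 0)) subr0 /GRing.scale/= mulr1.
    have [h0|h0] := leP h 0; first by rewrite bump_lt0// mulr0 normr0 ltW.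
    have -> : h^-1 * bump n h = h * bump n.+2 h.
      by rewrite /bump h0 !exprS !mulrA mulfV ?mul1r// gt_eqF.
    rewrite ger0_norm ?mulr_ge0 ?bump_ge0 ?(ltW h0)//.
    apply: (le_trans (ler_wpM2l (ltW h0) (bump_le _ _))).
    rewrite -ler_pdivlMr ?ltr0n ?fact_gt0//.
    apply: (le_trans (ler_norm h)); apply: ltW.
    by near: h; apply: dnbhs0_lt; rewrite divr_gt0// ltr0n fact_gt0.
  apply: DeriveDef; first by apply/cvg_ex; exists 0.
  exact: cvg_lim H.
Unshelve. all: by end_near. Qed.

Lemma bump0_ge x : 1/2 <= x -> expR (- 2) <= bump 0 x.
Proof.
move=> x2; have x0 : 0 < x by lra.
rewrite /bump x0 expr0 mul1r ler_expR lerN2 -[leRHS]invrK lef_pV2 ?posrE ?invr_gt0//.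
by rewrite -div1r.
Qed.

Definition step x := bump 0 x / (bump 0 x + bump 0 (1 - x)).

Lemma step_den x : expR (- 2) <= bump 0 x + bump 0 (1 - x).
Proof.
have b1 := bump_ge0 0 x; have b2 := bump_ge0 0 (1 - x).
have [x2|x2] := leP (1/2) x; first by have := bump0_ge x2; lra.
have x3 : 1/2 <= 1 - x by lra.
have := bump0_ge x3; lra.
Qed.

Lemma step_den_gt0 x : 0 < bump 0 x + bump 0 (1 - x).
Proof. by apply: lt_le_trans (step_den x); exact: expR_gt0. Qed.

Lemma step_ge0 x : 0 <= step x.
Proof. by rewrite divr_ge0 ?bump_ge0// ltW// step_den_gt0. Qed.

Lemma step_le1 x : step x <= 1.
Proof. by rewrite ler_pdivrMr ?step_den_gt0// mul1r lerDl bump_ge0. Qed.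

Lemma step0 x : x <= 0 -> step x = 0.
Proof. by move=> x0; rewrite /step bump_lt0// mul0r. Qed.

Lemma step1 x : 1 <= x -> step x = 1.
Proof.
move=> x1; have := step_den_gt0 x; rewrite /step (@bump_lt0 0 (1 - x)) ?subr_le0//.
by rewrite addr0 => h; rewrite divff// gt_eqF.
Qed.

End Bump.

(** * Cut-off functions and weights on intervals with generalized end points *)

Section Cutoff.
Variables (R : realType) (rho : gauge R).
Local Notation TN := (tame_upto rho (fun=> setT)).

Let oT (e : R) : 0 < e <= 1 -> open [set: R].
Proof. by move=> _; exact: openT. Qed.
Let pT (P : set (R -> R)) u : P u -> \forall e \near 0^'+, [set: R] (u e).
Proof. by move=> _; exact: nearW. Qed.

Lemma tame_upto_bump k n : TN setT k (fun _ => bump n).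
Proof.
have mb n' u : moderate rho (fun e => bump n' (u e)).
  apply: (moderate_le _ (moderate_cst rho n'`!%:R)); apply: nearW => e.
  by rewrite !ger0_norm// ?bump_ge0// bump_le.
elim: k n => [|k IH] n; split=> //.
exists (fun _ t => - n%:R * bump n.+1 t + bump n.+2 t); split.
  by move=> e t _ _; exact: is_derive_bump.
apply: tame_uptoD; last exact: IH.
exact: (tame_uptoM (tame_upto_cst _ _ _ (moderate_cst rho (- n%:R))) (IH n.+1)).
Qed.

Lemma tame_upto_affine k P (a b : R -> R) : P `<=` moderate rho -> moderate rho a ->
  moderate rho b -> TN P k (fun e t => a e * t + b e).
Proof.
move=> mP ma mb; apply: tame_uptoD (tame_upto_cst _ _ _ mb).
by apply: tame_uptoM (tame_upto_cst _ _ _ ma) _; exact: tame_upto_id.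
Qed.

(** The denominator of [step] is bounded below by exp(-2), as one of x and 1 - x
    is at least 1/2. *)
Lemma tame_upto_step k : TN (moderate rho) k (fun _ => @step R).
Proof.
have h1 : TN (moderate rho) k (fun _ t => bump 0 t).
  exact: (tame_upto_sub (tame_upto_bump k 0)).
have h2 : TN (moderate rho) k (fun _ t => bump 0 (1 - t)).
  have h := tame_upto_affine k (@subset_refl _ (moderate rho)) (moderate_cst rho (-1)) (moderate_cst rho 1).
  have hc := tame_upto_comp (tame_upto_bump k 0) h (fun _ _ _ _ => I) (fun _ _ => I).
  by apply: (tame_upto_eq oT (@pT _) hc) => e t _ _; rewrite mulN1r addrC.
apply: tame_uptoM => //; apply: (tame_uptoV oT (@pT _)); first exact: tame_uptoD.
  by move=> e t _ _; rewrite gt_eqF// step_den_gt0.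
move=> u _; apply: (moderate_le _ (moderate_cst rho (expR 2))); apply: nearW => e.
rewrite normfV !gtr0_norm ?step_den_gt0 ?expR_gt0//.
rewrite -[leRHS]invrK lef_pV2 ?posrE ?invr_gt0 ?step_den_gt0 ?expR_gt0//.
by rewrite -expRN step_den.
Qed.

(** A smooth map of the real line into a slightly larger interval that is the
    identity near [A,B]: composing with it extends nets from neighbourhoods of
    [A,B] to the whole line.  It is obtained from the identity by a product of
    two steps of width rho^N, which vanishes far away, where all points are sent to A. *)
Lemma cutoff (A B : R -> R) N (P : set (R -> R)) : moderate rho A -> moderate rho B ->
  (forall e, 0 < e <= 1 -> A e <= B e) -> P `<=` moderate rho ->
  exists phi : R -> R -> R, [/\ tame rho (fun=> setT) P phi,
    forall e t, 0 < e <= 1 ->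
      A e - 2 * rho e ^+ N <= phi e t <= B e + 2 * rho e ^+ N &
    forall e t, 0 < e <= 1 -> A e - rho e ^+ N <= t <= B e + rho e ^+ N ->
      phi e t = t].
Proof.
move=> mA mB AB mP.
pose r e := rho e ^+ N; pose s e := (rho e)^-1 ^+ N.
have r0 e : 0 < e <= 1 -> 0 < r e.
  by move=> /(gauge_itv rho) /andP[r0 _]; rewrite exprn_gt0.
have sr e : 0 < e <= 1 -> s e * r e = 1.
  by move=> /r0 re; rewrite /s exprVn mulVf// gt_eqF.
have s0 e : 0 < e <= 1 -> 0 <= s e.
  by move=> /(gauge_itv rho) /andP[re _]; rewrite /s exprn_ge0// invr_ge0 ltW.
have ms : moderate rho s by exact: moderate_rhoV.
have mr : moderate rho r by exact: moderate_rho.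
pose a e t := s e * t + s e * (2 * r e - A e).
pose b e t := - s e * t + s e * (B e + 2 * r e).
pose chi e t := step (a e t) * step (b e t).
exists (fun e t => A e + (t - A e) * chi e t); split.
- move=> k.
  have m2r : moderate rho (fun e => 2 * r e).
    exact: moderateM (moderate_cst rho 2) mr.
  have ha : TN P k a by apply: tame_upto_affine => //; apply: moderateM => //; exact: moderateB.
  have hb : TN P k b.
    apply: tame_upto_affine => //; first exact: moderateN.
    by apply: moderateM => //; exact: moderateD.
  have hchi : TN P k chi.
    apply: tame_uptoM; apply: (tame_upto_comp (tame_upto_step k)) => //.
      by move=> u Pu; exact: (tame_upto_moderate ha Pu).
    by move=> u Pu; exact: (tame_upto_moderate hb Pu).
  apply: tame_uptoD; first exact: (tame_upto_cst _ _ _ mA).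
  apply: tame_uptoM => //.
  have h1 := tame_upto_affine k mP (moderate_cst rho 1) (moderateN mA).
  by apply: (tame_upto_eq oT (@pT _) h1) => e t _ _; rewrite mul1r.
- move=> e t e01; have re := r0 e e01; have ABe := AB e e01.
  have c0 : 0 <= chi e t by rewrite mulr_ge0 ?step_ge0.
  have c1 : chi e t <= 1.
    by rewrite -[leRHS]mulr1 ler_pM ?step_ge0 ?step_le1.
  rewrite -/(r e).
  have [ta|ta] := leP t (A e - 2 * r e).
    have -> : chi e t = 0.
      rewrite /chi step0 ?mul0r// /a -mulrDr mulr_ge0_le0 ?s0//; lra.
    rewrite mulr0 addr0; lra.
  have [tb|tb] := leP (B e + 2 * r e) t.
    have -> : chi e t = 0.
      rewrite /chi (step0 (x := b e t)) ?mulr0// /b mulNr addrC -mulrBr.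
      rewrite mulr_ge0_le0 ?s0//; lra.
    rewrite mulr0 addr0; lra.
  move: c0 c1; clear -ta tb re ABe; set c := chi e t; nra.
- move=> e t e01 /andP[tA tB]; have re := r0 e e01; have sre := sr e e01.
  rewrite -/(r e) in tA tB.
  have -> : chi e t = 1.
    rewrite /chi !step1 ?mulr1//; rewrite -sre.
      rewrite /b mulNr addrC -mulrBr ler_wpM2l ?s0//; lra.
    rewrite /a -mulrDr ler_wpM2l ?s0//; lra.
  ring.
Qed.

(** The product of exp(-1/x) at the rescaled distances (t - A)/rho^N and
    (B - t)/rho^N; these are at least 1 in the inner interval. *)
Lemma weight (A B : R -> R) N (P : set (R -> R)) : moderate rho A -> moderate rho B ->
  P `<=` moderate rho ->
  exists w : R -> R -> R, [/\ tame rho (fun=> setT) P w,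
    forall e t, 0 <= w e t,
    forall e t, 0 < e <= 1 -> t <= A e \/ B e <= t -> w e t = 0 &
    forall e t, 0 < e <= 1 -> A e + rho e ^+ N <= t <= B e - rho e ^+ N ->
      expR (- 4) <= w e t].
Proof.
move=> mA mB mP.
pose r e := rho e ^+ N; pose s e := (rho e)^-1 ^+ N.
have r0 e : 0 < e <= 1 -> 0 < r e.
  by move=> /(gauge_itv rho) /andP[r0 _]; rewrite exprn_gt0.
have sr e : 0 < e <= 1 -> s e * r e = 1.
  by move=> /r0 re; rewrite /s exprVn mulVf// gt_eqF.
have s0 e : 0 < e <= 1 -> 0 <= s e.
  by move=> /(gauge_itv rho) /andP[re _]; rewrite /s exprn_ge0// invr_ge0 ltW.
have ms : moderate rho s by exact: moderate_rhoV.
pose a e t := s e * t + s e * (- A e).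
pose b e t := - s e * t + s e * B e.
exists (fun e t => bump 0 (a e t) * bump 0 (b e t)); split.
- move=> k.
  have ha : TN P k a by apply: tame_upto_affine => //; apply: moderateM => //; exact: moderateN.
  have hb : TN P k b.
    by apply: tame_upto_affine => //; [exact: moderateN|exact: moderateM].
  apply: tame_uptoM.
    exact: (tame_upto_comp (tame_upto_bump k 0) ha (fun _ _ _ _ => I) (fun _ _ => I)).
  exact: (tame_upto_comp (tame_upto_bump k 0) hb (fun _ _ _ _ => I) (fun _ _ => I)).
- by move=> e t; rewrite mulr_ge0 ?bump_ge0.
- move=> e t e01 [tA|tB].
    by rewrite bump_lt0 ?mul0r// /a -mulrDr mulr_ge0_le0 ?s0// subr_le0.
  rewrite (@bump_lt0 _ _ (b e t)) ?mulr0// /b mulNr addrC -mulrBr.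
  by rewrite mulr_ge0_le0 ?s0// subr_le0.
- move=> e t e01 /andP[tA tB]; have sre := sr e e01.
  rewrite -/(r e) in tA tB.
  have h1 : 1 <= a e t by rewrite -sre /a -mulrDr ler_wpM2l ?s0//; lra.
  have h2 : 1 <= b e t by rewrite -sre /b mulNr addrC -mulrBr ler_wpM2l ?s0//; lra.
  have -> : - 4 = - 2 + - 2 :> R by ring.
  by rewrite expRD ler_pM ?expR_ge0//; apply: bump0_ge; lra.
Qed.

End Cutoff.

(** * Generalized curves and tame nets *)

Section OneVariable.
Variable R : realType.
Implicit Types (g : R -> R) (x : 'rV[R]_1).

Lemma growth_num g x i :
  (fun h : R => h^-1 *: (g ((h *: (delta_mx 0 i : 'rV[R]_1) + x) 0 0) - g (x 0 0))) =
  (fun h : R => h^-1 *: (g (h *: 1 + x 0 0) - g (x 0 0))).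
Proof. by apply/funext => h; rewrite !mxE (ord1 i) eqxx. Qed.

(** With [derivable_num] and [ipartial_num]: functions of a row vector with one
    entry are functions of one variable. *)
Lemma derive_num g x i :
  'D_(delta_mx 0 i) (fun y : 'rV[R]_1 => g (y 0 0)) x = derive1 g (x 0 0).
Proof. by rewrite derive1E /derive growth_num. Qed.

Lemma derivable_num g x i : derivable g (x 0 0) 1 ->
  derivable (fun y : 'rV[R]_1 => g (y 0 0)) x (delta_mx 0 i).
Proof. by rewrite /derivable growth_num. Qed.

Lemma ipartial_num g s :
  ipartial s (fun y : 'rV[R]_1 => g (y 0 0)) = (fun y => derive1n (size s) g (y 0 0)).
Proof.
elim: s => [//|i s IH] /=; apply/funext => x.
by rewrite IH derive_num.
Qed.

Lemma derivable_continuous g t : derivable g t 1 -> {for t, continuous g}.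
Proof. by move=> /derivable1_diffP /differentiable_continuous. Qed.

Lemma smooth_in_num (U : set R) g :
  (forall k t, U t -> derivable (derive1n k g) t 1) ->
  smooth_in [set x : 'rV[R]_1 | U (x 0 0)] (fun y => g (y 0 0)).
Proof.
move=> h x Ux s; rewrite ipartial_num; split=> [|i].
  apply: (@continuous_comp _ _ _ (fun y : 'rV[R]_1 => y 0 0) (derive1n (size s) g)).
    exact: coord_continuous.
  exact/derivable_continuous/h.
exact/derivable_num/h.
Qed.

Lemma open_num (U : set R) : open U -> open [set x : 'rV[R]_1 | U (x 0 0)].
Proof. by move=> oU; apply: open_comp oU => x _; exact: coord_continuous. Qed.

Lemma derive1nD (f g : R -> R) (c : R) i :
  (forall k t, derivable (derive1n k f) t 1) ->
  (forall k t, derivable (derive1n k g) t 1) ->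
  derive1n i (fun t => f t + c * g t) =
  (fun t => derive1n i f t + c * derive1n i g t).
Proof.
move=> hf hg; elim: i => [//|i IH].
rewrite derive1nS IH; apply/funext => t; rewrite !derive1nS !derive1E.
have d1 := derivableP (hf i t); have d2 := derivableP (hg i t).
have d3 := is_deriveD d1 (is_deriveZ c d2).
have -> : (fun t => derive1n i f t + c * derive1n i g t) =
  derive1n i f + c \*: derive1n i g by [].
by rewrite (@derive_val _ _ _ _ _ _ _ d3).
Qed.

End OneVariable.

Section Bridge.
Variables (R : realType) (rho : gauge R).
Local Notation Rt := (Rtilde rho).

Definition reps_of (S : set Rt) : set (R -> R) :=
  [set u | exists2 t, S t & gnum u t].

Lemma reps_of_moderate S : reps_of S `<=` moderate rho.
Proof. by move=> u [t _ /gnum_moderate]. Qed.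

Lemma gsf_of_tame k (S : set Rt) (c : Rt -> 'rV[Rt]_k) (U : R -> set R)
    (f : 'I_k -> R -> R -> R) :
  (forall e, 0 < e <= 1 -> open (U e)) ->
  (forall u, reps_of S u -> \forall e \near 0^'+, U e (u e)) ->
  (forall j, tame rho U (reps_of S) (f j)) ->
  (forall t u j, S t -> gnum u t -> gnum (fun e => f j e (u e)) (c t 0 j)) ->
  gsf_defined_by (num_set S) (of_num c) (fun e => [set x | U e (x 0 0)])
    (fun e x => \row_j f j e (x 0 0)).
Proof.
move=> oU PU hf fc.
have E e j : (fun y : 'rV[R]_1 => (\row_j f j e (y 0 0)) 0 j) =
             (fun y : 'rV[R]_1 => f j e (y 0 0)).
  by apply/funext => y; rewrite mxE.
have sF e : 0 < e <= 1 -> smooth_on [set x : 'rV[R]_1 | U e (x 0 0)]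
    (fun x => \row_j f j e (x 0 0)).
  move=> e01; apply: smooth_on_of_coords; first exact/open_num/oU.
  move=> j; rewrite E; apply: smooth_in_num => i t Ut.
  exact: (tame_derive oU PU (tame_deriven oU PU i (hf j))).1.
split=> [e e01|x Sx u ux|x u Sx ux].
- by split; [exact/open_num/oU|exact: sF].
- by apply: PU; exists (x 0 0).
- split=> [j|alpha].
    apply: (gnum_near (fc (x 0 0) (fun e => u e 0 0) j Sx (ux 0))).
    by apply: nearW => e; rewrite mxE.
  apply/moderate_enorm => j.
  pose s := flatten [seq nseq (alpha i) i | i <- enum 'I_1].
  have Pu : reps_of S (fun e => u e 0 0) by exists (x 0 0).
  have h := tame_upto_moderate (tame_deriven oU PU (size s) (hf j) 0%N) Pu.
  apply: (moderate_le _ h).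
  apply: filterS2 (near_itv01 R) (PU _ Pu) => e e01 Ue.
  rewrite (partials_coord _ _ (open_num (oU e e01)) (sF e e01) Ue) E.
  by rewrite -/s -/(ipartial s _) ipartial_num.
Qed.

Lemma mpartial_num k (U : set R) (f : 'I_k -> R -> R) (x : 'rV[R]_1) i j :
  open U -> U (x 0 0) -> (forall j n t, U t -> derivable (derive1n n (f j)) t 1) ->
  mpartial (fun=> i) (fun x => \row_j f j (x 0 0)) x 0 j = derive1n i (f j) (x 0 0).
Proof.
move=> oU Ux hf.
have E j' : (fun y : 'rV[R]_1 => (\row_j f j (y 0 0)) 0 j') =
             (fun y : 'rV[R]_1 => f j' (y 0 0)).
  by apply/funext => y; rewrite mxE.
have sF : smooth_on [set x : 'rV[R]_1 | U (x 0 0)] (fun x => \row_j f j (x 0 0)).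
  apply: smooth_on_of_coords; first exact: open_num.
  by move=> j'; rewrite E; apply: smooth_in_num => n t Ut; exact: hf.
rewrite (partials_coord _ _ (open_num oU) sF Ux) E -/(ipartial _ _) ipartial_num.
by rewrite size_flatten /shape -map_comp enum_ordSl enum_ord0 /= size_nseq addn0.
Qed.

(** Moving one coordinate away from the ends of [a,b] by rho^M makes the point
    sharply interior; as b - a is at least a power of rho, there is room for
    this. *)
Lemma slab_adherent n (i0 : 'I_n) (a b : Rt) (x : 'rV[Rt]_n) : glt a b ->
  gitv a b (x 0 i0) -> adherent [set x : 'rV[Rt]_n | gitv a b (x 0 i0)] x.
Proof.
move=> ab xab u N ux.
have [A Aa] := gnum_ex a; have [B Bb] := gnum_ex b.
have [K HK] := glt_net Aa Bb ab.
pose M := (K + N).+1.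
pose cl e := Num.max (A e + rho e ^+ M) (Num.min (u e 0 i0) (B e - rho e ^+ M)).
pose v e : 'rV[R]_n := \row_j (if j == i0 then cl e else u e 0 j).
have h1 := gle_net Aa (ux i0) xab.1 M; have h2 := gle_net (ux i0) Bb xab.2 M.
have basic : \forall e \near 0^'+, [/\ 0 < rho e <= 1, 2 * rho e ^+ M <= rho e ^+ K,
    2 * rho e ^+ M <= rho e ^+ N & 0 < rho e ^+ M].
  near=> e.
  have re : 0 < rho e <= 1 by near: e; exact: near_gauge.
  have /andP[r0 r1] := re.
  have r2 : 2 * rho e <= 1.
    by rewrite mulrC -ler_pdivlMr// mul1r; apply/ltW; near: e; apply: near_gauge_lt.
  have hM : 2 * rho e ^+ M <= rho e ^+ (K + N).
    by rewrite /M exprS mulrA ler_piMl// exprn_ge0// ltW.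
  split=> //; last by rewrite exprn_gt0.
    by apply: (le_trans hM); rewrite rho_expW// leq_addr.
  by apply: (le_trans hM); rewrite rho_expW// leq_addl.
have clb : \forall e \near 0^'+, [/\ `|cl e - u e 0 i0| <= 2 * rho e ^+ M,
    A e + rho e ^+ M <= cl e & cl e <= B e - rho e ^+ M].
  near=> e.
  have [_ q1 _ q2] : [/\ 0 < rho e <= 1, 2 * rho e ^+ M <= rho e ^+ K,
    2 * rho e ^+ M <= rho e ^+ N & 0 < rho e ^+ M] by near: e.
  have q3 : A e <= u e 0 i0 + rho e ^+ M by near: e.
  have q4 : u e 0 i0 <= B e + rho e ^+ M by near: e.
  have q5 : A e + rho e ^+ K <= B e by near: e.
  move: q1 q2 q3 q4 q5; rewrite /cl; clear.
  set r := rho e ^+ M; set w := u e 0 i0; rewrite /Num.max /Num.min ler_norml.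
  by case: (ltP w) => h4; case: (ltP (A e + r)) => h5; split; lra.
have vu : \forall e \near 0^'+, `|v e - u e| <= rho e ^+ N.
  apply: filterS2 basic clb => e [re _ q1 q2] [q3 _ _].
  have rN : 0 <= rho e ^+ N by lra.
  apply/rVnorm_leP => // j; rewrite !mxE; case: eqP => [->|_].
    exact: le_trans q3 q1.
  by rewrite subrr normr0.
have [z vz] : exists z : 'rV[Rt]_n, gvec v z.
  apply: moderate_gvec => j.
  have mu := gnum_moderate (ux j).
  apply: (moderate_le _ (moderateD (moderate_rho rho N) (moderate_le (v := fun e => u e 0 j) (u := fun e => `|u e 0 j|) _ mu))); last first.
    by apply: nearW => e; rewrite normr_id.
  apply: filterS2 (near_gauge rho) vu => e /andP[r0 _] h.
  have := le_trans (rVnorm_coord _ j) h; rewrite !mxE => h'.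
  rewrite [leRHS]ger0_norm ?addr_ge0 ?exprn_ge0 ?(ltW r0)//.
  by rewrite -[X in `|X| <= _](subrK (u e 0 j)) (le_trans (ler_normD _ _))// lerD2r.
exists z; last by exists v.
apply: (@net_interior _ _ _ _ z v M vz) => w y wy wv /=.
apply: (net_gitv Aa Bb (wy i0)) => k.
have wv0 : \forall e \near 0^'+, `|w e 0 i0 - cl e| <= rho e ^+ M.
  apply: filterS wv => e h; have := le_trans (rVnorm_coord _ i0) h.
  by rewrite !mxE eqxx.
near=> e.
have [_ q1 q2] : [/\ `|cl e - u e 0 i0| <= 2 * rho e ^+ M,
    A e + rho e ^+ M <= cl e & cl e <= B e - rho e ^+ M] by near: e.
have q3 : `|w e 0 i0 - cl e| <= rho e ^+ M by near: e.
have /andP[r0 _] : 0 < rho e <= 1 by near: e; exact: near_gauge.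
have q4 : 0 <= rho e ^+ k by rewrite exprn_ge0// ltW.
move: q3 q1 q2 q4; clear; rewrite ler_norml => /andP[? ?] *; lra.
Unshelve. all: by end_near. Qed.

End Bridge.

(** * Nets on a generalized interval *)

Section Interval.
Variables (R : realType) (rho : gauge R).
Local Notation Rt := (Rtilde rho).
Variables (t1 t2 : Rt) (ht : glt t1 t2) (A B : R -> R).
Hypothesis (At : gnum A t1) (Bt : gnum B t2).
Hypothesis AB : forall e, 0 < e <= 1 -> A e <= B e.
Local Notation P := (reps_of (gitv t1 t2)).
Local Notation tameI := (tame rho (fun=> setT) P).

Let oT (e : R) : 0 < e <= 1 -> open [set: R].
Proof. by move=> _; exact: openT. Qed.
Let pT u : P u -> \forall e \near 0^'+, [set: R] (u e).
Proof. by move=> _; exact: nearW. Qed.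

Lemma reps_of_near (u v : R -> R) : P u -> (\forall e \near 0^'+, v e = u e) -> P v.
Proof. by move=> [t It ut] vu; exists t => //; exact: gnum_near ut vu. Qed.

Lemma reps_of_net (u : R -> R) :
  (forall N, \forall e \near 0^'+, A e - rho e ^+ N <= u e <= B e + rho e ^+ N) -> P u.
Proof.
move=> h.
have mu : moderate rho u.
  have mA := gnum_moderate At; have mB := gnum_moderate Bt.
  have nm (w : R -> R) : moderate rho w -> moderate rho (fun e => `|w e|).
    by apply: moderate_le; apply: nearW => e; rewrite normr_id.
  apply: (moderate_le _ (moderateD (moderateD (nm _ mA) (nm _ mB)) (moderate_cst rho 1))).
  apply: filterS (h 0%N) => e; rewrite expr0 => /andP[h1 h2].
  rewrite [leRHS]ger0_norm ?addr_ge0//.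
  have := ler_norm (B e); have := ler_norm (- A e); rewrite normrN => a b.
  have := normr_ge0 (A e); have := normr_ge0 (B e) => c d.
  rewrite ler_norml; lra.
have [t ut] := moderate_gnum mu; exists t => //.
exact: (net_gitv At Bt ut).
Qed.

Lemma reps_of_in (u : R -> R) : (\forall e \near 0^'+, A e <= u e <= B e) -> P u.
Proof.
move=> h; apply: reps_of_net => N.
apply: filterS2 (near_gauge rho) h => e /andP[r0 _] /andP[h1 h2].
have : 0 <= rho e ^+ N by rewrite exprn_ge0// ltW.
by move=> r1; apply/andP; split; lra.
Qed.

Lemma reps_of_bounds (u : R -> R) N : P u ->
  \forall e \near 0^'+, A e - rho e ^+ N <= u e <= B e + rho e ^+ N.
Proof.
move=> [t [h1 h2] ut].
apply: filterS2 (gle_net At ut h1 N) (gle_net ut Bt h2 N) => e a b.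
by apply/andP; split; lra.
Qed.

(** A net that lies in [A - rho^N, B + rho^N] for all N represents a point of
    [t1,t2], so that [saturation] applies to these intervals. *)
Lemma interval_saturation (ok : nat -> R -> R -> Prop) :
  (forall N e t, 0 < e <= 1 -> ok N e t -> ok N.+1 e t) ->
  (forall u, P u -> exists N, \forall e \near 0^'+, ok N e (u e)) ->
  exists N, \forall e \near 0^'+, forall t,
    A e - rho e ^+ N <= t <= B e + rho e ^+ N -> ok N e t.
Proof.
move=> okS hok.
apply: (@saturation _ _ (fun N e t => A e - rho e ^+ N <= t <= B e + rho e ^+ N) ok A).
- move=> N; apply: filterS2 (near_gauge rho) (near_itv01 R) => e /andP[r0 _] /AB ABe.
  have : 0 <= rho e ^+ N by rewrite exprn_ge0// ltW.
  by move=> r1; apply/andP; split; lra.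
- move=> N e t /(gauge_itv rho) re /andP[h1 h2].
  by have := rho_expW re (leqnSn N) => r1; apply/andP; split; lra.
- exact: okS.
- by move=> u /reps_of_net /hok.
Qed.

Lemma reps_of_bounded (f : R -> R -> R) :
  (forall u, P u -> moderate rho (fun e => f e (u e))) ->
  exists N, \forall e \near 0^'+, forall t,
    A e - rho e ^+ N <= t <= B e + rho e ^+ N -> `|f e t| <= (rho e)^-1 ^+ N.
Proof.
move=> mf; apply: (@interval_saturation (fun N e t => `|f e t| <= (rho e)^-1 ^+ N)).
  by move=> N e t /(gauge_itv rho) re h; apply: (le_trans h); rewrite rho_invW.
exact: mf.
Qed.

Lemma reps_of_negligible (f : R -> R -> R) n :
  (forall u, P u -> negligible rho (fun e => f e (u e))) ->
  \forall e \near 0^'+, forall t, A e <= t <= B e -> `|f e t| <= rho e ^+ n.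
Proof.
move=> nf.
have [//||N HN] := @interval_saturation (fun N e t => `|f e t| <= rho e ^+ n).
  by move=> u Pu; exists 0%N; exact: nf.
apply: filterS2 (near_gauge rho) HN => e /andP[r0 _] h t /andP[h1 h2]; apply: h.
have : 0 <= rho e ^+ N by rewrite exprn_ge0// ltW.
by move=> r1; apply/andP; split; lra.
Qed.

(** By saturation the curve c stays in the domain Omega for t within rho^N of
    [A,B].  Precomposing c with a cut-off map into that neighbourhood makes the
    composite defined on the whole line, and does not change it near [A,B]. *)
Lemma comp_tame n (X : set 'rV[Rt]_n) (Omega : R -> set 'rV[R]_n)
    (G : R -> 'rV[R]_n -> R) (c : R -> R -> 'rV[R]_n) :
  smooth_net X Omega G ->
  (forall i, tameI (fun e t => c e t 0 i)) ->
  (forall u, P u -> exists2 x, X x & gvec (fun e => c e (u e)) x) ->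
  exists2 g, tameI g & exists N, \forall e \near 0^'+, forall t,
     A e - rho e ^+ N <= t <= B e + rho e ^+ N ->
     Omega e (c e t) /\ g e t = G e (c e t).
Proof.
move=> sG hc cX.
have [//||N0 HN0] := @interval_saturation (fun N e t => Omega e (c e t)).
  move=> u Pu; exists 0%N; have [x Xx ux] := cX u Pu.
  by have [_ XO _] := sG; exact: XO Xx _ ux.
have [phi [hphi phir phi1]] := cutoff N0.+1 (gnum_moderate At) (gnum_moderate Bt) AB
   (@reps_of_moderate _ rho (gitv t1 t2)).
pose good e := [/\ 0 < e <= 1, 2 * rho e ^+ N0.+1 <= rho e ^+ N0 &
   forall t, A e - rho e ^+ N0 <= t <= B e + rho e ^+ N0 -> Omega e (c e t)].
have gg : \forall e \near 0^'+, good e.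
  near=> e; have e01 : 0 < e <= 1 by near: e; exact: near_itv01.
  have /andP[r0 _] := gauge_itv rho e01.
  split=> //; last by near: e.
  rewrite exprS mulrA ler_piMl ?exprn_ge0 ?(ltW r0)//.
  by rewrite mulrC -ler_pdivlMr// mul1r; apply/ltW; near: e; apply: near_gauge_lt.
have goodO e t : good e -> Omega e (c e (phi e t)).
  move=> [e01 r2 H]; apply: H; have /andP[h1 h2] := phir e t e01.
  by apply/andP; split; lra.
have Pphi u : P u -> P (fun e => phi e (u e)).
  move=> Pu; apply: (reps_of_near Pu).
  apply: filterS2 (near_itv01 R) (reps_of_bounds N0.+1 Pu) => e e01 h.
  exact: phi1.
exists (fun e t => if `[< good e >] then G e (c e (phi e t)) else 0).
  move=> k; apply: (tame_upto_comp_net k sG gg goodO) => [i k'|u /Pphi /cX//].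
  exact: (tame_upto_comp (hc i k') (hphi k') (fun _ _ _ _ => I) Pphi).
exists N0.+1; near=> e => t tAB.
have ge : good e by near: e.
have [e01 r2 H] := ge.
have phit := phi1 e t e01 tAB.
split; last by case: asboolP => // _; rewrite phit.
by rewrite -phit; exact: goodO.
Unshelve. all: by end_near. Qed.

Lemma interval_adherent t : gitv t1 t2 t ->
  adherent (num_set (gitv t1 t2)) (const_mx t : 'rV[Rt]_1).
Proof. by move=> tI; apply: (@slab_adherent _ _ _ 0) => //; rewrite mxE. Qed.

Lemma gsf_of_global k (c : Rt -> 'rV[Rt]_k) (f : 'I_k -> R -> R -> R) :
  (forall j, tameI (f j)) ->
  (forall t u j, gitv t1 t2 t -> gnum u t -> gnum (fun e => f j e (u e)) (c t 0 j)) ->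
  gsf_defined_by (num_set (gitv t1 t2)) (of_num c) (fun=> setT)
    (fun e x => \row_j f j e (x 0 0)).
Proof.
by move=> hf fc; exact: (@gsf_of_tame _ _ _ _ c (fun=> setT) f (fun e h => oT h) pT hf fc).
Qed.

Lemma tameI_derivable f e i t : tameI f -> 0 < e <= 1 -> derivable (derive1n i (f e)) t 1.
Proof.
by move=> hf e01; exact: (tame_derive (fun e h => oT h) pT (tame_deriven (fun e h => oT h) pT i hf)).1.
Qed.

Lemma tameI_deriven f i : tameI f -> tameI (fun e => derive1n i (f e)).
Proof. exact: (tame_deriven (fun e h => oT h) pT). Qed.

(** End points included: they are adherent to the sharp interior. *)
Lemma gderive1n_net k (c : Rt -> 'rV[Rt]_k) (f : 'I_k -> R -> R -> R) i t u j :
  (forall j, tameI (f j)) ->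
  (forall t u j, gitv t1 t2 t -> gnum u t -> gnum (fun e => f j e (u e)) (c t 0 j)) ->
  gitv t1 t2 t -> gnum u t ->
  gnum (fun e => derive1n i (f j e) (u e)) (gderive1n (gitv t1 t2) i c t 0 j).
Proof.
move=> hf fc tI ut; case: i => [|i]; first exact: fc.
have D := gsf_of_global hf fc.
have ux : gvec (fun e => const_mx (u e) : 'rV[R]_1) (const_mx t).
  by move=> l; rewrite mxE; apply: (gnum_near ut); apply: nearW => e; rewrite mxE.
have Sx : num_set (gitv t1 t2) (const_mx t : 'rV[Rt]_1) by rewrite /num_set /= mxE.
have := gderive_net (fun=> i.+1) D Sx (interval_adherent tI) ux j.
move=> H; apply: (gnum_near H).
apply: filterS (near_itv01 R) => e e01.
by rewrite (@mpartial_num _ _ setT (fun j => f j e) _ _ _ openT)// ?mxE// => *; exact: tameI_derivable.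
Qed.

(** The case of [comp_tame] where the curve is the identity: the domains of a
    defining net can be replaced by the whole line. *)
Lemma global_rep k (c : Rt -> 'rV[Rt]_k) : gsf1 (gitv t1 t2) c ->
  exists2 f : 'I_k -> R -> R -> R, (forall j, tameI (f j)) &
  (forall t u j, gitv t1 t2 t -> gnum u t -> gnum (fun e => f j e (u e)) (c t 0 j)).
Proof.
move=> [[Om [F D]] _].
have H j : exists g, tameI g /\ forall t u, gitv t1 t2 t -> gnum u t ->
    gnum (fun e => g e (u e)) (c t 0 j).
  have ux (u : R -> R) (t : Rt) : gnum u t -> gvec (fun e => const_mx (u e) : 'rV[R]_1) (const_mx t).
    by move=> ut l; rewrite mxE; apply: (gnum_near ut); apply: nearW => e; rewrite mxE.
  have hid (i : 'I_1) : tameI (fun e t => (const_mx t : 'rV[R]_1) 0 i).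
    move=> n; have h : tame_upto rho (fun=> setT) P n (fun _ t => t).
      by apply: tame_upto_id; exact: reps_of_moderate.
    by apply: (tame_upto_eq (fun e h => oT h) pT h) => e t _ _; rewrite mxE.
  have [|g hg [N HN]] := comp_tame (c := fun _ t => const_mx t) (gsf_smooth_net j D) hid.
    move=> u [t tI ut]; exists (const_mx t); last exact: ux.
    by rewrite /num_set /= mxE.
  exists g; split=> // t u tI ut.
  have Sx : num_set (gitv t1 t2) (const_mx t : 'rV[Rt]_1) by rewrite /num_set /= mxE.
  have := gsf_value D Sx (ux _ _ ut) j; rewrite /of_num mxE => h.
  apply: (gnum_near h).
  have Pu : P u by exists t.
  by apply: filterS2 HN (reps_of_bounds N Pu) => e H /H[].
have [f hf] := choice H; exists f => [j|t u j]; first by have [] := hf j.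
by have [_] := hf j; apply.
Qed.

End Interval.

(** * Integrals over compact intervals *)

Section Integrals.
Variable R : realType.
Implicit Types (f g : R -> R) (a b : R).

Definition itvint a b f : R := \int[lebesgue_measure]_(x in `[a, b]) f x.

(** Continuity as a function on the line, at the points of the interval, so that
    no one-sided limits occur at its ends. *)
Definition cont_on a b f := forall t, a <= t <= b -> {for t, continuous f}.

Lemma itvint_integrable a b f : cont_on a b f ->
  (@lebesgue_measure R).-integrable `[a, b] (EFin \o f).
Proof.
move=> cf; apply: continuous_compact_integrable; first exact: segment_compact.
apply: continuous_in_subspaceT => t; rewrite inE /= in_itv/=; exact: cf.
Qed.

Lemma cont_onD a b f g : cont_on a b f -> cont_on a b g ->
  cont_on a b (fun t => f t + g t).
Proof. by move=> cf cg t tab; apply: continuousD; [exact: cf|exact: cg]. Qed.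

Lemma cont_onM a b f g : cont_on a b f -> cont_on a b g ->
  cont_on a b (fun t => f t * g t).
Proof. by move=> cf cg t tab; apply: continuousM; [exact: cf|exact: cg]. Qed.

Lemma cont_on_cst a b c : cont_on a b (fun=> c).
Proof. by move=> t _; exact: cst_continuous. Qed.

Lemma cont_on_sum a b (I : Type) (s : seq I) (F : I -> R -> R) :
  (forall i, cont_on a b (F i)) -> cont_on a b (fun t => \sum_(i <- s) F i t).
Proof.
move=> h; elim: s => [|i s IH].
  by under eq_fun do rewrite big_nil; exact: cont_on_cst.
by under eq_fun do rewrite big_cons; exact: cont_onD.
Qed.

Lemma itvint_eq a b f g : (forall t, a <= t <= b -> f t = g t) -> itvint a b f = itvint a b g.
Proof.
move=> fg; apply: eq_Rintegral => t; rewrite inE /= in_itv/=; exact: fg.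
Qed.

Lemma itvintD a b f g : cont_on a b f -> cont_on a b g ->
  itvint a b (fun t => f t + g t) = itvint a b f + itvint a b g.
Proof. by move=> cf cg; apply: RintegralD => //; exact: itvint_integrable. Qed.

Lemma itvintZ a b c f : cont_on a b f -> itvint a b (fun t => c * f t) = c * itvint a b f.
Proof. by move=> cf; apply: RintegralZl => //; exact: itvint_integrable. Qed.

Lemma itvint0 a b : itvint a b (fun=> 0) = 0.
Proof. by rewrite /itvint Rintegral_cst// mul0r. Qed.

Lemma itvint_sum a b (I : Type) (s : seq I) (F : I -> R -> R) :
  (forall i, cont_on a b (F i)) ->
  itvint a b (fun t => \sum_(i <- s) F i t) = \sum_(i <- s) itvint a b (F i).
Proof.
move=> h; elim: s => [|i s IH].
  by under eq_fun do rewrite big_nil; rewrite big_nil itvint0.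
under eq_fun do rewrite big_cons; rewrite big_cons -IH itvintD//.
exact: cont_on_sum.
Qed.

Lemma itvint_cst a b c : a <= b -> itvint a b (fun=> c) = c * (b - a).
Proof.
move=> ab; rewrite /itvint Rintegral_cst//= lebesgue_measure_itv/= lte_fin.
case: ltP => [//|ba]; have -> : a = b by apply/le_anti; rewrite ab.
by rewrite subrr.
Qed.

Lemma itvint_le a b f g : cont_on a b f -> cont_on a b g ->
  (forall t, a <= t <= b -> f t <= g t) -> itvint a b f <= itvint a b g.
Proof.
move=> cf cg fg; apply: (le_Rintegral _ (itvint_integrable cf) (itvint_integrable cg)) => //.
Qed.

Lemma itvint_norm_le a b f K : a <= b -> cont_on a b f ->
  (forall t, a <= t <= b -> `|f t| <= K) -> `|itvint a b f| <= K * (b - a).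
Proof.
move=> ab cf fK; rewrite -itvint_cst// ler_norml; apply/andP; split.
  rewrite -mulN1r -(itvintZ _ (@cont_on_cst a b K)); apply: itvint_le => //.
    by apply: cont_onM; exact: cont_on_cst.
  by move=> t /fK; rewrite ler_norml mulN1r => /andP[].
apply: itvint_le => //; first exact: cont_on_cst.
by move=> t /fK; rewrite ler_norml => /andP[].
Qed.

Lemma cont_onW a b c d f : a <= c -> d <= b -> cont_on a b f -> cont_on c d f.
Proof.
move=> ac db cf t /andP[ct td]; apply: cf.
by rewrite (le_trans ac ct) (le_trans td db).
Qed.

Lemma itvint_split a b c f : a <= b -> b <= c -> cont_on a c f ->
  itvint a c f = itvint a b f + itvint b c f.
Proof.
move=> ab bc cf; apply/eqP; rewrite addrC -subr_eq /itvint.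
rewrite (@Rintegral_itvB _ f (BLeft a) (BRight c) b)//; last exact: itvint_integrable.
apply/eqP/Rintegral_itv_obnd_cbnd.
apply: integrableS (itvint_integrable cf) => //.
by apply: subset_itvr; rewrite bnd_simp.
Qed.

Lemma itvint_ge a b c d f m : a <= c -> c <= d -> d <= b -> cont_on a b f ->
  (forall t, a <= t <= b -> 0 <= f t) -> (forall t, c <= t <= d -> m <= f t) ->
  m * (d - c) <= itvint a b f.
Proof.
move=> ac cd db cf f0 fm.
have ge0 x y : a <= x -> y <= b -> 0 <= itvint x y f.
  move=> ax yb; apply: Rintegral_ge0 => t; rewrite /= in_itv/= => /andP[h1 h2].
  by apply: f0; rewrite (le_trans ax)//= (le_trans h2).
rewrite (itvint_split (le_trans ac cd) db cf).
rewrite (itvint_split ac cd (cont_onW (lexx _) db cf)).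
have h1 := ge0 a c (lexx _) (le_trans cd db); have h2 := ge0 d b (le_trans ac cd) (lexx _).
have : m * (d - c) <= itvint c d f.
  rewrite -itvint_cst//; apply: itvint_le => //; first exact: cont_on_cst.
  exact: cont_onW ac db cf.
move: h1 h2; set x := itvint a c f; set y := itvint d b f; set z := itvint c d f; lra.
Qed.

(** Both integrals are compared with the one over the union of the intervals;
    the four remaining pieces have length at most d. *)
Lemma itvint_ends a b a' b' f K d : a <= b -> a' <= b' ->
  `|a - a'| <= d -> `|b - b'| <= d ->
  cont_on (Num.min a a') (Num.max b b') f ->
  (forall t, Num.min a a' <= t <= Num.max b b' -> `|f t| <= K) ->
  `|itvint a b f - itvint a' b' f| <= 4 * (K * d).
Proof.
move=> ab ab' aa bb cf fK.
set lo := Num.min a a' in cf fK; set hi := Num.max b b' in cf fK.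
have la : lo <= a by rewrite ge_min lexx.
have la' : lo <= a' by rewrite ge_min lexx orbT.
have hb : b <= hi by rewrite le_max lexx.
have hb' : b' <= hi by rewrite le_max lexx orbT.
have K0 : 0 <= K.
  by apply: (le_trans (normr_ge0 (f a))); apply: fK; rewrite la (le_trans ab).
have E x y : lo <= x -> x <= y -> y <= hi -> itvint lo hi f = itvint lo x f + itvint x y f + itvint y hi f.
  move=> h1 h2 h3; rewrite (itvint_split (le_trans h1 h2) h3 cf).
  by rewrite (itvint_split h1 h2 (cont_onW (lexx _) h3 cf)).
have S x y : lo <= x -> x <= y -> y <= hi -> y - x <= d -> `|itvint x y f| <= K * d.
  move=> h1 h2 h3 h4; apply: (@le_trans _ _ (K * (y - x))); last exact: ler_wpM2l.
  apply: itvint_norm_le => //; first exact: cont_onW h1 h3 cf.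
  by move=> t /andP[h5 h6]; apply: fK; rewrite (le_trans h1)//= (le_trans h6).
have d1 : a - lo <= d /\ a' - lo <= d.
  by move: aa; rewrite /lo /Num.min ler_norml => /andP[? ?]; case: ltP => ?; split; lra.
have d2 : hi - b <= d /\ hi - b' <= d.
  by move: bb; rewrite /hi /Num.max ler_norml => /andP[? ?]; case: ltP => ?; split; lra.
have e1 := E a b la ab hb; have e2 := E a' b' la' ab' hb'.
have s1 := S lo a (lexx _) la (le_trans ab hb) d1.1.
have s2 := S lo a' (lexx _) la' (le_trans ab' hb') d1.2.
have s3 := S b hi (le_trans la ab) hb (lexx _) d2.1.
have s4 := S b' hi (le_trans la' ab') hb' (lexx _) d2.2.
move: e1 e2 s1 s2 s3 s4; clear.
set x1 := itvint lo hi f; set x2 := itvint lo a f; set x3 := itvint a b f; set x4 := itvint b hi f.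
set x5 := itvint lo a' f; set x6 := itvint a' b' f; set x7 := itvint b' hi f.
rewrite !ler_norml => e1 e2 /andP[? ?] /andP[? ?] /andP[? ?] /andP[? ?].
apply/andP; split; lra.
Qed.

Lemma itvint_parts a b (u v u' v' : R -> R) : a <= b ->
  (forall t : R, is_derive t 1 u (u' t)) -> (forall t : R, is_derive t 1 v (v' t)) ->
  (forall t, {for t, continuous u'}) -> (forall t, {for t, continuous v'}) ->
  v a = 0 -> v b = 0 ->
  itvint a b (fun t => u t * v' t) = - itvint a b (fun t => u' t * v t).
Proof.
move=> ab du dv cu' cv' va vb.
have cc (w : R -> R) w' : (forall t : R, is_derive t 1 w (w' t)) -> forall t, {for t, continuous w}.
  move=> dw t; apply: differentiable_continuous; apply/derivable1_diffP.
  by case: (dw t).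
have [ba|ba] := leP b a.
  have -> : b = a by apply/le_anti; rewrite ab ba.
  by rewrite /itvint set_itv1 !Rintegral_set1 oppr0.
have LR (w : R -> R) w' : (forall t : R, is_derive t 1 w (w' t)) -> derivable_oo_LRcontinuous w a b.
  move=> dw; split=> [t _||]; first by case: (dw t).
    exact/cvg_at_right_filter/(cc _ _ dw).
  exact/cvg_at_left_filter/(cc _ _ dw).
have W (w : R -> R) : (forall t, {for t, continuous w}) -> {within `[a, b], continuous w}.
  by move=> cw; apply: continuous_subspaceT => t; exact: cw.
have D (w : R -> R) w' : (forall t : R, is_derive t 1 w (w' t)) -> {in `]a, b[, (derive1 w) =1 w'}.
  by move=> dw t _; rewrite derive1E; case: (dw t).
have := Rintegration_by_parts ba (W _ cu') (LR _ _ du) (D _ _ du) (W _ cv') (LR _ _ dv) (D _ _ dv).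
by rewrite va vb !mulr0 subrr sub0r /itvint => ->.
Qed.

(** The derivative in s is bounded on a compact rectangle around s0, and this
    bound is the integrable majorant for differentiation under the integral. *)
Lemma itvint_derive a b (Phi Phi' : R -> R -> R) s0 r : a <= b -> 0 < r ->
  (forall s t : R, `|s - s0| < r -> a <= t <= b ->
     is_derive s 1 (fun s => Phi s t) (Phi' s t)) ->
  (forall s, `|s - s0| < r -> cont_on a b (Phi s)) ->
  (forall s t : R, `|s - s0| < r -> a <= t <= b ->
     {for (s, t), continuous (fun p : R * R => Phi' p.1 p.2)}) ->
  is_derive s0 1 (fun s => itvint a b (Phi s)) (itvint a b (Phi' s0)).
Proof.
move=> ab r0 dPhi cPhi cPhi'.
pose u := s0 - r / 2; pose v := s0 + r / 2.
have uvr s : u <= s <= v -> `|s - s0| < r.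
  by rewrite /u /v => /andP[? ?]; rewrite ltr_norml; apply/andP; split; lra.
have uvr' s : s \in `]u, v[ -> `|s - s0| < r.
  by rewrite in_itv/= => /andP[? ?]; apply: uvr; rewrite !ltW.
have K : compact (`[u, v]%classic `*` `[a, b]%classic : set (R * R)).
  by apply: compact_setX; exact: segment_compact.
have [||[s1 t1] _ HM] := @compact_EVT_max _ _ (fun p : R * R => `|Phi' p.1 p.2|)
    (`[u, v]%classic `*` `[a, b]%classic) _ K.
- by exists (s0, a); split; rewrite /= in_itv/= ?lexx ?ab// /u /v; apply/andP; split; lra.
- apply: continuous_in_subspaceT => -[s t]; rewrite inE /= => -[/=].
  rewrite !in_itv/= => us at_.
  have c := cPhi' s t (uvr s us) at_.
  by apply: (continuous_comp c); exact: norm_continuous.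
pose M := `|Phi' s1 t1|.
have {}HM s t : u <= s <= v -> a <= t <= b -> `|Phi' s t| <= M.
  by move=> us tab; apply: (HM (s, t)); rewrite inE; split; rewrite /= in_itv.
have ma : measurable (`[a, b]%classic : set (measurableTypeR R)) by exact: measurable_itv.
have d1E s t : s \in `]u, v[ -> t \in `[a, b] -> partial1of2 Phi s t = Phi' s t.
  move=> us; rewrite in_itv/= => tab; rewrite partial1of2E.
  by case: (dPhi s t (uvr' s us) tab).
have s0I : s0 \in `]u, v[ by rewrite in_itv/= /u /v; apply/andP; split; lra.
have := @cvg_differentiation_under_integral R _ _ (@lebesgue_measure R) Phi `[a, b]
   ma s0 u v s0I.
have h1 : forall x, `]u, v[%classic x ->
   (@lebesgue_measure R).-integrable `[a, b] (EFin \o Phi x).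
  by move=> s us; apply: itvint_integrable; apply: cPhi; exact: uvr'.
have h2 : forall x y, `]u, v[%classic x -> `[a, b]%classic y -> derivable (Phi ^~ y) x 1.
  move=> s t us; rewrite /= in_itv/= => tab.
  by case: (dPhi s t (uvr' s us) tab).
have h3 : (@lebesgue_measure R).-integrable `[a, b] (EFin \o (fun=> M)).
  by apply: itvint_integrable; exact: cont_on_cst.
have h4 : forall x y, `]u, v[%classic x -> `[a, b]%classic y ->
    `|partial1of2 Phi x y| <= M.
  move=> s t us tab; rewrite d1E//; apply: HM.
    by move: us; rewrite /= in_itv/= => /andP[? ?]; rewrite !ltW.
  by move: tab; rewrite /= in_itv.
move=> /(_ h1 h2 (fun=> M) (fun=> normr_ge0 _) h3 h4) H.
have E : \int[lebesgue_measure]_(y in `[a, b]) partial1of2 Phi s0 y = itvint a b (Phi' s0).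
  by apply: eq_Rintegral => t; rewrite inE => tab; rewrite d1E.
rewrite E in H.
have E2 : (fun h : R => h^-1 *: (itvint a b (Phi (h *: 1 + s0)) - itvint a b (Phi s0))) =
   (fun h : R => h^-1 *: (itvint a b (Phi (h + s0)) - itvint a b (Phi s0))).
  by apply/funext => h; rewrite [h *: 1]mulr1.
apply: DeriveDef.
  by apply/cvg_ex; exists (itvint a b (Phi' s0)); rewrite E2.
by apply/cvg_lim => //; rewrite E2.
Qed.

End Integrals.

Lemma itv_widen (R : realType) (a b r t : R) : 0 <= r -> a <= t <= b ->
  a - r <= t <= b + r.
Proof. by move=> r0 /andP[? ?]; apply/andP; split; lra. Qed.

Lemma itv_widen_ends (R : realType) (a b a' b' r r' t : R) : r' <= r ->
  `|a - a'| <= r' -> `|b - b'| <= r' -> 0 < r ->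
  Num.min a a' <= t <= Num.max b b' -> a - r <= t <= b + r.
Proof.
rewrite ge_min le_max !ler_norml => rr /andP[? ?] /andP[? ?] ? /andP[h1 h2].
by apply/andP; split; [case/orP: h1 => ?; lra|case/orP: h2 => ?; lra].
Qed.

(** * Generalized integrals *)

Section GIntegral.
Variables (R : realType) (rho : gauge R).
Local Notation Rt := (Rtilde rho).
Variables (t1 t2 : Rt) (ht : glt t1 t2) (A B : R -> R).
Hypothesis (At : gnum A t1) (Bt : gnum B t2).
Hypothesis AB : forall e, 0 < e <= 1 -> A e <= B e.
Local Notation P := (reps_of (gitv t1 t2)).
Local Notation tameI := (tame rho (fun=> setT) P).

Lemma moderate_length : exists k, \forall e \near 0^'+, B e - A e <= (rho e)^-1 ^+ k.
Proof.
have [k hk] := moderateB (gnum_moderate Bt) (gnum_moderate At).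
by exists k; apply: filterS hk => e; apply: le_trans; exact: ler_norm.
Qed.

Lemma tameI_continuous f e t : tameI f -> 0 < e <= 1 -> {for t, continuous (f e)}.
Proof.
move=> hf e01; apply/derivable_continuous.
by have h : derivable (derive1n 0 (f e)) t 1 by exact: tameI_derivable hf e01.
Qed.

Lemma itvint_moderate (f : R -> R -> R) :
  (\forall e \near 0^'+, cont_on (A e) (B e) (f e)) ->
  (forall u, P u -> moderate rho (fun e => f e (u e))) ->
  moderate rho (fun e => itvint (A e) (B e) (f e)).
Proof.
move=> cf mf; have [N HN] := reps_of_bounded At Bt AB mf; have [k Hk] := moderate_length.
apply: (moderate_le _ (moderateM (moderate_rhoV rho N) (moderate_rhoV rho k))).
near=> e.
have e01 : 0 < e <= 1 by near: e; exact: near_itv01.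
have ABe := AB e01.
have /andP[r0 _] := gauge_itv rho e01.
have rN : 0 <= rho e ^+ N by rewrite exprn_ge0// ltW.
have rV : 0 <= (rho e)^-1 ^+ N by rewrite exprn_ge0// invr_ge0 ltW.
have bl : B e - A e <= (rho e)^-1 ^+ k by near: e.
have bf : forall t, A e - rho e ^+ N <= t <= B e + rho e ^+ N -> `|f e t| <= (rho e)^-1 ^+ N.
  by near: e.
have cfe : cont_on (A e) (B e) (f e) by near: e.
apply: le_trans (ler_norm _); apply: (le_trans (@itvint_norm_le _ _ _ _ ((rho e)^-1 ^+ N) ABe cfe _)).
  by move=> t tAB; apply: bf; exact: itv_widen.
by rewrite ler_wpM2l.
Unshelve. all: by end_near. Qed.

Lemma itvint_negligible (f : R -> R -> R) :
  (\forall e \near 0^'+, cont_on (A e) (B e) (f e)) ->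
  (forall u, P u -> negligible rho (fun e => f e (u e))) ->
  negligible rho (fun e => itvint (A e) (B e) (f e)).
Proof.
move=> cf nf n; have [k Hk] := moderate_length.
have Hn := reps_of_negligible At Bt AB (n + k) nf.
near=> e.
have e01 : 0 < e <= 1 by near: e; exact: near_itv01.
have ABe := AB e01.
have /andP[r0 _] := gauge_itv rho e01.
have bl : B e - A e <= (rho e)^-1 ^+ k by near: e.
have bf : forall t, A e <= t <= B e -> `|f e t| <= rho e ^+ (n + k) by near: e.
have cfe : cont_on (A e) (B e) (f e) by near: e.
apply: (le_trans (itvint_norm_le ABe cfe bf)).
apply: (@le_trans _ _ (rho e ^+ (n + k) * (rho e)^-1 ^+ k)).
  by rewrite ler_wpM2l// exprn_ge0// ltW.
by rewrite exprD -mulrA exprVn mulfV ?mulr1// expf_neq0// gt_eqF.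
Unshelve. all: by end_near. Qed.

(** Two defining nets differ by a net that is negligible along all points of
    [t1,t2], hence uniformly on [A,B] by saturation; two choices of end points
    differ by an arbitrarily high power of rho, against a moderate bound of the
    integrand. *)
Lemma gintegral_net (f : Rt -> Rt) (g : R -> R -> R) : tameI g ->
  (forall t u, gitv t1 t2 t -> gnum u t -> gnum (fun e => g e (u e)) (f t)) ->
  gnum (fun e => itvint (A e) (B e) (g e)) (gintegral t1 t2 f t1 t2).
Proof.
move=> hg gf.
have cg : \forall e \near 0^'+, cont_on (A e) (B e) (g e).
  by apply: filterS (near_itv01 R) => e e01 t _; exact: tameI_continuous.
have [y0 gy0] := moderate_gnum (itvint_moderate cg (fun u Pu => tame_upto_moderate (hg 0%N) Pu)).
rewrite /gintegral; set Y := (X in xget _ X).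
have : Y y0.
  exists (fun e x => \row_j (fun _ : 'I_1 => g) j e (x 0 0)), A, B; split=> //.
    apply: (gsf_of_global (c := to_num f) (f := fun _ : 'I_1 => g)) => //.
    by move=> t u j It ut; rewrite mxE; exact: gf.
  apply: (gnum_near gy0); apply: filterS (near_itv01 R) => e /AB ABe.
  by rewrite /oriented_integral ABe; apply: itvint_eq => t _; rewrite !mxE.
move/(xgetI 0); set y := xget _ _ => -[F [u [v [D ut vt H]]]].
apply: (gnum_negl H).
pose g' e t := F e (const_mx t : 'rV[R]_1) 0 0.
have ux (w : R -> R) (t : Rt) : gnum w t -> gvec (fun e => const_mx (w e) : 'rV[R]_1) (const_mx t).
  by move=> wt l; rewrite mxE; apply: (gnum_near wt); apply: nearW => e; rewrite mxE.
have g'f w t : gitv t1 t2 t -> gnum w t -> gnum (fun e => g' e (w e)) (f t).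
  move=> It wt.
  have Sx : num_set (gitv t1 t2) (const_mx t : 'rV[Rt]_1) by rewrite /num_set /= mxE.
  by have := gsf_value D Sx (ux _ _ wt) 0; rewrite /of_num /to_num !mxE.
have cg' e t : 0 < e <= 1 -> {for t, continuous (g' e)}.
  move=> e01; have [h1 _ _] := D; have [oO sO] := h1 e e01.
  have sF := smooth_on_coord 0 oO sO.
  apply: (@continuous_comp _ _ _ (fun t : R => (const_mx t : 'rV[R]_1)) (fun y => F e y 0 0)).
    apply: differentiable_continuous; apply/derivable1_diffP/derivable_mxP => i j.
    by under eq_fun do rewrite mxE; exact: derivable_id.
  exact: (sF _ I [::]).1.
have mg' w : P w -> moderate rho (fun e => g' e (w e)).
  by move=> [t It wt]; exact: gnum_moderate (g'f w t It wt).
have n1 : negligible rho (fun e => itvint (A e) (B e) (fun t => g e t + -1 * g' e t)).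
  apply: itvint_negligible.
    apply: filterS (near_itv01 R) => e e01; apply: cont_onD.
      by move=> t _; exact: tameI_continuous.
    by apply: cont_onM; [exact: cont_on_cst|move=> t _; exact: cg'].
  move=> w [t It wt].
  apply: (negligible_le _ (gnum_eq (gf t w It wt) (g'f w t It wt))).
  by apply: nearW => e; rewrite mulN1r.
have n2 : negligible rho (fun e => itvint (A e) (B e) (g' e) - itvint (u e) (v e) (g' e)).
  move=> n; have [N HN] := reps_of_bounded At Bt AB mg'.
  have hu := gnum_eq At ut (N + n.+1)%N; have hv := gnum_eq Bt vt (N + n.+1)%N.
  have [K HK] := glt_net ut vt ht.
  near=> e.
  have e01 : 0 < e <= 1 by near: e; exact: near_itv01.
  have re := gauge_itv rho e01; have /andP[r0 r1] := re.
  have rN : 0 < rho e ^+ N by rewrite exprn_gt0.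
  have rK : 0 < rho e ^+ K by rewrite exprn_gt0.
  have a1 : `|A e - u e| <= rho e ^+ (N + n.+1) by near: e.
  have a2 : `|B e - v e| <= rho e ^+ (N + n.+1) by near: e.
  have a3 : u e + rho e ^+ K <= v e by near: e.
  have uv : u e <= v e by apply: le_trans a3; rewrite lerDl ltW.
  have a4 : forall t, A e - rho e ^+ N <= t <= B e + rho e ^+ N -> `|g' e t| <= (rho e)^-1 ^+ N.
    by near: e.
  have a5 : rho e ^+ (N + n.+1) <= rho e ^+ N by rewrite rho_expW// leq_addr.
  have a6 : 4 * rho e <= 1.
    by rewrite mulrC -ler_pdivlMr// mul1r; apply/ltW; near: e; apply: near_gauge_lt.
  have bnd : forall t, Num.min (A e) (u e) <= t <= Num.max (B e) (v e) ->
      `|g' e t| <= (rho e)^-1 ^+ N.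
    by move=> t tAB; apply: a4; exact: itv_widen_ends a5 a1 a2 rN tAB.
  apply: (le_trans (itvint_ends (AB e01) uv a1 a2 (fun t _ => cg' e t e01) bnd)).
  rewrite exprD (mulrA ((rho e)^-1 ^+ N)) exprVn mulVf ?mul1r ?gt_eqF// exprS mulrA.
  by rewrite ler_piMl// exprn_ge0// ltW.
apply: (negligible_le _ (negligibleD n1 n2)).
have [K HK] := glt_net ut vt ht.
near=> e.
have e01 : 0 < e <= 1 by near: e; exact: near_itv01.
have /andP[r0 _] := gauge_itv rho e01.
have uv : u e <= v e.
  have : u e + rho e ^+ K <= v e by near: e.
  by apply: le_trans; rewrite lerDl exprn_ge0// ltW.
rewrite /oriented_integral uv -/(itvint (u e) (v e) (g' e)).
rewrite itvintD; last first.
- by apply: cont_onM; [exact: cont_on_cst|move=> t _; exact: cg'].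
- by move=> t _; exact: tameI_continuous.
rewrite itvintZ; last by move=> t _; exact: cg'.
by rewrite mulN1r addrA subrK.
Unshelve. all: by end_near. Qed.

End GIntegral.

(** * Integrals along an affine family of curves *)

Section Variation.
Variables (R : realType) (rho : gauge R) (n : nat).
Local Notation Rt := (Rtilde rho).
Variables (t1 t2 : Rt) (A B : R -> R).
Hypothesis (At : gnum A t1) (Bt : gnum B t2).
Hypothesis AB : forall e, 0 < e <= 1 -> A e <= B e.
Local Notation P := (reps_of (gitv t1 t2)).
Local Notation tameI := (tame rho (fun=> setT) P).
Variables (X : set 'rV[Rt]_n) (Omega : R -> set 'rV[R]_n).
Variables (gam eta : R -> R -> 'rV[R]_n).
Hypothesis hgam : forall i, tameI (fun e t => gam e t 0 i).
Hypothesis heta : forall i, tameI (fun e t => eta e t 0 i).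
Hypothesis XO : X `<=` @internal R rho n Omega.
Let c e s t := s *: eta e t + gam e t.
Hypothesis cX : forall s u, moderate rho s -> P u ->
  exists2 x, X x & gvec (fun e => c e (s e) (u e)) x.

Let S e : set R := [set s | exists2 r, `|s| < r &
  forall s' t, `|s'| < r -> A e <= t <= B e -> Omega e (c e s' t)].

Lemma vec_continuous (w : R -> R -> 'rV[R]_n) e t :
  (forall i, tameI (fun e t => w e t 0 i)) -> 0 < e <= 1 -> {for t, continuous (w e)}.
Proof.
move=> hw e01; apply: differentiable_continuous; apply/derivable1_diffP/derivable_mxP => i j.
have h : derivable (derive1n 0 (fun t => w e t 0 j)) t 1 by exact: tameI_derivable (hw j) e01.
by rewrite ord1.
Qed.

Lemma c_continuous e s t : 0 < e <= 1 ->
  {for (s, t), continuous (fun p : R * R => c e p.1 p.2)}.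
Proof.
move=> e01.
have c2 : {for (s, t), continuous (@snd R R)} by exact: cvg_snd.
have c1 : {for (s, t), continuous (@fst R R)} by exact: cvg_fst.
have ce : {for (s, t), continuous (fun p : R * R => eta e p.2)}.
  by apply: (continuous_comp c2); exact: vec_continuous heta e01.
have cg : {for (s, t), continuous (fun p : R * R => gam e p.2)}.
  by apply: (continuous_comp c2); exact: vec_continuous hgam e01.
by apply: cvgD; [exact: cvgZ c1 ce|exact: cg].
Qed.

Lemma S_open e : 0 < e <= 1 -> open (S e).
Proof.
move=> _; rewrite openE => s [r sr H].
apply/nbhs_ballP; exists (r - `|s|); first by rewrite /= subr_gt0.
move=> s'; rewrite /ball/= => ss; exists r => //.
have := ler_normB s (s - s'); rewrite opprB addrC subrK => h.
by apply: (le_lt_trans h); rewrite -ltrBrDl.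
Qed.

(** The set S e of the parameters s for which all curves c e s', |s'| < r for
    some r > |s|, stay in the domain is open by construction.  A moderate net
    eventually lies in it, by saturation on pairs (s', t): moderate nets s' and
    nets t representing points of the interval give points of X, whose
    representatives eventually lie in Omega. *)
Lemma S_moderate s : moderate rho s -> \forall e \near 0^'+, S e (s e).
Proof.
move=> [k hk].
have [||||N HN] := @saturation R (R * R)
  (fun _ e p => `|p.1| <= (rho e)^-1 ^+ k + 1 /\ A e <= p.2 <= B e)
  (fun _ e p => Omega e (c e p.1 p.2)) (fun e => (0, A e)).
- move=> _; apply: filterS (near_itv01 R) => e e01; rewrite /= normr0 lexx AB//; split=> //.
  have /andP[r0 _] := gauge_itv rho e01.
  by rewrite addr_ge0// exprn_ge0// invr_ge0 ltW.
- by [].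
- by [].
- move=> p hp; exists 0%N.
  have ms : moderate rho (fun e => (p e).1).
    apply: (moderate_le _ (moderateD (moderate_rhoV rho k) (moderate_cst rho 1))).
    by apply: filterS (hp 0%N) => e [h _]; apply: (le_trans h); exact: ler_norm.
  have Pt : P (fun e => (p e).2).
    by apply: (reps_of_in At Bt); apply: filterS (hp 0%N) => e [].
  have [x Xx cx] := cX ms Pt.
  by move: (XO Xx cx); apply: filterS.
apply: filterS2 hk HN => e h H; exists ((rho e)^-1 ^+ k + 1).
  by apply: (le_lt_trans h); rewrite ltrDl.
by move=> s' t s'k tAB; apply: (H (s', t)); split=> //=; exact: ltW.
Qed.

Definition curve_int (g : R -> 'rV[R]_n -> R) (a : R -> R -> R) e s :=
  itvint (A e) (B e) (fun t => g e (c e s t) * a e t).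

Lemma curve_int_cont g a e s t : smooth_net X Omega g -> tameI a -> 0 < e <= 1 ->
  Omega e (c e s t) ->
  {for (s, t), continuous (fun p : R * R => g e (c e p.1 p.2) * a e p.2)}.
Proof.
move=> sg ha e01 Oc; have [/(_ e e01)[oO sO] _ _] := sg.
have c2 : {for (s, t), continuous (@snd R R)} by exact: cvg_snd.
have h1 := @continuous_comp _ _ _ (fun p : R * R => c e p.1 p.2) (g e) (s, t)
  (c_continuous (s := s) (t := t) e01) (sO _ Oc [::]).1.
have h2 := @continuous_comp _ _ _ (@snd R R) (a e) (s, t) c2 (tameI_continuous ha e01).
exact: (continuousM h1 h2).
Qed.

Lemma curve_int_cont_on g a e s : smooth_net X Omega g -> tameI a -> 0 < e <= 1 -> S e s ->
  cont_on (A e) (B e) (fun t => g e (c e s t) * a e t).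
Proof.
move=> sg ha e01 [r sr H] t tAB.
have cc := curve_int_cont sg ha e01 (H s t sr tAB).
have c3 : {for t, continuous (fun t : R => (s, t))}.
  move=> W [[W1 W2] /= [h1 h2] HW]; apply: filterS h2 => z Wz; apply: HW; split=> //=.
  exact: nbhs_singleton h1.
exact: (@continuous_comp _ _ _ (fun t : R => (s, t))
  (fun p : R * R => g e (c e p.1 p.2) * a e p.2) t c3 cc).
Qed.

(** The derivative is a sum of integrals of the same kind, with partial
    derivatives of g in place of g and coordinates of eta in the weight a.  This
    is why the weight is there: the family of such integrals is closed under
    differentiation, and [curve_int_tame] is an induction. *)
Lemma curve_int_derive g a e s : smooth_net X Omega g -> tameI a -> 0 < e <= 1 -> S e s ->
  is_derive s 1 (curve_int g a e)
    (\sum_i curve_int (fun e => ipartial [:: i] (g e)) (fun e t => eta e t 0 i * a e t) e s).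
Proof.
move=> sg ha e01 Ss; have [r sr H] := Ss; have [/(_ e e01)[oO sO] _ _] := sg.
pose D s t := \sum_i ipartial [:: i] (g e) (c e s t) * (eta e t 0 i * a e t).
have sl (s' : R) : `|s' - s| < r - `|s| -> `|s'| < r.
  move=> h; have := ler_normD (s' - s) s; rewrite subrK => h'.
  by apply: (le_lt_trans h'); rewrite -ltrBrDr.
have r0 : 0 < r - `|s| by rewrite subr_gt0.
have hea i : tameI (fun e t => eta e t 0 i * a e t).
  by move=> k; apply: tame_uptoM; [exact: heta|exact: ha].
have := @itvint_derive R (A e) (B e) (fun s t => g e (c e s t) * a e t) D s (r - `|s|)
  (AB e01) r0.
have -> : itvint (A e) (B e) (D s) =
    \sum_i curve_int (fun e => ipartial [:: i] (g e)) (fun e t => eta e t 0 i * a e t) e s.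
  rewrite /D itvint_sum// => i.
  exact: (curve_int_cont_on (smooth_net_ipartial [:: i] sg) (hea i) e01 Ss).
apply.
- move=> s' t /sl s'r tAB.
  have Oc := H s' t s'r tAB.
  have dg : is_derive s' 1 (fun s => g e (c e s t))
      (\sum_i 'D_(delta_mx 0 i) (g e) (c e s' t) * eta e t 0 i).
    apply: (@chain_rule _ _ (g e) (fun s => c e s t) (fun=> eta e t)).
      move=> i; rewrite [X in is_derive _ _ X](_ : _ = fun s => s * eta e t 0 i + gam e t 0 i).
        apply: is_derive_eq; rewrite addr0 scaler1 /GRing.scale/=.
        by rewrite ?mulr0 ?add0r ?mulr1.
      by apply/funext => z; rewrite !mxE.
    exact: smooth_in_differentiable oO sO Oc.
  apply: (is_derive_eq (is_deriveM dg (is_derive_cst (a e t) s' 1))).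
  rewrite scaler0 add0r /D scaler_sumr; apply: eq_bigr => i _.
  by rewrite /GRing.scale/= mulrA mulrC.
- move=> s' /sl s'r.
  apply: (curve_int_cont_on sg ha e01); exists r => //.
- move=> s' t /sl s'r tAB; have Oc := H s' t s'r tAB.
  rewrite /D; apply: (@cvg_big R _ +%R 0 xpredT (@add_continuous R) _ (nbhs (s', t))
    (index_enum _) (fun i p => ipartial [:: i] (g e) (c e p.1 p.2) * (eta e p.2 0 i * a e p.2))
    (fun i => ipartial [:: i] (g e) (c e s' t) * (eta e t 0 i * a e t))) => i _.
  exact: (curve_int_cont (smooth_net_ipartial [:: i] sg) (hea i) e01 Oc).
Qed.

Lemma curve_int_tame g a k : smooth_net X Omega g -> tameI a ->
  tame_upto rho S (moderate rho) k (curve_int g a).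
Proof.
have mm g' a' s : smooth_net X Omega g' -> tameI a' -> moderate rho s ->
    moderate rho (fun e => curve_int g' a' e (s e)).
  move=> sg ha ms; apply: (itvint_moderate At Bt AB).
    apply: filterS2 (near_itv01 R) (S_moderate ms) => e e01 Se.
    exact: curve_int_cont_on.
  move=> u Pu; have [x Xx cx] := cX ms Pu; have [_ _ mg] := sg.
  exact: moderateM (mg x _ [::] Xx cx) (tame_upto_moderate (ha 0%N) Pu).
elim: k g a => [|k IH] g a sg ha.
  by split=> // s ms; exact: mm.
split=> [s ms|]; first exact: mm.
exists (fun e s => \sum_i curve_int (fun e => ipartial [:: i] (g e))
   (fun e t => eta e t 0 i * a e t) e s); split.
  by move=> e s e01 Ss; exact: curve_int_derive.
apply: (@tame_upto_sum _ _ S (moderate rho) S_open S_moderate k _ (index_enum _)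
  (fun i => curve_int (fun e => ipartial [:: i] (g e)) (fun e t => eta e t 0 i * a e t))) => i.
apply: IH; first exact: smooth_net_ipartial.
by move=> k'; apply: tame_uptoM; [exact: heta|exact: ha].
Qed.

Lemma gderive_at0 G a (J : Rt -> Rt) : smooth_net X Omega G -> tameI a ->
  (forall s z, gnum s z -> gnum (fun e => curve_int G a e (s e)) (J z)) ->
  gnum (fun e => \sum_i curve_int (fun e => ipartial [:: i] (G e))
                   (fun e t => eta e t 0 i * a e t) e 0)
       (gderive1n setT 1 (to_num J) 0 0 0).
Proof.
move=> sG ha GJ.
have PM : reps_of [set: Rt] = moderate rho.
  apply/seteqP; split=> [u [t _ /gnum_moderate]//|u mu].
  by have [t ut] := moderate_gnum mu; exists t.
have D : gsf_defined_by (num_set setT) (of_num (to_num J)) (fun e => [set x | S e (x 0 0)])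
    (fun e x => \row_(j < 1) curve_int G a e (x 0 0)).
  apply: (@gsf_of_tame _ _ 1 setT (to_num J) S (fun _ => curve_int G a)).
  - exact: S_open.
  - by rewrite PM; exact: S_moderate.
  - by move=> _ k; rewrite PM; exact: curve_int_tame.
  - by move=> t u j _ ut; rewrite mxE; exact: GJ.
have ux : gvec (fun e => const_mx 0 : 'rV[R]_1) (const_mx 0 : 'rV[Rt]_1).
  by move=> l; rewrite !mxE; exact: gnum0.
have int : sharp_interior (num_set setT) (const_mx 0 : 'rV[Rt]_1).
  by have [r _ r0] := rho_class rho 0; exists r.
have ad : adherent (num_set setT) (const_mx 0 : 'rV[Rt]_1).
  move=> u N u0; exists (const_mx 0) => //; exists u => //.
  by apply: filterS (near_gauge rho) => e /andP[r0 _]; rewrite subrr normr0 exprn_ge0// ltW.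
have := gderive_net (fun=> 1%N) D I ad ux 0 => H.
apply: (gnum_near H).
apply: filterS2 (near_itv01 R) (S_moderate (moderate_cst rho 0)) => e e01 S0.
rewrite (@mpartial_num _ _ (S e) (fun _ => curve_int G a e))//.
- by rewrite mxE /= derive1E; have [_ ->] := curve_int_derive sG ha e01 S0.
- exact: S_open.
- by rewrite /= mxE.
- move=> j k t St.
  exact: (tame_derive S_open S_moderate (tame_deriven S_open S_moderate k
     (fun k => curve_int_tame k sG ha))).1.
Qed.

End Variation.

(** * Elementary facts on functions of one variable *)

Section Classical.
Variable R : realType.

(** All derivatives vanish outside [a,b], and they are continuous. *)
Lemma vanishing_derivatives (g : R -> R) a b i : a <= b ->
  (forall k t, derivable (derive1n k g) t 1) ->
  (forall t, t <= a \/ b <= t -> g t = 0) ->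
  derive1n i g a = 0 /\ derive1n i g b = 0.
Proof.
move=> ab dg g0.
have H t : t < a \/ b < t -> derive1n i g t = 0.
  elim: i t => [|i IH] t h; first by apply: g0; case: h => /ltW; [left|right].
  have oO : open ([set s : R | s < a] `|` [set s : R | b < s]).
    by apply: openU; [exact: open_lt|exact: open_gt].
  have E (s : R) : ([set s : R | s < a] `|` [set s : R | b < s]) s -> cst 0 s = derive1n i g s.
    by move=> hs; rewrite IH.
  have := eq_near_is_derive oO h E (is_derive_cst 0 t 1).
  by rewrite derive1nS derive1E => -[_ ->].
have Z t : (forall r, 0 < r -> exists2 s, `|t - s| < r & derive1n i g s = 0) ->
    derive1n i g t = 0.
  move=> Hr; apply/eqP; rewrite -normr_eq0 eq_le normr_ge0 andbT.
  rewrite leNgt; apply/negP => t0.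
  have /cvgrPdist_lt /(_ _ t0) := derivable_continuous (dg i t).
  move=> /nbhs_ballP[r /= r0 Hb].
  have [s ts s0] := Hr r r0.
  have := Hb s ts; rewrite /= s0 subr0; by rewrite ltxx.
split; apply: Z => r r0.
  exists (a - r / 2); last by apply: H; left; lra.
  by rewrite opprB addrC subrK gtr0_norm; lra.
exists (b + r / 2); last by apply: H; right; lra.
by rewrite opprD addrA subrr sub0r normrN gtr0_norm; lra.
Qed.

Lemma lipschitz_itv (E D : R -> R) a b K s t :
  (forall t : R, is_derive t 1 E (D t)) -> (forall t, a <= t <= b -> `|D t| <= K) ->
  a <= s <= b -> a <= t <= b -> `|E t - E s| <= K * `|t - s|.
Proof.
move=> dE DK; wlog st : s t / s <= t => [H|] sab tab.
  by have [h|/ltW h] := leP s t; [exact: H|rewrite distrC (distrC t); exact: H].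
have [|r rst ->] := @MVT_segment R E D s t st (fun r _ => dE r).
  by apply: derivable_within_continuous => r _; case: (dE r).
rewrite normrM ler_wpM2r//; apply: DK; move: rst; rewrite in_itv/= => /andP[h1 h2].
have /andP[h3 _] := sab; have /andP[_ h4] := tab.
by rewrite (le_trans h3 h1) (le_trans h2 h4).
Qed.

(** |E| stays above x/2 within distance 2 de of t0.  Depending on the half of
    [a,b] in which t0 lies, the interval [t0 + de, t0 + 2 de] or
    [t0 - 2 de, t0 - de] keeps distance de from both ends of [a,b], so that w is
    bounded below on it. *)
Lemma weighted_lower_bound (a b de K x mw t0 : R) (E D w F : R -> R) :
  0 < de -> 6 * de <= b - a -> a <= t0 <= b ->
  (forall t : R, is_derive t 1 E (D t)) -> (forall t, a <= t <= b -> `|D t| <= K) ->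
  K * (2 * de) <= x / 2 -> 0 <= x -> x <= `|E t0| ->
  0 <= mw -> (forall t, 0 <= w t) ->
  (forall t, a + de <= t <= b - de -> mw <= w t) ->
  cont_on a b F -> (forall t, a <= t <= b -> E t ^+ 2 * w t <= F t) ->
  (x / 2) ^+ 2 * mw * de <= itvint a b F.
Proof.
move=> d0 dab /andP[at0 t0b] dE DK Kd x0 xE mw0 w0 wm cF EF.
have K0 : 0 <= K.
  by apply: (le_trans (normr_ge0 (D t0))); apply: DK; rewrite at0.
have F0 t : a <= t <= b -> 0 <= F t.
  by move=> tab; apply: le_trans (EF t tab); rewrite mulr_ge0 ?sqr_ge0.
have near0 t : a <= t <= b -> `|t - t0| <= 2 * de -> x / 2 <= `|E t|.
  move=> /andP[at_ tb] tt0.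
  have tab : a <= t <= b by rewrite at_ tb.
  have t0ab : a <= t0 <= b by rewrite at0 t0b.
  have h := lipschitz_itv dE DK t0ab tab.
  have h2 : K * `|t - t0| <= K * (2 * de) by rewrite ler_wpM2l.
  have h3 : `|E t0| <= `|E t| + `|E t - E t0|.
    by rewrite -{1}(subKr (E t) (E t0)) ler_normB.
  lra.
have key c : a + de <= c -> c + de <= b - de -> (forall t, c <= t <= c + de -> `|t - t0| <= 2 * de) ->
    (x / 2) ^+ 2 * mw * de <= itvint a b F.
  move=> ac cb ct.
  have -> : (x / 2) ^+ 2 * mw * de = (x / 2) ^+ 2 * mw * (c + de - c) by rewrite addrAC subrr add0r.
  apply: itvint_ge => //; [lra|lra|lra|].
  move=> t /andP[t1 t2]; have tab : a <= t <= b by apply/andP; split; lra.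
  apply: le_trans (EF t tab).
  apply: ler_pM => //; first exact: sqr_ge0.
    rewrite -[leRHS]real_normK ?num_real// lerXn2r ?nnegrE//; first lra.
    by apply: near0 => //; apply: ct; rewrite t1.
  by apply: wm; apply/andP; split; lra.
have [h|h] := leP t0 ((a + b) / 2).
  apply: (key (t0 + de)); [lra|lra|].
  by move=> t /andP[? ?]; rewrite ler_norml; apply/andP; split; lra.
apply: (key (t0 - 2 * de)); [lra|lra|].
by move=> t /andP[? ?]; rewrite ler_norml; apply/andP; split; lra.
Qed.

End Classical.

(** * Jets *)

Section JetRow.
Variables (d m : nat).

(** The coordinate of the jet space that carries the j-th entry of q^(i). *)
Definition jet_index (i : 'I_m.+1) (j : 'I_d) : 'I_(1 + m.+1 * d) :=
  rshift 1 (mxvec_index i j).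

Definition jet_row (T : Type) (t : T) (M : 'I_m.+1 -> 'I_d -> T) : 'rV[T]_(1 + m.+1 * d) :=
  row_mx (const_mx t) (mxvec (\matrix_(i, j) M i j)).

Lemma jet_row0 T (t : T) M : jet_row t M 0 (lshift _ 0) = t.
Proof. by rewrite row_mxEl mxE. Qed.

Lemma jet_rowE T (t : T) M i j : jet_row t M 0 (jet_index i j) = M i j.
Proof. by rewrite row_mxEr mxvecE mxE. Qed.

Lemma jet_indexP (l : 'I_(1 + m.+1 * d)) :
  l = lshift _ 0 \/ exists i j, l = jet_index i j.
Proof.
case: (splitP l) => k lk.
  by left; apply: val_inj; rewrite /= lk; case: k {lk} => -[].
right; case/mxvec_indexP: k lk => i j lk; exists i, j.
exact: val_inj.
Qed.

Lemma sum_jet_index (V : nmodType) (F : 'I_(1 + m.+1 * d) -> V) :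
  \sum_l F l = F (lshift _ 0) + \sum_i \sum_j F (jet_index i j).
Proof.
rewrite big_split_ord big_ord1; congr (_ + _).
rewrite pair_bigA /= (reindex _ (curry_mxvec_bij m.+1 d)) /=.
by apply: eq_bigr => -[i j] _.
Qed.

End JetRow.

Section Jets.
Variables (R : realType) (rho : gauge R).
Local Notation Rt := (Rtilde rho).
Variables (t1 t2 : Rt) (ht : glt t1 t2) (A B : R -> R).
Hypothesis (At : gnum A t1) (Bt : gnum B t2).
Hypothesis AB : forall e, 0 < e <= 1 -> A e <= B e.
Local Notation P := (reps_of (gitv t1 t2)).
Local Notation tameI := (tame rho (fun=> setT) P).

Definition represents k (f : 'I_k -> R -> R -> R) (c : Rt -> 'rV[Rt]_k) :=
  forall t u j, gitv t1 t2 t -> gnum u t -> gnum (fun e => f j e (u e)) (c t 0 j).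

Lemma tameI_is_derive (f : R -> R -> R) (e t : R) : tameI f -> 0 < e <= 1 ->
  is_derive t 1 (f e) (derive1 (f e) t).
Proof.
move=> hf e01; have h : derivable (derive1n 0 (f e)) t 1 by exact: tameI_derivable hf e01.
by apply: DeriveDef; [exact: h|rewrite derive1E].
Qed.

Lemma tameI_rep (f : R -> R -> R) u v (t : Rt) : tameI f -> gitv t1 t2 t -> gnum u t -> gnum v t ->
  negligible rho (fun e => f e (u e) - f e (v e)).
Proof.
move=> hf It ut vt n.
have h1 := tameI_deriven 1 hf.
have [N HN] := reps_of_bounded At Bt AB (fun u Pu => tame_upto_moderate (h1 0%N) Pu).
have Hu := reps_of_bounds At Bt N (ex_intro2 _ _ t It ut : P u).
have Hv := reps_of_bounds At Bt N (ex_intro2 _ _ t It vt : P v).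
have Huv := gnum_eq ut vt (N + n)%N.
near=> e.
have e01 : 0 < e <= 1 by near: e; exact: near_itv01.
have /andP[r0 r1] := gauge_itv rho e01.
have b1 : A e - rho e ^+ N <= u e <= B e + rho e ^+ N by near: e.
have b2 : A e - rho e ^+ N <= v e <= B e + rho e ^+ N by near: e.
have b3 : `|u e - v e| <= rho e ^+ (N + n) by near: e.
have b4 : forall t, A e - rho e ^+ N <= t <= B e + rho e ^+ N ->
    `|derive1n 1 (f e) t| <= (rho e)^-1 ^+ N by near: e.
apply: (le_trans (lipschitz_itv (fun t => tameI_is_derive t hf e01) b4 b2 b1)).
apply: (@le_trans _ _ ((rho e)^-1 ^+ N * rho e ^+ (N + n))).
  by rewrite ler_wpM2l// exprn_ge0// invr_ge0 ltW.
by rewrite exprD mulrA exprVn mulVf ?mul1r// expf_neq0// gt_eqF.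
Unshelve. all: by end_near. Qed.

(** Every tame net defines a generalized curve; this is how test functions are
    produced.  The value at t is defined through an arbitrary representative of
    t, on which it does not depend by [tameI_rep]. *)
Lemma tameI_fun k (f : 'I_k -> R -> R -> R) : (forall j, tameI (f j)) ->
  exists c, represents f c.
Proof.
move=> hf.
exists (fun t => \row_j xget 0 [set y : Rt | exists2 u, gnum u t & gnum (fun e => f j e (u e)) y]).
move=> t u j It ut; rewrite mxE.
have [y fy] : exists y : Rt, gnum (fun e => f j e (u e)) y.
  by apply: moderate_gnum; apply: (tame_upto_moderate (hf j 0%N)); exists t.
have : [set y : Rt | exists2 u, gnum u t & gnum (fun e => f j e (u e)) y] y by exists u.
move/(xgetI 0) => [v vt fv]; apply: (gnum_negl fv).
exact: tameI_rep (hf j) It ut vt.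
Qed.

Lemma tameI_id : tameI (fun _ t => t).
Proof. by move=> k; apply: tame_upto_id; exact: reps_of_moderate. Qed.

Lemma tameI_cst (a : R -> R) : moderate rho a -> tameI (fun e _ => a e).
Proof. by move=> ma k; exact: tame_upto_cst. Qed.

Lemma tameIM f g : tameI f -> tameI g -> tameI (fun e t => f e t * g e t).
Proof. by move=> hf hg k; apply: tame_uptoM; [exact: hf|exact: hg]. Qed.

Lemma tameID f g : tameI f -> tameI g -> tameI (fun e t => f e t + g e t).
Proof. by move=> hf hg k; apply: tame_uptoD; [exact: hf|exact: hg]. Qed.

Lemma tameI_eq f g : tameI f -> (forall e t, f e t = g e t) -> tameI g.
Proof.
move=> hf fg k; apply: (tame_upto_eq (fun e _ => openT) (fun u _ => nearW _ (fun _ => I)) (hf k)).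
by move=> e t _ _.
Qed.

Variables (d m : nat).

(** The function tau in the time slot is the identity for jets of curves, and 0
    for the jets of directions h, since the time variable is not varied. *)
Definition jet_curve (tau : R -> R -> R) (f : 'I_d -> R -> R -> R) e t :
    'rV[R]_(1 + m.+1 * d) :=
  jet_row (tau e t) (fun (i : 'I_m.+1) j => derive1n i (f j e) t).

Lemma tameI_jet_curve tau f l : tameI tau -> (forall j, tameI (f j)) ->
  tameI (fun e t => jet_curve tau f e t 0 l).
Proof.
move=> htau hf; have [->|[i [j ->]]] := jet_indexP l.
  by apply: (tameI_eq htau) => e t; rewrite jet_row0.
by apply: (tameI_eq (tameI_deriven i (hf j))) => e t; rewrite jet_rowE.
Qed.

Lemma jetE (q : Rt -> 'rV[Rt]_d) t :
  jet t1 t2 m q t = jet_row t (fun (i : 'I_m.+1) j => gderive1n (gitv t1 t2) i q t 0 j).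
Proof. by rewrite /jet /jet_row; congr (row_mx _ (mxvec _)); apply/matrixP => i j; rewrite !mxE. Qed.

Lemma jet_net f (q : Rt -> 'rV[Rt]_d) t u : (forall j, tameI (f j)) -> represents f q ->
  gitv t1 t2 t -> gnum u t ->
  gvec (fun e => jet_curve (fun _ t => t) f e (u e)) (jet t1 t2 m q t).
Proof.
move=> hf fq It ut l; rewrite jetE; have [->|[i [j ->]]] := jet_indexP l.
  by rewrite jet_row0; apply: (gnum_near ut); apply: nearW => e; rewrite jet_row0.
rewrite jet_rowE; apply: (gnum_near (gderive1n_net ht i j hf fq It ut)).
by apply: nearW => e; rewrite jet_rowE.
Qed.

Lemma jet_in_box (q : Rt -> 'rV[Rt]_d) t : gitv t1 t2 t ->
  jet_box t1 t2 (jet t1 t2 m q t).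
Proof. by move=> It; rewrite /jet_box /= mxE jetE jet_row0. Qed.

(** Only the time coordinate is constrained, so the box is a slab. *)
Lemma box_adherent (x : 'rV[Rt]_(1 + m.+1 * d)) : jet_box t1 t2 x ->
  adherent (jet_box t1 t2 (d := d) (m := m)) x.
Proof.
have -> : jet_box t1 t2 (d := d) (m := m) =
    [set x : 'rV[Rt]_(1 + m.+1 * d) | gitv t1 t2 (x 0 (lshift _ 0))].
  by apply/seteqP; split=> y; rewrite /jet_box /= mxE.
exact: slab_adherent.
Qed.

Lemma jet_grad_net (L : jet_space rho d m -> Rt) Om
    (F : R -> 'rV[R]_(1 + m.+1 * d) -> 'rV[R]_1) (x : 'rV[Rt]_(1 + m.+1 * d)) v i j :
  gsf_defined_by (jet_box t1 t2 (d := d) (m := m)) (to_num L) Om F ->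
  jet_box t1 t2 x -> gvec v x ->
  gnum (fun e => ipartial [:: jet_index i j] (fun y => F e y 0 0) (v e))
       (jet_grad t1 t2 i L x 0 j).
Proof.
move=> D bx vx; rewrite mxE.
have := gderive_net (fun l => (l == jet_index i j) : nat) D bx (box_adherent bx) vx 0 => H.
apply: (gnum_near H); apply: filterS (mpartial_ipartial (fun l => (l == jet_index i j) : nat) 0 D bx vx) => e ->.
have := sort_multiindex [:: jet_index i j].
have -> : [seq nseq (count_mem i0 [:: jet_index i j]) i0 | i0 <- enum 'I_(1 + m.+1 * d)] =
    [seq nseq ((i0 == jet_index i j) : nat) i0 | i0 <- enum 'I_(1 + m.+1 * d)].
  by apply: eq_map => l /=; rewrite addn0 eq_sym.
move=> pe; suff -> : flatten [seq nseq ((i0 == jet_index i j) : nat) i0 | i0 <- enum 'I_(1 + m.+1 * d)] = [:: jet_index i j] by [].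
by apply: perm_small_eq; rewrite // perm_sym.
Qed.

End Jets.

Lemma scaleD_coord (R : pzRingType) n (a : R) (x y : 'rV[R]_n) l :
  (a *: x + y) 0 l = a * x 0 l + y 0 l.
Proof. by rewrite !mxE. Qed.

(** * The first variation *)

Section FirstVariation.
Variables (R : realType) (rho : gauge R).
Local Notation Rt := (Rtilde rho).
Variables (t1 t2 : Rt) (ht : glt t1 t2) (A B : R -> R).
Hypothesis (At : gnum A t1) (Bt : gnum B t2).
Hypothesis AB : forall e, 0 < e <= 1 -> A e <= B e.
Local Notation P := (reps_of (gitv t1 t2)).
Local Notation tameI := (tame rho (fun=> setT) P).
Variables (d m : nat).
Local Notation box := (jet_box t1 t2 (d := d) (m := m)).
Variables (L : jet_space rho d m -> Rt) (Om : R -> set 'rV[R]_(1 + m.+1 * d))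
  (FL : R -> 'rV[R]_(1 + m.+1 * d) -> 'rV[R]_1).
Hypothesis DL : gsf_defined_by box (to_num L) Om FL.
Variables (q h : Rt -> 'rV[Rt]_d) (fq fh : 'I_d -> R -> R -> R).
Hypotheses (gq : forall j, tameI (fq j)) (gh : forall j, tameI (fh j)).
Hypotheses (rq : represents t1 t2 fq q) (rh : represents t1 t2 fh h).

Let G e y := FL e y 0 0.
Let gam := jet_curve m (fun _ t => t) fq.
Let eta := jet_curve m (fun _ _ => 0) fh.

Let ggam l : tameI (fun e t => gam e t 0 l).
Proof. by apply: tameI_jet_curve => //; exact: tameI_id. Qed.

Let geta l : tameI (fun e t => eta e t 0 l).
Proof. by apply: tameI_jet_curve => //; exact: (tameI_cst _ _ (moderate_cst rho 0)). Qed.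

Let fs (s : R -> R) j e t := fq j e t + s e * fh j e t.

Let gs s j : moderate rho s -> tameI (fs s j).
Proof. by move=> ms; apply: tameID => //; apply: tameIM => //; exact: tameI_cst. Qed.

Let rs s z : gnum s z -> represents t1 t2 (fs s) (fun t => q t + z *: h t).
Proof.
move=> sz t u j It ut; rewrite !mxE; apply: gnumD; first exact: rq.
by apply: gnumM => //; exact: rh.
Qed.

Lemma jet_curve_affine s e t : 0 < e <= 1 ->
  jet_curve m (fun _ t => t) (fs s) e t = s e *: eta e t + gam e t.
Proof.
move=> e01; apply/rowP => l; rewrite scaleD_coord.
have [->|[i [j ->]]] := jet_indexP l.
  by rewrite /eta /gam /jet_curve !jet_row0 mulr0 add0r.
rewrite /eta /gam /jet_curve !jet_rowE addrC.
by rewrite (@derive1nD _ (fq j e) (fh j e) (s e) i)// => k t'; exact: tameI_derivable.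
Qed.

Lemma jet_line s z t u : gnum s z -> gitv t1 t2 t -> gnum u t ->
  gvec (fun e => s e *: eta e (u e) + gam e (u e))
       (jet t1 t2 m (fun t => q t + z *: h t) t).
Proof.
move=> sz It ut.
have H := jet_net (m := m) ht (fun j => gs j (gnum_moderate sz)) (rs sz) It ut.
apply: (gvec_near H); apply: filterS (near_itv01 R) => e e01.
by rewrite jet_curve_affine.
Qed.

Let cX s u : moderate rho s -> P u ->
  exists2 x, box x & gvec (fun e => s e *: eta e (u e) + gam e (u e)) x.
Proof.
move=> ms [t It ut]; have [z sz] := moderate_gnum ms.
exists (jet t1 t2 m (fun t => q t + z *: h t) t); first exact: jet_in_box.
exact: jet_line.
Qed.

Let sG : smooth_net box Om G.
Proof. exact: gsf_smooth_net DL. Qed.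

Let XO : box `<=` @internal R rho _ Om.
Proof. by have [_ ? _] := DL. Qed.

(** The integral along q + z h is first written with a net defined on the whole
    line, to which [gintegral_net] applies; this net agrees with L along the jet
    on [A,B]. *)
Lemma action_net s z : gnum s z ->
  gnum (fun e => curve_int A B gam eta G (fun _ _ => 1) e (s e))
       (action t1 t2 L (fun t => q t + z *: h t)).
Proof.
move=> sz; have ms := gnum_moderate sz.
have gc i : tameI (fun e t => (s e *: eta e t + gam e t) 0 i).
  apply: (tameI_eq (tameID (tameIM (tameI_cst _ _ ms) (geta i)) (ggam i))) => e t.
  by rewrite scaleD_coord.
have [g hg [N HN]] := comp_tame At Bt AB sG gc (fun u Pu => cX ms Pu).
have H := gintegral_net ht At Bt AB (f := fun t => L (jet t1 t2 m (fun t => q t + z *: h t) t)) hg.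
apply: (gnum_near (H _)) => [t u It ut|].
  have bx := jet_in_box m (fun t => q t + z *: h t) It.
  have := gsf_value DL bx (jet_line sz It ut) 0; rewrite /to_num mxE => v.
  apply: (gnum_near v).
  apply: filterS2 HN (reps_of_bounds At Bt N (ex_intro2 _ _ t It ut : P u)) => e Hn Hu.
  by have [] := Hn _ Hu.
apply: filterS2 (near_itv01 R) HN => e e01 Hn.
apply: itvint_eq => t tAB; rewrite mulr1.
have /andP[r0 _] := gauge_itv rho e01.
by have [] := Hn t (itv_widen (exprn_ge0 N (ltW r0)) tAB).
Qed.

Lemma first_variation_net :
  gnum (fun e => \sum_l curve_int A B gam eta (fun e => ipartial [:: l] (G e))
                   (fun e t => eta e t 0 l * 1) e 0)
       (first_variation (action t1 t2 L) q h).
Proof.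
have H := gderive_at0 At Bt AB ggam geta XO cX
  (J := fun z => action t1 t2 L (fun t => q t + z *: h t)) sG
  (tameI_cst _ _ (moderate_cst rho 1)) action_net.
exact: H.
Qed.

(** The time slot of the direction is 0 and contributes nothing. *)
Lemma variation_expand e : 0 < e <= 1 ->
  \sum_l curve_int A B gam eta (fun e => ipartial [:: l] (G e))
                   (fun e t => eta e t 0 l * 1) e 0 =
  \sum_(i < m.+1) \sum_j itvint (A e) (B e)
     (fun t => ipartial [:: jet_index i j] (G e) (gam e t) * derive1n i (fh j e) t).
Proof.
move=> e01; rewrite sum_jet_index [X in X + _](_ : _ = 0) ?add0r.
  apply: eq_bigr => i _; apply: eq_bigr => j _; apply: itvint_eq => t _.
  by rewrite scale0r add0r mulr1 jet_rowE.
rewrite /curve_int -[RHS](itvint0 (A e) (B e)); apply: itvint_eq => t _.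
by rewrite jet_row0 mul0r mulr0.
Qed.

End FirstVariation.

(** * Integration by parts and the fundamental lemma *)

Section ByParts.
Variables (R : realType) (rho : gauge R).
Local Notation Rt := (Rtilde rho).
Variables (t1 t2 : Rt) (A B : R -> R).
Hypothesis AB : forall e, 0 < e <= 1 -> A e <= B e.
Local Notation tameI := (tame rho (fun=> setT) (reps_of (gitv t1 t2))).

Lemma itvint_parts_iter i (a f : R -> R -> R) e : tameI a -> tameI f -> 0 < e <= 1 ->
  (forall k, derive1n k (f e) (A e) = 0 /\ derive1n k (f e) (B e) = 0) ->
  itvint (A e) (B e) (fun t => a e t * derive1n i (f e) t) =
  (-1) ^+ i * itvint (A e) (B e) (fun t => derive1n i (a e) t * f e t).
Proof.
move=> ga gf e01 flat; elim: i a ga => [|i IH] a ga.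
  by rewrite expr0 mul1r; apply: itvint_eq.
have ga1 : tameI (fun e => derive1 (a e)) by exact: (tameI_deriven 1 ga).
have gfi := tameI_deriven i gf.
have dv (t : R) : is_derive t 1 (derive1n i (f e)) (derive1n i.+1 (f e) t).
  by rewrite derive1nS; exact: (tameI_is_derive t gfi e01).
have H := itvint_parts (AB e01) (fun t => tameI_is_derive t ga e01) dv
  (fun t => tameI_continuous ga1 e01) (fun t => tameI_continuous (tameI_deriven i.+1 gf) e01)
  (flat i).1 (flat i).2.
rewrite H (IH _ ga1) exprS mulN1r mulNr; congr (- (_ * _)).
by apply: itvint_eq => t _; rewrite derive1Sn.
Qed.

End ByParts.

Lemma gnum_sign (R : realType) (rho : gauge R) i :
  gnum (fun=> (-1) ^+ i) ((-1) ^+ i : Rtilde rho).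
Proof.
elim: i => [|i IH]; first by rewrite !expr0; exact: gnum1.
by rewrite !exprS; exact: (gnumM (gnumN (gnum1 rho)) IH).
Qed.

Lemma small_steps (R : realType) (a b x y z : R) :
  a + z <= b -> x <= y -> y <= 1/8 * z -> 0 < z -> 6 * x <= b - a.
Proof. lra. Qed.

Lemma small_half (R : realType) (x y z : R) :
  x <= y -> y <= 1/8 * z -> 0 < z -> 2 * x <= z / 2.
Proof. lra. Qed.

Section Fundamental.
Variables (R : realType) (rho : gauge R).
Local Notation Rt := (Rtilde rho).
Variables (t1 t2 : Rt) (ht : glt t1 t2) (A B : R -> R).
Hypothesis (At : gnum A t1) (Bt : gnum B t2).
Hypothesis AB : forall e, 0 < e <= 1 -> A e <= B e.
Local Notation P := (reps_of (gitv t1 t2)).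
Local Notation tameI := (tame rho (fun=> setT) P).
Variable d : nat.

(** The weight w may depend on the exponent n for which |E_j| <= rho^n is to be
    proved.  If the bound fails at a point, [weighted_lower_bound] with
    x = rho^n, K = rho^-M and de = rho^Q bounds the integral below by
    exp(-4)/4 * rho^(2n+Q), whereas the hypothesis bounds it by rho^(2n+Q+1).
    The other components of E only increase the integrand, a sum of squares
    times w. *)
Lemma fundamental_lemma (E : 'I_d -> R -> R -> R) :
  (forall j, tameI (E j)) ->
  (forall w : R -> R -> R, tameI w ->
     (forall e t, 0 < e <= 1 -> t <= A e \/ B e <= t -> w e t = 0) ->
     negligible rho (fun e => itvint (A e) (B e)
        (fun t => \sum_j E j e t * (E j e t * w e t)))) ->
  forall j u, P u -> negligible rho (fun e => E j e (u e)).
Proof.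
move=> hE Hw j.
suff H n : \forall e \near 0^'+, forall t, A e <= t <= B e -> `|E j e t| <= rho e ^+ n.
  move=> u [t It ut].
  have [v vt vAB] := gitv_net At Bt AB It.
  have n1 : negligible rho (fun e => E j e (v e)).
    by move=> n; apply: filterS2 (near_itv01 R) (H n) => e e01; apply; exact: vAB.
  have n2 := tameI_rep At Bt AB (hE j) It ut vt.
  apply: (negligible_le _ (negligibleD n1 n2)); apply: nearW => e.
  by rewrite addrC subrK.
have [M HM] := reps_of_bounded At Bt AB (fun u Pu => tame_upto_moderate (tameI_deriven 1 (hE j) 0%N) Pu).
have [K HK] := glt_net At Bt ht.
(* Q exceeds n + M, to control the variation of E_j by rho^-M on the length
   rho^Q, and K, to fit into [A,B], whose length is at least rho^K. *)
pose Q := (n + M + K + 1)%N.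
have QK : (K.+1 <= Q)%N by rewrite /Q addn1 ltnS leq_addl.
have QM : (Q = M + (n + K + 1))%N by rewrite /Q (addnC n M) !addnA.
have nK : (n.+1 <= n + K + 1)%N by rewrite addn1 ltnS leq_addr.
have [w [gw w0 wout win]] := weight Q (gnum_moderate At) (gnum_moderate Bt)
  (@reps_of_moderate _ rho (gitv t1 t2)).
have Hn := Hw w gw wout (n + n + Q + 1)%N.
near=> e => t0 t0AB.
have e01 : 0 < e <= 1 by near: e; exact: near_itv01.
have re := gauge_itv rho e01; have /andP[r0 r1] := re.
rewrite leNgt; apply/negP => big.
have I1 : `|itvint (A e) (B e) (fun t => \sum_j E j e t * (E j e t * w e t))| <=
   rho e ^+ (n + n + Q + 1) by near: e.
have d0 : 0 < rho e ^+ Q by rewrite exprn_gt0.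
have r8 : rho e < 1/8 by near: e; apply: near_gauge_lt; lra.
have rw : rho e < expR (- 4) / 4.
  by near: e; apply: near_gauge_lt; rewrite divr_gt0// expR_gt0.
have dAB : 6 * rho e ^+ Q <= B e - A e.
  have a1 : A e + rho e ^+ K <= B e by near: e.
  have a2 : rho e ^+ Q <= rho e ^+ K.+1 by rewrite rho_expW.
  have a3 : rho e ^+ K.+1 <= 1/8 * rho e ^+ K.
    by rewrite exprS ler_wpM2r ?exprn_ge0// ltW.
  have rK : 0 < rho e ^+ K by rewrite exprn_gt0.
  exact: small_steps a1 a2 a3 rK.
have Dm : forall t, A e - rho e ^+ M <= t <= B e + rho e ^+ M ->
    `|derive1n 1 (E j e) t| <= (rho e)^-1 ^+ M by near: e.
have Dm' t : A e <= t <= B e -> `|derive1 (E j e) t| <= (rho e)^-1 ^+ M.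
  by move=> tAB; apply: Dm; apply: itv_widen => //; rewrite exprn_ge0// ltW.
have Md : (rho e)^-1 ^+ M * (2 * rho e ^+ Q) <= rho e ^+ n / 2.
  rewrite QM exprD mulrCA (mulrA ((rho e)^-1 ^+ M)) exprVn mulVf ?mul1r ?expf_neq0 ?gt_eqF//.
  have b1 : rho e ^+ (n + K + 1) <= rho e ^+ n.+1 by rewrite rho_expW.
  have b2 : rho e ^+ n.+1 <= 1/8 * rho e ^+ n.
    by rewrite exprS ler_wpM2r ?exprn_ge0// ltW.
  have rn : 0 < rho e ^+ n by rewrite exprn_gt0.
  exact: small_half b1 b2 rn.
have cF : cont_on (A e) (B e) (fun t => \sum_j E j e t * (E j e t * w e t)).
  apply: cont_on_sum => i; apply: cont_onM; first by move=> t _; exact: tameI_continuous.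
  by apply: cont_onM => t _; exact: tameI_continuous.
have := @weighted_lower_bound R (A e) (B e) (rho e ^+ Q) ((rho e)^-1 ^+ M) (rho e ^+ n)
  (expR (- 4)) t0 (E j e) (derive1 (E j e)) (w e) _ d0 dAB t0AB
  (fun t => tameI_is_derive t (hE j) e01) Dm' Md (exprn_ge0 n (ltW r0)) (ltW big)
  (expR_ge0 _) (w0 e) (fun t => win e t e01) cF.
move=> /(_ _) LB.
have {}LB : (rho e ^+ n / 2) ^+ 2 * expR (- 4) * rho e ^+ Q <=
   rho e ^+ (n + n + Q + 1).
  apply: le_trans (le_trans (ler_norm _) I1); apply: LB => t tAB.
  rewrite (bigD1 j)//= mulrA -expr2 lerDl sumr_ge0// => i _.
  by rewrite mulrA -expr2 mulr_ge0 ?sqr_ge0.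
move: LB; apply/negP; rewrite -ltNge.
rewrite addn1 (exprS (rho e) (n + n + Q)) (exprD _ (n + n) Q) (exprD _ n n).
have -> : (rho e ^+ n / 2) ^+ 2 * expR (- 4) * rho e ^+ Q =
   expR (- 4) / 4 * (rho e ^+ n * rho e ^+ n * rho e ^+ Q) by field.
by rewrite ltr_pM2r// !mulr_gt0// exprn_gt0.
Unshelve. all: by end_near. Qed.

End Fundamental.

Theorem corollary46 (R : realType) (rho : gauge R) (t1 t2 : Rtilde rho)
    (ht : glt t1 t2) (d m : nat) (hd : (0 < d)%N) (hm : (0 < m)%N)
    (L : jet_space rho d m -> Rtilde rho)
    (hL : gsf (jet_box t1 t2 (d := d) (m := m)) setT (to_num L))
    (q : Rtilde rho -> 'rV[Rtilde rho]_d) (hq : gsf1 (gitv t1 t2) q)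
    (Q : jet_space rho d m -> 'rV[Rtilde rho]_d)
    (hQ : gsf (jet_box t1 t2 (d := d) (m := m)) setT Q)
    (dAlembert : forall h : Rtilde rho -> 'rV[Rtilde rho]_d,
       gsf_flat t1 t2 h ->
       first_variation (action t1 t2 L) q h =
       gintegral t1 t2 (fun t => dot (h t) (Q (jet t1 t2 m q t))) t1 t2) :
  forall t, gitv t1 t2 t ->
    \sum_(i < m.+1) (-1) ^+ i *:
      gderive1n (gitv t1 t2) i
        (fun s => jet_grad t1 t2 i L (jet t1 t2 m q s)) t
    = Q (jet t1 t2 m q t).
Proof.
have [[A [B [At Bt AB]]] _] := ht.
have [[Om [FL DL]] _] := hL; have [[OQ [FQ DQ]] _] := hQ.
have [fq gq rq] := global_rep At Bt AB hq.
pose gam := jet_curve m (fun _ t => t) fq.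
have ggam l : tame rho (fun=> setT) (reps_of (gitv t1 t2)) (fun e t => gam e t 0 l).
  by apply: tameI_jet_curve => //; exact: tameI_id.
have gamX u : reps_of (gitv t1 t2) u ->
    exists2 x, jet_box t1 t2 x & gvec (fun e => gam e (u e)) x.
  move=> [t It ut]; exists (jet t1 t2 m q t); first exact: jet_in_box.
  exact: jet_net.
have comp Om' (G : R -> 'rV[R]_(1 + m.+1 * d) -> R) :
    smooth_net (jet_box t1 t2 (d := d) (m := m)) Om' G ->
    exists g, [/\ tame rho (fun=> setT) (reps_of (gitv t1 t2)) g,
      forall u, reps_of (gitv t1 t2) u ->
        \forall e \near 0^'+, g e (u e) = G e (gam e (u e)) &
      \forall e \near 0^'+, forall t, A e <= t <= B e -> g e t = G e (gam e t)].
  move=> sG; have [g hg [N HN]] := comp_tame At Bt AB sG ggam gamX.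
  exists g; split=> // [u Pu|].
    by apply: filterS2 HN (reps_of_bounds At Bt N Pu) => e Hn Hu; have [] := Hn _ Hu.
  apply: filterS2 (near_gauge rho) HN => e /andP[r0 _] Hn t tAB.
  by have [] := Hn t (itv_widen (exprn_ge0 N (ltW r0)) tAB).
have /choice[fA hA] (ij : 'I_m.+1 * 'I_d) :=
  comp _ _ (smooth_net_ipartial [:: jet_index ij.1 ij.2] (gsf_smooth_net 0 DL)).
have /choice[fQ hfQ] j := comp _ _ (gsf_smooth_net j DQ).
have gA ij : tame rho (fun=> setT) (reps_of (gitv t1 t2)) (fA ij) by have [] := hA ij.
have gQ j : tame rho (fun=> setT) (reps_of (gitv t1 t2)) (fQ j) by have [] := hfQ j.
have rA i : represents t1 t2 (fun j => fA (i, j))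
    (fun s => jet_grad t1 t2 i L (jet t1 t2 m q s)).
  move=> t u j It ut; have [_ H _] := hA (i, j).
  have Pu : reps_of (gitv t1 t2) u by exists t.
  apply: (gnum_near _ (H u Pu)).
  exact: (jet_grad_net ht i j DL (jet_in_box m q It) (jet_net ht gq rq It ut)).
have rQ : represents t1 t2 fQ (fun s => Q (jet t1 t2 m q s)).
  move=> t u j It ut; have [_ H _] := hfQ j.
  have Pu : reps_of (gitv t1 t2) u by exists t.
  apply: (gnum_near _ (H u Pu)).
  exact: (gsf_value DQ (jet_in_box m q It) (jet_net ht gq rq It ut) j).
pose EL j e t := \sum_(i < m.+1) (-1) ^+ i * derive1n i (fA (i, j) e) t.
pose E j e t := EL j e t + -1 * fQ j e t.
have gEL j : tame rho (fun=> setT) (reps_of (gitv t1 t2)) (EL j).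
  move=> k; apply: (@tame_upto_sum _ _ _ _ (fun _ _ => openT) (fun _ _ => nearW _ (fun _ => I)) k
    _ (index_enum 'I_m.+1) (fun i e t => (-1) ^+ i * derive1n i (fA (i, j) e) t)) => i.
  apply: tame_uptoM; first exact: (tame_upto_cst _ _ _ (moderate_cst rho ((-1) ^+ i))).
  exact: tameI_deriven.
have gE j : tame rho (fun=> setT) (reps_of (gitv t1 t2)) (E j).
  by apply: tameID => //; apply: tameIM => //; exact: (tameI_cst _ _ (moderate_cst rho (-1))).
suff E0 : forall j u, reps_of (gitv t1 t2) u -> negligible rho (fun e => E j e (u e)).
  move=> t It; apply/rowP => j; have [u ut] := gnum_ex t.
  have Pu : reps_of (gitv t1 t2) u by exists t.
  have n1 : gnum (fun e => EL j e (u e)) ((\sum_(i < m.+1) (-1) ^+ i *: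
      gderive1n (gitv t1 t2) i (fun s => jet_grad t1 t2 i L (jet t1 t2 m q s)) t) 0 j).
    rewrite summxE; apply: gnum_sum => i; rewrite mxE; apply: gnumM; first exact: gnum_sign.
    exact: (gderive1n_net ht i j (fun j => gA (i, j)) (rA i) It ut).
  apply/(gnumP n1 (rQ t u j It ut)).
  by apply: (negligible_le _ (E0 j u Pu)); apply: nearW => e; rewrite /E mulN1r.
apply: (fundamental_lemma ht At Bt AB gE) => w gw wout.
pose fh j e t := E j e t * w e t.
have gh j : tame rho (fun=> setT) (reps_of (gitv t1 t2)) (fh j) by exact: tameIM.
have [h rh] := tameI_fun At Bt AB gh.
have flat j e k : 0 < e <= 1 ->
    derive1n k (fh j e) (A e) = 0 /\ derive1n k (fh j e) (B e) = 0.
  move=> e01; apply: vanishing_derivatives; first exact: AB.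
    by move=> k' t; exact: tameI_derivable.
  by move=> t h'; rewrite /fh wout// mulr0.
have I1 : gitv t1 t2 t1.
  split; last by have [] := ht.
  by apply: (net_gle0 At At); apply: nearW.
have I2 : gitv t1 t2 t2.
  split; first by have [] := ht.
  by apply: (net_gle0 Bt Bt); apply: nearW.
(* The representatives of h vanish outside ]A,B[, so all their derivatives
   vanish at A and B themselves. *)
have hflat : gsf_flat t1 t2 h.
  split.
    by split=> //; exists (fun=> setT), (fun e x => \row_j fh j e (x 0 0)); exact: gsf_of_global.
  move=> k; split; apply/rowP => j; rewrite mxE.
    apply: (gnum_inj (gderive1n_net ht k j gh rh I1 At)).
    apply: (gnum_near (gnum0 rho)); apply: filterS (near_itv01 R) => e e01.
    by have [] := flat j e k e01.
  apply: (gnum_inj (gderive1n_net ht k j gh rh I2 Bt)).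
  apply: (gnum_near (gnum0 rho)); apply: filterS (near_itv01 R) => e e01.
  by have [] := flat j e k e01.
have V := first_variation_net ht At Bt AB DL gq gh rq rh.
rewrite (dAlembert h hflat) in V.
pose g e t := \sum_j fh j e t * fQ j e t.
have gg : tame rho (fun=> setT) (reps_of (gitv t1 t2)) g.
  move=> k; apply: (@tame_upto_sum _ _ _ _ (fun _ _ => openT) (fun _ _ => nearW _ (fun _ => I)) k
    _ (index_enum 'I_d) (fun j e t => fh j e t * fQ j e t)) => j.
  by apply: tame_uptoM; [exact: gh|exact: gQ].
have W := gintegral_net ht At Bt AB
  (f := fun t => dot (h t) (Q (jet t1 t2 m q t))) gg.
have {}W := gnum_eq V (W _).
apply: (negligible_le _ (W _)) => [|t u It ut]; last first.
  by rewrite /dot; apply: gnum_sum => j; apply: gnumM; [exact: rh|exact: rQ].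
have near_A : \forall e \near 0^'+, forall ij t, A e <= t <= B e ->
    fA ij e t = ipartial [:: jet_index ij.1 ij.2] (fun y => FL e y 0 0) (gam e t).
  have H ij : \forall e \near 0^'+, forall t, A e <= t <= B e ->
    fA ij e t = ipartial [:: jet_index ij.1 ij.2] (fun y => FL e y 0 0) (gam e t).
    by have [] := hA ij.
  exact: (@filter_forall _ _ _ _ _ H).
apply: filterS2 (near_itv01 R) near_A => e e01 HA.
(* The two sides of the principle, for the test function E w, differ by the
   integral of the sum of the squares of the E_j times w. *)
suff -> : itvint (A e) (B e) (fun t => \sum_j E j e t * (E j e t * w e t)) =
   \sum_l curve_int A B gam (jet_curve m (fun _ _ => 0) fh)
     (fun e => ipartial [:: l] (fun y => FL e y 0 0))
     (fun e t => jet_curve m (fun _ _ => 0) fh e t 0 l * 1) e 0 - itvint (A e) (B e) (g e).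
  by [].
have cA ij k : cont_on (A e) (B e) (derive1n k (fA ij e)).
  by move=> t _; exact: (tameI_continuous (tameI_deriven k (gA ij)) e01).
have ch j : cont_on (A e) (B e) (fh j e) by move=> t _; exact: tameI_continuous.
have cQ j : cont_on (A e) (B e) (fQ j e) by move=> t _; exact: tameI_continuous.
have cE j : cont_on (A e) (B e) (E j e) by move=> t _; exact: tameI_continuous.
rewrite variation_expand// exchange_big /= /g !itvint_sum; last 2 first.
- by move=> j; exact: cont_onM.
- by move=> j; apply: cont_onM => //; exact: ch.
rewrite -sumrB; apply: eq_bigr => j _.
have -> : \sum_(i < m.+1) itvint (A e) (B e) (fun t =>
      ipartial [:: jet_index i j] (fun y => FL e y 0 0) (gam e t) * derive1n i (fh j e) t) =
    \sum_(i < m.+1) itvint (A e) (B e)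
      (fun t => (-1) ^+ i * (derive1n i (fA (i, j) e) t * fh j e t)).
  apply: eq_bigr => i _; rewrite itvintZ; last by apply: cont_onM.
  rewrite -(itvint_parts_iter AB i (gA (i, j)) (gh j) e01 (fun k => flat j e k e01)).
  by apply: itvint_eq => t tAB; rewrite HA.
rewrite -itvint_sum; last first.
  by move=> i; apply: cont_onM; [exact: cont_on_cst|exact: cont_onM].
have -> : - itvint (A e) (B e) (fun t => fh j e t * fQ j e t) =
    itvint (A e) (B e) (fun t => -1 * (fh j e t * fQ j e t)).
  by rewrite itvintZ ?mulN1r//; exact: cont_onM.
rewrite -itvintD; last 2 first.
- apply: cont_on_sum => i.
  by apply: cont_onM; [exact: cont_on_cst|exact: cont_onM].
- by apply: cont_onM; [exact: cont_on_cst|exact: cont_onM].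
apply: itvint_eq => t _; rewrite -/(fh j e t) {1}/E /EL mulrDl mulr_suml.
congr (_ + _); last by ring.
by apply: eq_bigr => i _; rewrite -mulrA.
Qed.
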